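(* Let $P\subset\mathbb{R}^n$ be a polytope with $0\in\operatorname{int}P$ whose centroid is the origin. Then $$\mathrm{U}(P)\;\ge\;\frac{(n!)^{1/n}}{n}\,\mathrm{V}(P),$$ and equality holds if and only if $P$ is a parallelotope.
   Context: $\mathrm{V}$ denotes $n$-dimensional Lebesgue measure. The centroid of a set $S\subset\mathbb{R}^n$ with $\mathrm{V}(S)>0$ is $\frac{1}{\mathrm{V}(S)}\int_S x\,\mathrm{d}x$. Let $F_1,\dots,F_m$ be the facets ($(n-1)$-dimensional faces) of $P$, let $a_i\in S^{n-1}$ be the outer unit normal of $F_i$, and let $C_i=\operatorname{conv}(\{0\}\cup F_i)$. The functional $\mathrm{U}(P)\ge 0$ is defined by $$\mathrm{U}(P)^n=\sum_{(i_1,\dots,i_n)}\mathrm{V}(C_{i_1})\cdots\mathrm{V}(C_{i_n}),$$ where the sum is over all ordered $n$-tuples $(i_1,\dots,i_n)\in\{1,\dots,m\}^n$ such that $a_{i_1},\dots,a_{i_n}$ are linearly independent (i.e. $a_{i_1}\wedge\cdots\wedge a_{i_n}\neq0$). A parallelotope in $\mathbb{R}^n$ is the image of the cube $[0,1]^n$ under an invertible affine map. *)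

(* Defs.v *)
From HB Require Import structures.
From mathcomp Require Import all_boot all_order all_algebra finmap.
From mathcomp Require Import all_classical all_reals all_analysis.
From mathcomp Require Import ring lra.

Set Implicit Arguments.
Unset Strict Implicit.
Unset Printing Implicit Defensive.

Import Order.TTheory GRing.Theory Num.Theory.
Import numFieldNormedType.Exports.

Local Open Scope classical_set_scope.
Local Open Scope ring_scope.
Local Open Scope convex_scope.

Section lebesgue_rV.
Context {R : realType}.

Definition rV_coord n (i : 'I_n) (x : 'rV[R]_n) : R := x ord0 i.

(* The sigma-algebra generated by the coordinates, that is, the Borel one. *)
Section rV_measurable.
Variable n : nat.

Let rV_set0 : g_sigma_preimage (@rV_coord n) set0.
Proof. exact: sigma_algebra0. Qed.

Let rV_setC A : g_sigma_preimage (@rV_coord n) A ->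
  g_sigma_preimage (@rV_coord n) (~` A).
Proof. exact: sigma_algebraC. Qed.

Let rV_bigcup (F : _^nat) : (forall i, g_sigma_preimage (@rV_coord n) (F i)) ->
  g_sigma_preimage (@rV_coord n) (\bigcup_i (F i)).
Proof. exact: sigma_algebra_bigcup. Qed.

HB.instance Definition _ := @isMeasurable.Build default_measure_display
  'rV[R]_n (g_sigma_preimage (@rV_coord n)) rV_set0 rV_setC rV_bigcup.

End rV_measurable.

Definition rV_cons n (p : measurableTypeR R * 'rV[R]_n) : 'rV[R]_n.+1 :=
  row_mx ((p.1 : R)%:M : 'rV[R]_1) p.2.

(* The n-fold product of the Lebesgue measure on R; see lebesgue_rV_box. *)
Fixpoint lebesgue_rV n : set 'rV[R]_n -> \bar R :=
  match n return set 'rV[R]_n -> \bar R with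
  | 0 => \d_(0 : 'rV[R]_0)
  | n'.+1 => pushforward (lebesgue_measure \x @lebesgue_rV n')%E (@rV_cons n')
  end.
Arguments lebesgue_rV : clear implicits.

Lemma rV_cons0 n (p : R * 'rV[R]_n) : rV_cons p ord0 ord0 = p.1.
Proof.
have -> : (ord0 : 'I_n.+1) = lshift n (ord0 : 'I_1) by exact/val_inj.
by rewrite (row_mxEl (p.1%:M : 'rV[R]_1) p.2) mxE eqxx mulr1n.
Qed.

Lemma rV_consS n (p : R * 'rV[R]_n) i :
  rV_cons p ord0 (lift ord0 i) = p.2 ord0 i.
Proof.
have -> : lift ord0 i = rshift 1 i by exact/val_inj.
exact: (row_mxEr (p.1%:M : 'rV[R]_1) p.2).
Qed.

Lemma measurable_rV_coord n (i : 'I_n) : measurable_fun setT (@rV_coord n i).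
Proof.
move=> _ Y mY; rewrite setTI; apply: sub_sigma_algebra => /=.
rewrite -bigcup_seq/=; exists i => /=; first by rewrite mem_index_enum.
by exists Y => //; rewrite setTI.
Qed.

Lemma measurable_fun_rVP d (T : measurableType d) n (f : T -> 'rV[R]_n) :
  measurable_fun setT f <->
  forall i, measurable_fun setT (@rV_coord n i \o f).
Proof.
split=> [mf i|mf].
  by apply: measurableT_comp => //; exact: measurable_rV_coord.
suff H : g_sigma_preimage (fun i => @rV_coord n i \o f) `<=` measurable.
  by move=> _ A mA; apply: H; rewrite g_sigma_preimage_comp; exists A.
apply: smallest_sub; first exact: sigma_algebra_measurable.
rewrite -bigcup_seq/=; apply: bigcup_sub => i _ A [B mB <-].
exact: mf.
Qed.

Lemma measurable_rV_cons n : measurable_fun setT (@rV_cons n).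
Proof.
apply/measurable_fun_rVP => i; have [j ->|->] := unliftP ord0 i.
  rewrite (_ : _ \o _ = @rV_coord n j \o snd).
    by apply: measurableT_comp => //; exact: measurable_rV_coord.
  by apply/funext => p /=; exact: rV_consS.
rewrite (_ : _ \o _ = fst); first exact: measurable_fst.
by apply/funext => p /=; exact: rV_cons0.
Qed.

Definition rV_uncons n (x : 'rV[R]_n.+1) : measurableTypeR R * 'rV[R]_n :=
  (x ord0 ord0, \row_i x ord0 (lift ord0 i)).

Lemma rV_consK n : cancel (@rV_cons n) (@rV_uncons n).
Proof.
move=> p; rewrite /rV_uncons rV_cons0 [RHS]surjective_pairing; congr pair.
by apply/rowP => i; rewrite mxE rV_consS.
Qed.

Lemma measurable_rV_uncons n : measurable_fun setT (@rV_uncons n).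
Proof.
apply/measurable_fun_pairP; split; first exact: (@measurable_rV_coord n.+1).
apply/measurable_fun_rVP => i.
rewrite (_ : _ \o _ = @rV_coord n.+1 (lift ord0 i)).
  exact: measurable_rV_coord.
by apply/funext => x; rewrite /= /rV_coord mxE.
Qed.

Lemma rV_cons_sigma_finite n (mu : {sigma_finite_measure set 'rV[R]_n -> \bar R}) :
  sigma_finite setT (pushforward (lebesgue_measure \x mu)%E (@rV_cons n)).
Proof.
have /sigma_finiteP[F [TF ndF Foo]] := sigma_finiteT (@lebesgue_measure R).
have /sigma_finiteP[G [TG ndG Goo]] := sigma_finiteT mu.
exists (fun k => @rV_uncons n @^-1` (F k `*` G k)).
  rewrite -preimage_bigcup (_ : \bigcup_k _ = setT) ?preimage_setT//.
  rewrite -setXTT TF TG predeqE => -[x y]; split.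
    by move=> [k _ []/= ? ?]; split; exists k.
  move=> [/= [k _ Fkx] [l _ Gly]]; exists (maxn k l) => //; split.
    by move: x Fkx; exact/subsetPset/ndF/leq_maxl.
  by move: y Gly; exact/subsetPset/ndG/leq_maxr.
move=> k; have [mF Fk] := Foo k; have [mG Gk] := Goo k; split.
  rewrite -[X in measurable X]setTI; apply: measurable_rV_uncons => //.
  exact: measurableX.
rewrite /pushforward (_ : _ @^-1` _ = F k `*` G k); last first.
  rewrite -comp_preimage (_ : _ \o _ = id) ?preimage_id//.
  by apply/funext => p; exact: rV_consK.
by rewrite product_measure1E// lte_mul_pinfty// ge0_fin_numE.
Qed.

Lemma lebesgue_rV_subproof n : [/\ lebesgue_rV n set0 = 0%E,
  forall A : set 'rV[R]_n, (0 <= lebesgue_rV n A)%E,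
  semi_sigma_additive (lebesgue_rV n) & sigma_finite setT (lebesgue_rV n)].
Proof.
elim: n => [|n [mu0 mu_ge0 mu_add mu_fin]].
  split; [exact: measure0|by move=> A; exact: measure_ge0|
          exact: measure_semi_sigma_additive|exact: sigma_finiteT].
pose iM := isMeasure.Build _ _ _ (lebesgue_rV n) mu0 mu_ge0 mu_add.
pose m : {measure set 'rV[R]_n -> \bar R} := HB.pack (lebesgue_rV n) iM.
pose iF := Measure_isSigmaFinite.Build _ _ _ m mu_fin.
pose mu : {sigma_finite_measure set 'rV[R]_n -> \bar R} :=
  HB.pack (lebesgue_rV n) iM iF.
have mc := @measurable_rV_cons n.
pose nu : {measure set 'rV[R]_n.+1 -> \bar R} :=
  measure_function_pushforward__canonical__measure_function_Measure (lebesgue_measure \x mu)%E mc.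
rewrite (_ : lebesgue_rV n.+1 = nu)//; split.
- exact: measure0.
- by move=> A; exact: measure_ge0.
- exact: measure_semi_sigma_additive.
- exact: (rV_cons_sigma_finite mu).
Qed.

HB.instance Definition _ n := isMeasure.Build _ _ _ (lebesgue_rV n)
  (let: And4 h _ _ _ := lebesgue_rV_subproof n in h)
  (let: And4 _ h _ _ := lebesgue_rV_subproof n in h)
  (let: And4 _ _ h _ := lebesgue_rV_subproof n in h).

HB.instance Definition _ n := Measure_isSigmaFinite.Build _ _ _ (lebesgue_rV n)
  (let: And4 _ _ _ h := lebesgue_rV_subproof n in h).

Lemma measurable_rV_box n (A : 'I_n -> set R) : (forall i, measurable (A i)) ->
  measurable [set x : 'rV[R]_n | forall i, A i (x ord0 i)].
Proof.
move=> mA; rewrite (_ : [set _ | _] = \bigcap_i (@rV_coord n i @^-1` A i)).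
  apply: fin_bigcap_measurable => // i _; rewrite -[X in measurable X]setTI.
  exact: measurable_rV_coord.
by apply/seteqP; split => x /= Ax i; [move=> _|]; exact: Ax.
Qed.

Lemma lebesgue_rV_box n (A : 'I_n -> set R) : (forall i, measurable (A i)) ->
  lebesgue_rV n [set x : 'rV[R]_n | forall i, A i (x ord0 i)] =
  (\prod_(i < n) lebesgue_measure (A i))%E.
Proof.
elim: n A => [A _|n IH A mA].
  rewrite big_ord0 (_ : [set _ | _] = setT); first by rewrite /= diracT.
  by apply/seteqP; split => // x _ [].
rewrite big_ord_recl -IH//.
have mB := measurable_rV_box (fun i => mA (lift ord0 i)).
rewrite /= /pushforward; set B := (X in lebesgue_rV n X) in mB *.
transitivity ((lebesgue_measure \x lebesgue_rV n)%E (A ord0 `*` B)); last first.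
  exact: (product_measure1E lebesgue_measure (lebesgue_rV n) (mA ord0) mB).
congr (product_measure1 _ _ _).
apply/seteqP; split=> p /=.
  move=> Ap; split=> /=; first by have := Ap ord0; rewrite rV_cons0.
  by move=> i; have := Ap (lift ord0 i); rewrite rV_consS.
move=> [p1 p2] i; have [j ->|->] := unliftP ord0 i; last by rewrite rV_cons0.
by rewrite rV_consS; exact: p2.
Qed.

End lebesgue_rV.
Arguments lebesgue_rV {R} n.

Section polytopes.
Context {R : realType} {n : nat}.
Implicit Types (P S F : set 'rV[R]_n) (a u x y : 'rV[R]_n).

Definition vol S : R := fine (lebesgue_rV n S).

Definition centroid S : 'rV[R]_n :=
  (vol S)^-1 *: \row_j (\int[lebesgue_rV n]_(x in S) x ord0 j)%R.

Definition dotp x y : R := \sum_i x ord0 i * y ord0 i.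

Definition conv_hull S : set 'rV[R]_n :=
  smallest [set K | convex_set (K : set (convex_lmodType 'rV[R]_n))] S.

Definition aff_hull S : set 'rV[R]_n :=
  [set x | exists k (p : 'I_k -> 'rV[R]_n) (w : 'I_k -> R),
    [/\ forall i, S (p i), \sum_i w i = 1 & x = \sum_i w i *: p i]].

Definition has_dim S (d : nat) : Prop :=
  exists (x0 : 'rV[R]_n) (L : {vspace 'rV[R]_n}),
    aff_hull S = [set x | x - x0 \in L] /\ \dim L = d.

Definition polytope P : Prop := exists2 A, finite_set A & P = conv_hull A.

(* [F] is the subset of [P] on which the valid inequality [dotp u x <= c] is
   tight; [u = 0] gives the improper faces [P] and [set0]. *)
Definition exposed_by P u (c : R) F : Prop :=
  (forall x, P x -> dotp u x <= c) /\ F = P `&` [set x | dotp u x = c].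

Definition face P F : Prop := exists u c, exposed_by P u c F.

Definition facet P F : Prop := face P F /\ has_dim F n.-1.

Definition outer_unit_normal P F a : Prop :=
  dotp a a = 1 /\ exists c, exposed_by P a c F.

Definition cone0 F : set 'rV[R]_n := conv_hull (0 |` F).

(* The outer unit normal of a facet of a full-dimensional polytope is unique.
   An index tuple (i_1, ..., i_n) is represented by the function mapping k to
   the facet F_(i_k), and the normals of these facets by the rows of [A]. *)
Definition indep_facets P : set ('I_n -> set 'rV[R]_n) :=
  [set F | (forall k, facet P (F k)) /\
    exists A : 'M[R]_n,
      (forall k, outer_unit_normal P (F k) (row k A)) /\ row_free A].

(* The sum is finite by finite_indep_facets below. *)
Definition Ufun P : R :=
  (\sum_(F \in indep_facets P) \prod_k vol (cone0 (F k))) `^ n%:R^-1.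

Definition unit_cube : set 'rV[R]_n :=
  [set x | forall i, 0 <= x ord0 i <= 1].

Definition parallelotope P : Prop :=
  exists (L : 'M[R]_n) (b : 'rV[R]_n),
    L \in unitmx /\ P = [set x *m L + b | x in unit_cube].

Lemma dotp_conv u x y (k : {i01 R}) :
  dotp u ((x : convex_lmodType _) <| k |> y) =
  (k%:num : R) * dotp u x + (1 - k%:num) * dotp u y.
Proof.
rewrite (_ : (x : convex_lmodType _) <| k |> y =
  k%:num *: x + (1 - k%:num) *: y :> 'rV[R]_n)//.
rewrite /dotp !mulr_sumr -big_split/=; apply: eq_bigr => i _.
by rewrite !mxE; ring.
Qed.

Lemma conv_hull_convex S : convex_set (conv_hull S : set (convex_lmodType _)).
Proof.
move=> x y k; rewrite !inE => Kx Ky K [cK SK].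
have := cK x y k; rewrite !inE; apply; [exact: Kx|exact: Ky].
Qed.

Lemma conv_hull_face A u c F : exposed_by (conv_hull A) u c F ->
  F = conv_hull (A `&` F).
Proof.
move=> [hle FE]; apply/seteqP; split; last first.
  apply: smallest_sub; last by move=> x [].
  move=> x y k; rewrite FE !inE => -[Kx /= xc] [Ky /= yc]; split.
    by have := @conv_hull_convex A x y k; rewrite !inE; apply.
  by rewrite /= dotp_conv xc yc; ring.
suff H : conv_hull A `<=` [set x | conv_hull A x /\
    (dotp u x = c -> conv_hull (A `&` F) x)].
  move=> x Fx; have [Kx xc] : (conv_hull A `&` [set x | dotp u x = c]) x.
    by rewrite -FE.
  by have [_] := H x Kx; exact.
apply: smallest_sub; last first.
  move=> x Ax; split; first exact: sub_smallest Ax.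
  move=> xc; suff : (A `&` F) x by exact: sub_smallest.
  split => //; rewrite FE; split => //; exact: sub_smallest Ax.
apply/convex_setW => x y /set_mem/=[Kx xF] /set_mem/=[Ky yF] k k0 k1.
apply/mem_set.
have cA := @conv_hull_convex A x y k; split.
  by move: cA; rewrite !inE; apply.
rewrite dotp_conv => kc.
have [xc yc] : dotp u x = c /\ dotp u y = c.
  have := hle x Kx; have := hle y Ky; nra.
have := @conv_hull_convex (A `&` F) x y k; rewrite !inE.
by apply; [exact: xF|exact: yF].
Qed.

Lemma finite_facets P : polytope P -> finite_set (facet P).
Proof.
move=> [A finA PE].
apply: (@sub_finite_set _ _ [set conv_hull B | B in [set B | B `<=` A]]).
  move=> F [[u [c]]]; rewrite PE => /conv_hull_face FE _.
  by exists (A `&` F) => //; apply: subIsetl.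
apply: finite_image.
rewrite (_ : [set _ | _] = [set [set` B] | B in [set` fpowerset (fset_set A)]]).
  by apply: finite_image; exact: finite_fset.
apply/seteqP; split => [B BA|_ [B /= + <-]].
  have finB : finite_set B by exact: sub_finite_set finA.
  exists (fset_set B); last by rewrite fset_setK.
  rewrite /= fpowersetE; apply/fsubsetP => x; rewrite !in_fset_set// !inE.
  exact: BA.
rewrite fpowersetE => /fsubsetP BA x /= /BA.
by rewrite in_fset_set// inE.
Qed.

Lemma finite_indep_facets P : polytope P -> finite_set (indep_facets P).
Proof.
move=> /finite_facets finF; pose X := fset_set (facet P).
apply: (@sub_finite_set _ _
  [set (fun k => fsval (f k)) | f in [set: {ffun 'I_n -> X}]]); last first.
  by apply: finite_image; exact: finite_finset.
move=> F [facF _].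
have FX k : F k \in X by rewrite in_fset_set// inE.
exists [ffun k => [` FX k]%fset] => //.
by apply/funext => k; rewrite ffunE.
Qed.

End polytopes.

(* Main.v *)
Require Import Defs.
From HB Require Import structures.
From mathcomp Require Import all_boot all_order all_algebra finmap.
From mathcomp Require Import all_classical all_reals all_analysis measurable_realfun.
From mathcomp Require Import ring lra.
Import Order.TTheory GRing.Theory Num.Theory.
Import numFieldNormedType.Exports.
Local Open Scope classical_set_scope.
Local Open Scope ring_scope.

Set Implicit Arguments.
Unset Strict Implicit.
Unset Printing Implicit Defensive.

(* Idea. Write [w F] for the volume of the cone [conv (0 |` F)] over a facet
   [F = P `&` [set x | dotp u x = 1]].
   If a linear subspace [U] of dimension [d] contains the functionals [u_i] of
   some facets [F_i] and [0 < l < 1], then the convex sets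
   [P_l = [set x in P | u_i x <= l for all i]] satisfy
   [(1 - l ^+ n) * \sum_i w F_i <= vol (P `\` P_l) <= (1 - l ^+ d) * vol P].
   On the left, the part of the cone over [F_i] where [u_i > l] misses [P_l]. On
   the right, the volume [f y] of the fibre of [P] over a point [y] of [U] is
   log-concave by Prekopa's theorem; with a supergradient [g] of [ln f] at the
   centroid [0] one gets [f (l *: y) >= f y * (1 - (1 - l) * dotp g y)], and the
   linear term integrates to [0]. Letting [l] tend to [1] yields the subspace
   concentration inequality [\sum_i w F_i <= d / n * vol P].
   Choosing the facets of an [n]-tuple one after the other, the inequality bounds
   from below the weight of the tuples with independent functionals by
   [\prod_(k < n) ((1 - k / n) * vol P)]. Equality forces every line spanned by a
   functional to carry the weight [vol P / n], which leaves exactly [n] lines and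
   makes [P] a parallelotope; conversely the functionals of a parallelotope lie on
   [n] lines, each of weight at most [vol P / n]. *)

(** * Linear changes of variables in Lebesgue integrals *)

Section measure_facts.
Context {R : realType}.
Local Open Scope ereal_scope.
Notation lebR := (@lebesgue_measure R).

(** The linear map that multiplies the coordinates given by [U] by [l] and fixes the complementary
    ones need not send [P] into itself, so [P_l] contains no evident copy of [P]. Only fibre volumes
    can be compared, and this is why log-concavity and the position of the centroid enter.
    Functionals equal to 1 on their facet replace the unit normals: [dotp u x] is then a radial
    coordinate on the cone, cutting the cone at level [l] is scaling it by [l], and linear
    independence is unaffected. Equality is decided inside finite sums. The product bound is a chain
    of inequalities between the weights of independent [k]-tuples and [k+1]-tuples, and equality at
    the end forces equality in every link; the link at [k = 0] gives the total weight, the link at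
    [k = 1] the weight of each line. The measure is an iterated product, so the change of variables,
    the nullity of hyperplanes and the log-concavity of fibre volumes are all obtained by peeling
    off one coordinate at a time. *)

Lemma lebesgue_measure_affine (a b : R) (A : set (measurableTypeR R)) :
  a != 0%R -> measurable A ->
  lebR A = `|a|%:E * lebR ((fun t : R => (a * t + b)%R) @^-1` A).
Proof.
move=> a0 mA.
have mf : measurable_fun setT
    (fun t : measurableTypeR R => (a * t + b)%R : measurableTypeR R).
  by apply: measurable_funD => //; exact: measurable_funM.
pose nu := measure_function_pushforward__canonical__measure_function_Measure
  lebR mf.
have na : (0 <= `|a|)%R by [].
rewrite (@lebesgue_measure_unique _ (mscale (NngNum na) nu))//.
move=> _ [[x y]] _ <-; rewrite lebesgue_measure_itv/= lte_fin.
change (mscale (NngNum na) nu `]x, y]%classic) with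
  (`|a|%:E * lebR ((fun t : R => (a * t + b)%R) @^-1` `]x, y]%classic)).
(* The sign of [a] decides which end of the preimage of []x, y]] is closed. *)
case: (ltgtP a 0%R) a0 => // {}a0 _.
- rewrite (_ : _ @^-1` _ = `[((y - b) / a)%R, ((x - b) / a)%R[%classic); last first.
    apply/seteqP; split => t; rewrite /= !in_itv/= ler_ndivrMr// ltr_ndivlMr//.
      by move=> /andP[? ?]; apply/andP; split; lra.
    by move=> /andP[? ?]; apply/andP; split; lra.
  rewrite lebesgue_measure_itv/= lte_fin ltr_ndivrMr// divfK ?lt_eqF//.
  rewrite ltrBlDr subrK; case: ifPn => xy; last by rewrite mule0.
  rewrite -EFinD -EFinM; congr EFin; rewrite ltr0_norm//; field.
  by rewrite lt_eqF.
- rewrite (_ : _ @^-1` _ = `]((x - b) / a)%R, ((y - b) / a)%R]%classic); last first.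
    apply/seteqP; split => t; rewrite /= !in_itv/= ltr_pdivrMr// ler_pdivlMr//.
      by move=> /andP[? ?]; apply/andP; split; lra.
    by move=> /andP[? ?]; apply/andP; split; lra.
  rewrite lebesgue_measure_itv/= lte_fin ltr_pdivrMr// divfK ?gt_eqF//.
  rewrite ltrBlDr subrK; case: ifPn => xy; last by rewrite mule0.
  rewrite -EFinD -EFinM; congr EFin; rewrite gtr0_norm//; field.
  by rewrite gt_eqF.
Qed.

Lemma ge0_integral_affine (a b : R) (f : measurableTypeR R -> \bar R) :
  a != 0%R -> measurable_fun setT f -> (forall t, 0 <= f t) ->
  \int[lebR]_t f t = `|a|%:E * \int[lebR]_t f (a * t + b)%R.
Proof.
move=> a0 mf f0.
have mg : measurable_fun setT
    (fun t : measurableTypeR R => (a * t + b)%R : measurableTypeR R).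
  by apply: measurable_funD => //; exact: measurable_funM.
have na : (0 <= `|a|)%R by [].
pose nu := measure_function_pushforward__canonical__measure_function_Measure
  lebR mg.
rewrite (eq_measure_integral (mscale (NngNum na) nu)); last first.
  by move=> A mA _; have := lebesgue_measure_affine b a0 mA.
rewrite ge0_integral_mscale//=; congr (_ * _).
rewrite (eq_measure_integral (pushforward lebR
  (fun t : measurableTypeR R => (a * t + b)%R : measurableTypeR R)))//.
by rewrite ge0_integral_pushforward.
Qed.

Lemma ge0_integral_rV_cons n (f : 'rV[R]_n.+1 -> \bar R) :
  measurable_fun setT f -> (forall x, 0 <= f x) ->
  \int[lebesgue_rV n.+1]_x f x =
  \int[lebR]_t \int[lebesgue_rV n]_x f (rV_cons (t, x)).
Proof.
move=> mf f0; have mc := @measurable_rV_cons R n.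
rewrite (eq_measure_integral (pushforward (lebR \x lebesgue_rV n) (@rV_cons R n)))//.
rewrite ge0_integral_pushforward// preimage_setT.
have mg : measurable_fun setT (f \o @rV_cons R n) by exact: measurableT_comp.
by rewrite (fubini_tonelli1 (f \o @rV_cons R n))//= => x; exact: f0.
Qed.

Lemma ge0_integral_rV_consC n (f : 'rV[R]_n.+1 -> \bar R) :
  measurable_fun setT f -> (forall x, 0 <= f x) ->
  \int[lebesgue_rV n.+1]_x f x =
  \int[lebesgue_rV n]_x \int[lebR]_t f (rV_cons (t, x)).
Proof.
move=> mf f0; rewrite ge0_integral_rV_cons//.
have mg : measurable_fun setT (f \o @rV_cons R n).
  by apply: measurableT_comp => //; exact: measurable_rV_cons.
by rewrite (fubini_tonelli (f \o @rV_cons R n))//= => x; exact: f0.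
Qed.

Lemma measurable_integral_rV_consl n (f : 'rV[R]_n.+1 -> \bar R) :
  measurable_fun setT f -> (forall x, 0 <= f x) ->
  measurable_fun setT (fun x : 'rV[R]_n => \int[lebR]_t f (rV_cons (t, x))).
Proof.
move=> mf f0.
apply: (measurable_fun_fubini_tonelli_G (m1 := lebR) (f \o @rV_cons R n)).
  by apply: measurableT_comp => //; exact: measurable_rV_cons.
by move=> x; exact: f0.
Qed.

Lemma measurable_integral_rV_consr n (f : 'rV[R]_n.+1 -> \bar R) :
  measurable_fun setT f -> (forall x, 0 <= f x) ->
  measurable_fun setT
    (fun t : measurableTypeR R => \int[lebesgue_rV n]_x f (rV_cons (t, x))).
Proof.
move=> mf f0.
apply: (measurable_fun_fubini_tonelli_F (m2 := lebesgue_rV n)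
  (f \o @rV_cons R n)).
  by apply: measurableT_comp => //; exact: measurable_rV_cons.
by move=> x; exact: f0.
Qed.

Lemma measurable_rV_comb n (c : 'I_n -> R) (b : R) :
  measurable_fun setT (fun x : 'rV[R]_n => (\sum_i x ord0 i * c i + b)%R).
Proof.
apply: measurable_funD => //; apply: measurable_sum => i.
by apply: measurable_funM => //; exact: measurable_rV_coord.
Qed.

Lemma measurable_affine m n (M : 'M[R]_(m, n)) (b : 'rV[R]_n) :
  measurable_fun setT (fun x : 'rV[R]_m => x *m M + b)%R.
Proof.
apply/measurable_fun_rVP => i.
rewrite (_ : _ \o _ = fun x : 'rV[R]_m => (\sum_j x ord0 j * M j i + b ord0 i)%R).
  exact: measurable_rV_comb.
by apply/funext => x /=; rewrite /rV_coord !mxE.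
Qed.

Lemma measurable_mulmx m n (M : 'M[R]_(m, n)) :
  measurable_fun setT (fun x : 'rV[R]_m => x *m M)%R.
Proof.
have := @measurable_affine m n M 0.
by under eq_fun do rewrite addr0.
Qed.

Lemma measurable_addrV n (b : 'rV[R]_n) :
  measurable_fun setT (fun x : 'rV[R]_n => x + b)%R.
Proof.
have := @measurable_affine n n 1%:M b.
by under eq_fun do rewrite mulmx1.
Qed.

Lemma rV_consD n (t : R) (x b : 'rV[R]_n) (s : R) :
  (rV_cons (t, x) + rV_cons (s, b) = rV_cons (t + s, x + b) :> 'rV[R]_n.+1)%R.
Proof.
by rewrite /rV_cons/= raddfD/= -add_row_mx.
Qed.

Lemma rV_unconsK n (x : 'rV[R]_n.+1) : rV_cons (rV_uncons x) = x.
Proof.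
apply/rowP => i; have [j ->|->] := unliftP ord0 i.
  by rewrite rV_consS mxE.
by rewrite rV_cons0.
Qed.

Lemma measurable_rV_cons2 n (t : R) : measurable_fun setT
  (fun x : 'rV[R]_n => rV_cons (t, x)).
Proof.
apply: measurableT_comp; first exact: measurable_rV_cons.
exact: pair1_measurable.
Qed.

Lemma measurable_rV_cons1 n (x : 'rV[R]_n) : measurable_fun setT
  (fun t : measurableTypeR R => rV_cons (t, x)).
Proof.
apply: measurableT_comp; first exact: measurable_rV_cons.
exact: pair2_measurable.
Qed.

Lemma ge0_integral_rV_shift n (b : 'rV[R]_n) (f : 'rV[R]_n -> \bar R) :
  measurable_fun setT f -> (forall x, 0 <= f x) ->
  \int[lebesgue_rV n]_x f (x + b)%R = \int[lebesgue_rV n]_x f x.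
Proof.
elim: n b f => [|n IH] b f mf f0.
  by apply: eq_integral => x _; rewrite (thinmx0 b) addr0.
have mfb : measurable_fun setT (fun x : 'rV[R]_n.+1 => f (x + b)%R).
  by apply: measurableT_comp => //; exact: measurable_addrV.
rewrite ge0_integral_rV_consC// [RHS]ge0_integral_rV_cons//.
have [s b'] := rV_uncons b; rewrite -(rV_unconsK b); move: (rV_uncons b).
move=> {s b' mfb} [s b'].
under eq_integral do under eq_integral do rewrite rV_consD.
have mg x : measurable_fun setT (fun t : measurableTypeR R => f (rV_cons (t, x))).
  by apply: measurableT_comp => //; exact: measurable_rV_cons1.
transitivity (\int[lebesgue_rV n]_x \int[lebR]_t f (rV_cons (t, x + b')%R)).
  apply: eq_integral => x _.
  rewrite [RHS](@ge0_integral_affine 1 s (fun t => f (rV_cons (t, x + b')%R)))//.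
  by rewrite normr1 mul1e; apply: eq_integral => t _; rewrite mul1r.
rewrite (IH b' (fun x => \int[lebR]_t f (rV_cons (t, x)))).
- by rewrite -ge0_integral_rV_consC// ge0_integral_rV_cons.
- exact: measurable_integral_rV_consl.
- by move=> x; exact: integral_ge0.
Qed.

Local Close Scope ereal_scope.

(** Quantifies over nonnegative functions, not only sets, so that the property is multiplicative in
    [M] and can be used inside an iterated integral. *)
Definition scales_integral n (M : 'M[R]_n) := forall f : 'rV[R]_n -> \bar R,
  measurable_fun setT f -> (forall x, 0 <= f x)%E ->
  (\int[lebesgue_rV n]_x f x =
    `|\det M|%:E * \int[lebesgue_rV n]_x f (x *m M)%R)%E.

Lemma scales_integralM n (M N : 'M[R]_n) :
  scales_integral M -> scales_integral N -> scales_integral (M *m N)%R.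
Proof.
move=> sM sN f mf f0; rewrite det_mulmx normrM mulrC EFinM -muleA.
rewrite sN//; congr (_ * _)%E.
rewrite (sM (fun x => f (x *m N)%R))//.
  by under [in RHS]eq_integral do rewrite mulmxA.
by apply: measurableT_comp => //; exact: measurable_mulmx.
Qed.

(** The matrix sends [(t, x)] to [(a t + x c, x)]: for fixed [x], an affine substitution in the
    first coordinate, which is therefore integrated innermost. *)
Lemma scales_integral_lblock n (a : R) (c : 'cV[R]_n) : a != 0%R ->
  @scales_integral n.+1 (block_mx (a%:M : 'M[R]_1) (0 : 'M[R]_(1, n)) c 1%:M).
Proof.
move=> a0 f mf f0.
have mfM : measurable_fun setT (fun x : 'rV[R]_n.+1 =>
    f (x *m block_mx (a%:M : 'M[R]_1) (0 : 'M[R]_(1, n)) c 1%:M)%R).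
  by apply: measurableT_comp => //; exact: measurable_mulmx.
rewrite (@det_lblock _ 1 n) det_scalar1 det1 mulr1.
rewrite ge0_integral_rV_consC// [in RHS]ge0_integral_rV_consC//.
rewrite -ge0_integralZl//; last 2 first.
- by apply: (measurable_integral_rV_consl mfM) => x; exact: f0.
- by move=> x _; exact: integral_ge0.
apply: eq_integral => x _.
rewrite (@ge0_integral_affine a ((x *m c) ord0 ord0))//; last first.
  by apply: measurableT_comp => //; exact: measurable_rV_cons1.
congr (_ * _)%E; apply: eq_integral => t _; congr f.
rewrite /rV_cons/= (@mul_row_block _ 1 1 n 1 n) mulmx0 add0r mulmx1.
congr (@row_mx _ 1 1 n); apply/matrixP => i j; rewrite !ord1 !mxE.
by rewrite big_ord1 !mxE !eqxx !mulr1n mulrC.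
Qed.

(** The matrix sends [(t, x)] to [(t, t r + x D)]: for fixed [t], the map [D] followed by a
    translation. *)
Lemma scales_integral_ublock n (r : 'rV[R]_n) (D : 'M[R]_n) :
  scales_integral D ->
  @scales_integral n.+1 (block_mx (1%:M : 'M[R]_1) r (0 : 'M[R]_(n, 1)) D).
Proof.
move=> sD f mf f0.
have mfM : measurable_fun setT (fun x : 'rV[R]_n.+1 =>
    f (x *m block_mx (1%:M : 'M[R]_1) r (0 : 'M[R]_(n, 1)) D)%R).
  by apply: measurableT_comp => //; exact: measurable_mulmx.
rewrite (@det_ublock _ 1 n) det1 mul1r.
rewrite ge0_integral_rV_cons// [in RHS]ge0_integral_rV_cons//.
rewrite -ge0_integralZl//; last 2 first.
- by apply: (measurable_integral_rV_consr mfM) => x; exact: f0.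
- by move=> x _; exact: integral_ge0.
apply: eq_integral => t _.
rewrite -(@ge0_integral_rV_shift _ (t *: r)%R)//; last first.
  by apply: measurableT_comp => //; exact: measurable_rV_cons2.
rewrite sD//; last first.
  apply: (@measurableT_comp _ _ _ _ _ _ (fun x => f (rV_cons (t, x)))).
    by apply: measurableT_comp => //; exact: measurable_rV_cons2.
  exact: measurable_addrV.
congr (_ * _)%E; apply: eq_integral => x _; congr f.
rewrite /rV_cons/= (@mul_row_block _ 1 1 n 1 n) mulmx0 addr0 mulmx1.
by rewrite mul_scalar_mx addrC.
Qed.

Lemma scales_integral1 n : scales_integral (1%:M : 'M[R]_n).
Proof.
move=> f mf f0; rewrite det1 normr1 mul1e.
by apply: eq_integral => x _; rewrite mulmx1.
Qed.

(** Gaussian elimination: a nonzero corner entry gives a factorization into a lower and an upper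
    block-triangular matrix, the latter carrying the Schur complement, to which the induction
    applies. *)
Lemma ge0_integral_mulmx n (M : 'M[R]_n) : M \in unitmx -> scales_integral M.
Proof.
elim: n M => [|n IH] M uM.
  by rewrite (flatmx0 M) -(flatmx0 (1%:M)); exact: scales_integral1.
have main (N : 'M[R]_(1 + n)) : N \in unitmx -> N ord0 ord0 != 0%R ->
    @scales_integral n.+1 N.
  move=> uN a0; rewrite -(submxK N); set a := ulsubmx N.
  have ea : a = (N ord0 ord0)%:M.
    apply/matrixP => i j; rewrite !ord1 !mxE eqxx mulr1n.
    by congr (N _ _); exact/val_inj.
  set b := ursubmx N; set c := dlsubmx N; set d := drsubmx N.
  set u := N ord0 ord0 in a0 ea.
  have NE : block_mx a b c d =
    (block_mx (u%:M : 'M[R]_1) (0 : 'M[R]_(1, n)) c 1%:M) *m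
    (block_mx (1%:M : 'M[R]_1) (u^-1 *: b) (0 : 'M[R]_(n, 1)) (d - c *m (u^-1 *: b))).
    rewrite mulmx_block !mulmx0 !mul0mx !mulmx1 !mul1mx !addr0 ea.
    by rewrite mul_scalar_mx scalerA mulfV// scale1r addrC subrK.
  rewrite NE; apply: scales_integralM; first exact: scales_integral_lblock.
  apply: scales_integral_ublock; apply: IH.
  have : \det N != 0%R by rewrite -unitfE -unitmxE.
  rewrite -(submxK N) -/a -/b -/c -/d NE det_mulmx (@det_ublock _ 1 n) det1 mul1r.
  by rewrite mulf_eq0 negb_or unitmxE unitfE => /andP[].
have [M00|M00] := eqVneq (M ord0 ord0) 0%R; last exact: main.
have [i Mi0] : exists i, M (lift ord0 i) ord0 != 0%R.
  apply/not_existsP => M0; move: uM; rewrite unitmxE unitfE => /negP; apply.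
  rewrite (expand_det_col _ ord0) big1// => i _.
  have [j ->|->] := unliftP ord0 i; last by rewrite M00 mul0r.
  by move/negP: (M0 j); rewrite negbK => /eqP ->; rewrite mul0r.
(* A zero corner is repaired by the shear [E], which adds a lower row with nonzero first entry to
   the top row; its inverse [E'] is upper block-triangular. *)
pose E := (block_mx (1%:M : 'M[R]_1) (delta_mx ord0 i) (0 : 'M[R]_(n, 1)) 1%:M) : 'M[R]_(1 + n).
pose E' := (block_mx (1%:M : 'M[R]_1) (- delta_mx ord0 i)%R (0 : 'M[R]_(n, 1)) 1%:M)
  : 'M[R]_(1 + n).
have EE' : (E' *m E = 1%:M)%R.
  rewrite mulmx_block !mulmx0 !mul0mx !mulmx1 !mul1mx !addr0 add0r subrr.
  by rewrite -scalar_mx_block.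
have -> : (M = E' *m (E *m M))%R by rewrite mulmxA EE' mul1mx.
apply: (@scales_integralM n.+1).
  apply: scales_integral_ublock; exact: scales_integral1.
apply: main.
  rewrite unitmx_mul; apply/andP; split; last exact: uM.
  by have [] := mulmx1_unit EE'.
move: Mi0; apply: contra => /eqP; rewrite mxE (bigD1 ord0)//= M00 mulr0 add0r.
rewrite (bigD1 (lift ord0 i))//= big1 ?addr0.
  rewrite {1}/E.
  have -> : (ord0 : 'I_(1 + n)) = lshift n (ord0 : 'I_1) by exact/val_inj.
  have -> : lift (lshift n (ord0 : 'I_1)) i = rshift 1 i by exact/val_inj.
  by rewrite block_mxEur mxE !eqxx mul1r => ->.
move=> k /andP[]; have [j ->|->] := unliftP ord0 k; last by rewrite eqxx.
move=> _ ji.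
have -> : (ord0 : 'I_(1 + n)) = lshift n (ord0 : 'I_1) by exact/val_inj.
have -> : lift (lshift n (ord0 : 'I_1)) j = rshift 1 j by exact/val_inj.
rewrite block_mxEur mxE eqxx/= (_ : j == i = false) ?mul0r//.
by apply/negbTE; move: ji; apply: contra => /eqP ->.
Qed.

End measure_facts.

(** * Borel sets and volumes *)

Section rV_topology.
Context {R : realType}.
Implicit Types (n : nat).

Lemma nbhs_rVP n (x : 'rV[R]_n) (A : set 'rV[R]_n) :
  nbhs x A <-> exists2 e : R, 0 < e &
    forall y : 'rV[R]_n, (forall i, `|x ord0 i - y ord0 i| < e) -> A y.
Proof.
split.
  move=> /(@nbhs_ballP _ 'rV[R]_n)[e e0 eA]; exists e => // y xy; apply: eA.
  rewrite mx_norm_ball /ball_/= [ltLHS]/Num.norm/= mx_normrE; apply/bigmax_ltP.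
  by split => // -[i j] _ /=; rewrite !mxE ord1.
move=> [e e0 eA]; apply/(@nbhs_ballP _ 'rV[R]_n); exists e => // y xy.
apply: eA => i; move: xy; rewrite mx_norm_ball /ball_/= [ltLHS]/Num.norm/= mx_normrE.
by move=> /bigmax_ltP[_ /(_ (ord0, i))]; rewrite /= !mxE; exact.
Qed.

Lemma measurable_rV_pred n (p : 'rV[R]_n -> bool) :
  measurable_fun setT p -> measurable [set x | p x].
Proof.
move=> mp; have := mp measurableT [set true] I.
by rewrite setTI.
Qed.

(** The measurable sets are generated by the coordinates, so an open set is written as the countable
    union of the cubes with rational centre and radius [1 / (k + 1)] that it contains. *)
Lemma open_rV_measurable n (U : set 'rV[R]_n) : open U -> measurable U.
Proof.
move=> oU.
pose B (q : 'rV[rat]_n) (k : nat) : set 'rV[R]_n :=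
  [set y | forall i, `|ratr (q ord0 i) - y ord0 i| < k.+1%:R^-1].
have mB q k : measurable (B q k).
  pose C (i : 'I_n) := [set t : measurableTypeR R | `|ratr (q ord0 i) - t| < k.+1%:R^-1].
  rewrite (_ : B q k = [set x | forall i, C i (x ord0 i)])//.
  apply: (measurable_rV_box (A := C)) => i.
  rewrite (_ : C i = `](ratr (q ord0 i) - k.+1%:R^-1), (ratr (q ord0 i) + k.+1%:R^-1)[%classic)//.
  by apply/seteqP; split => t; rewrite /C/= in_itv/= distrC ltr_distl.
pose F (qk : 'rV[rat]_n * nat) := if `[< B qk.1 qk.2 `<=` U >] then B qk.1 qk.2 else set0.
have -> : U = \bigcup_qk F qk.
  apply/seteqP; split => [x Ux|x [qk _]]; last first.
    by rewrite /F; case: ifPn => // /asboolP; exact.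
  have /nbhs_rVP[e e0 eU] : nbhs x U by exact: open_nbhs_nbhs.
  pose k := Num.truncn (2 / e).
  have ke : k.+1%:R^-1 < e / 2.
    rewrite -[e / 2]invrK ltf_pV2 ?posrE ?invr_gt0 ?divr_gt0// invf_div.
    exact: truncnS_gt.
  have q_ (i : 'I_n) : {q : rat | `|ratr q - x ord0 i| < k.+1%:R^-1}.
    apply: cid.
    have k0 : 0 < k.+1%:R^-1 :> R by rewrite invr_gt0.
    have xx : x ord0 i - k.+1%:R^-1 < x ord0 i + k.+1%:R^-1.
      by rewrite ltrBlDr -addrA ltrDl addr_gt0.
    by have [q] := rat_in_itvoo xx; rewrite in_itv/= => qi; exists q; rewrite ltr_distl.
  exists (\row_i sval (q_ i), k) => //; rewrite /F ifT/=; last first.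
    apply/asboolP => y /= By; apply: eU => i.
    have := By i; rewrite mxE; have := svalP (q_ i).
    move: (sval (q_ i)) ke => q; move: (k.+1%:R^-1 : R) => d ke.
    rewrite !ltr_distl => /andP[? ?] /andP[? ?]; apply/andP; split; lra.
  by move=> i; rewrite mxE; exact: (svalP (q_ i)).
apply: countable_bigcupT_measurable => [|qk]; first exact: countableP.
by rewrite /F; case: ifPn.
Qed.

Lemma closed_rV_measurable n (A : set 'rV[R]_n) : closed A -> measurable A.
Proof.
move=> cA; rewrite -(setCK A); apply: measurableC; apply: open_rV_measurable.
exact: closed_openC.
Qed.

End rV_topology.

Section volume.
Context {R : realType}.
Notation lebR := (@lebesgue_measure R).
Implicit Types (n : nat).

Lemma lebesgue_rV_mulmx n (M : 'M[R]_n) (A : set 'rV[R]_n) :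
  M \in unitmx -> measurable A ->
  (lebesgue_rV n A = `|\det M|%:E * lebesgue_rV n [set x | A (x *m M)])%E.
Proof.
move=> uM mA.
have mB : measurable [set x | A (x *m M)].
  by rewrite -[X in measurable X]setTI; exact: measurable_mulmx.
have := @ge0_integral_mulmx R n M uM (fun x => (\1_A x)%:E).
rewrite integral_indic// setIT => -> //; last first.
  exact/measurable_EFinP/measurable_indic.
congr (_ * _)%E; rewrite -[in RHS](setIT [set x | _]) -integral_indic//.
Qed.

Lemma lebesgue_rV_scale n (a : R) (A : set 'rV[R]_n) :
  0 < a -> measurable A ->
  (lebesgue_rV n A = (a ^+ n)%:E * lebesgue_rV n [set x | A (a *: x)])%E.
Proof.
move=> a0 mA.
have uM : (a%:M : 'M[R]_n) \in unitmx.
  by rewrite unitmxE det_scalar unitrX// unitfE gt_eqF.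
rewrite (lebesgue_rV_mulmx uM)// det_scalar ger0_norm ?exprn_ge0 ?ltW//.
by congr (_ * lebesgue_rV n _)%E; apply/funext => x /=; rewrite mul_mx_scalar.
Qed.

Lemma lebesgue_rVS n (A : set 'rV[R]_n.+1) : measurable A ->
  (lebesgue_rV n.+1 A =
   \int[lebesgue_rV n]_x lebR [set t | A (rV_cons (t, x))])%E.
Proof.
move=> mA; rewrite -[in LHS](setIT A) -integral_indic//.
rewrite ge0_integral_rV_consC//; last exact/measurable_EFinP/measurable_indic.
apply: eq_integral => x _.
have mB : measurable [set t : measurableTypeR R | A (rV_cons (t, x))].
  by rewrite -[X in measurable X]setTI; exact: measurable_rV_cons1.
by rewrite -[in RHS](setIT [set t | _]) -integral_indic.
Qed.

Lemma measurable_hyperplane n (u : 'rV[R]_n) (c : R) :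
  measurable [set x | dotp u x = c].
Proof.
rewrite (_ : [set _ | _] = [set x : 'rV[R]_n | dotp u x == c]); last first.
  by apply/seteqP; split => x /eqP.
apply: measurable_rV_pred; apply: measurable_fun_eqr => //.
have := @measurable_rV_comb R n (fun i => u ord0 i) 0.
rewrite (_ : (fun _ => _) = dotp u)//.
by apply/funext => x; rewrite addr0; apply: eq_bigr => i _; rewrite mulrC.
Qed.

Lemma measurable_halfspace n (u : 'rV[R]_n) (c : R) :
  measurable [set x | dotp u x <= c].
Proof.
apply: measurable_rV_pred; apply: measurable_fun_ler => //.
have := @measurable_rV_comb R n (fun i => u ord0 i) 0.
rewrite (_ : (fun _ => _) = dotp u)//.
by apply/funext => x; rewrite addr0; apply: eq_bigr => i _; rewrite mulrC.
Qed.

Lemma dotp_rV_cons n (u x : 'rV[R]_n) (s t : R) :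
  dotp (rV_cons (s, u)) (rV_cons (t, x)) = s * t + dotp u x.
Proof.
rewrite /dotp big_ord_recl !rV_cons0; congr (_ + _).
by apply: eq_bigr => i _; rewrite !rV_consS.
Qed.

(** Induction by slicing along the first coordinate: the slices are single points if the first
    coefficient is nonzero. *)
Lemma lebesgue_rV_hyperplane n (u : 'rV[R]_n) (c : R) : u != 0 ->
  lebesgue_rV n [set x | dotp u x = c] = 0%E.
Proof.
elim: n u c => [u|n IH u c u0]; first by rewrite (thinmx0 u) eqxx.
rewrite lebesgue_rVS; last exact: measurable_hyperplane.
rewrite -(rV_unconsK u) in u0 *; case: (rV_uncons u) u0 => s v /= u0.
under eq_integral do under eq_set do rewrite dotp_rV_cons.
have [s0|s0] := eqVneq s 0; last first.
  rewrite integral0_eq// => x _.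
  rewrite (_ : [set _ | _] = [set ((c - dotp v x) / s)]); first exact: lebesgue_measure_set1.
  apply/seteqP; split => t /=.
    by move=> <-; rewrite addrK mulrC mulKf.
  by move=> ->; field.
have v0 : v != 0.
  apply: contra u0 => /eqP ->; rewrite s0; apply/eqP/rowP => i.
  by have [j ->|->] := unliftP ord0 i; rewrite ?rV_consS ?rV_cons0 !mxE.
have mE := measurable_hyperplane v c.
(* The slices are whole lines over a hyperplane of lower dimension and empty elsewhere, so the
   integral is infinity times a null measure, which is 0. *)
rewrite (eq_integral (fun x => +oo * (\1_[set x | dotp v x = c] x)%:E)%E).
  rewrite ge0_integralZl//; last exact/measurable_EFinP/measurable_indic.
  rewrite integral_indic// setIT.
  by have /= -> := IH v c v0; rewrite mule0.
move=> x _; rewrite indicE; case: (boolP (x \in _)).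
  rewrite inE => /= xc; rewrite mule1 (_ : [set _ | _] = setT).
    by rewrite -set_itvNyy lebesgue_measure_itv.
  by apply/seteqP; split => // t _ /=; rewrite s0 mul0r add0r.
rewrite notin_setE => /= xc; rewrite mule0 (_ : [set _ | _] = set0) ?measure0//.
by rewrite -subset0 => t /=; rewrite s0 mul0r add0r.
Qed.

Definition bounded_by n (r : R) (A : set 'rV[R]_n) :=
  forall x, A x -> forall i, `|x ord0 i| <= r.

Lemma lebesgue_rV_boxE n (r : R) (B : 'I_n -> set R) : 0 <= r ->
  (forall i, exists2 a, B i = `[a, a + r]%classic & True) ->
  lebesgue_rV n [set x : 'rV[R]_n | forall i, B i (x ord0 i)] = (r ^+ n)%:E.
Proof.
move=> r0 Br; rewrite lebesgue_rV_box; last first.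
  by move=> i; have [a -> _] := Br i; exact: measurable_itv.
rewrite (eq_bigr (fun _ => r%:E)); last first.
  move=> i _; have [a -> _] := Br i; rewrite lebesgue_measure_itv/= lte_fin.
  rewrite ltrDl; move: r0; rewrite le_eqVlt => /predU1P[<-|->].
    by rewrite ltxx.
  by rewrite -EFinD addrAC subrr add0r.
by rewrite prodEFin prodr_const card_ord.
Qed.

Lemma lebesgue_rV_bounded n (r : R) (A : set 'rV[R]_n) :
  measurable A -> bounded_by r A -> (lebesgue_rV n A < +oo)%E.
Proof.
move=> mA Ar.
pose B (i : 'I_n) : set R := `[- `|r|, - `|r| + (2 * `|r|)]%classic.
have mB : measurable [set x : 'rV[R]_n | forall i, B i (x ord0 i)].
  by apply: measurable_rV_box => i; exact: measurable_itv.
apply: (@le_lt_trans _ _ (lebesgue_rV n [set x : 'rV[R]_n | forall i, B i (x ord0 i)])).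
  apply: le_measure; rewrite ?inE// => x Ax i; rewrite /B/= in_itv/=.
  have /andP[? ?] : - r <= x ord0 i <= r by rewrite -ler_norml; exact: Ar.
  by have ? := ler_norm r; have ? := normr_ge0 r; apply/andP; split; lra.
rewrite (@lebesgue_rV_boxE _ (2 * `|r|)) ?ltry//.
by move=> i; exists (- `|r|).
Qed.

Lemma lebesgue_rV_gt0 n (e : R) (A : set 'rV[R]_n) (x0 : 'rV[R]_n) : 0 < e ->
  measurable A -> (forall x : 'rV[R]_n, (forall i, `|x0 ord0 i - x ord0 i| < e) -> A x) ->
  (0 < lebesgue_rV n A)%E.
Proof.
move=> e0 mA eA.
pose B (i : 'I_n) : set R := `[x0 ord0 i, x0 ord0 i + e / 2]%classic.
have mB : measurable [set x : 'rV[R]_n | forall i, B i (x ord0 i)].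
  by apply: measurable_rV_box => i; exact: measurable_itv.
apply: (@lt_le_trans _ _ (lebesgue_rV n [set x : 'rV[R]_n | forall i, B i (x ord0 i)])).
  rewrite (@lebesgue_rV_boxE _ (e / 2)) ?divr_ge0 ?(ltW e0)//.
    by rewrite lte_fin exprn_gt0 ?divr_gt0.
  by move=> i; exists (x0 ord0 i).
apply: le_measure; rewrite ?inE// => x Bx; apply: eA => i.
have := Bx i; rewrite /B/= in_itv/= => /andP[? ?].
by rewrite ltr_distl; apply/andP; split; lra.
Qed.

End volume.

(** * Supergradients of concave functions *)

Section supergradient.
Context {R : realType}.

Definition internal0 n (D : set 'rV[R]_n) := exists2 e : R, 0 < e &
  forall x : 'rV[R]_n, (forall i, `|x ord0 i| < e) -> D x.

Definition concave_on n (D : set 'rV[R]_n) (phi : 'rV[R]_n -> R) :=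
  forall x y (t : R), D x -> D y -> 0 < t < 1 ->
    D (t *: x + (1 - t) *: y) /\
    t * phi x + (1 - t) * phi y <= phi (t *: x + (1 - t) *: y).

Lemma dotpD n (u x y : 'rV[R]_n) : dotp u (x + y) = dotp u x + dotp u y.
Proof.
by rewrite /dotp -big_split; apply: eq_bigr => i _; rewrite mxE mulrDr.
Qed.

Lemma dotpZ n (u x : 'rV[R]_n) (c : R) : dotp u (c *: x) = c * dotp u x.
Proof.
by rewrite /dotp mulr_sumr; apply: eq_bigr => i _; rewrite mxE mulrCA.
Qed.

Lemma dotpC n (u v : 'rV[R]_n) : dotp u v = dotp v u.
Proof. by apply: eq_bigr => i _; rewrite mulrC. Qed.

Lemma dotpZl n (c : R) (x y : 'rV[R]_n) : dotp (c *: x) y = c * dotp x y.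
Proof. by rewrite dotpC dotpZ dotpC. Qed.

Lemma dotp0 n (u : 'rV[R]_n) : dotp u 0 = 0.
Proof. by rewrite -(scale0r (0 : 'rV[R]_n)) dotpZ mul0r. Qed.

Lemma dotpN n (u x : 'rV[R]_n) : dotp u (- x) = - dotp u x.
Proof. by rewrite -scaleN1r dotpZ mulN1r. Qed.

Lemma dotpNl n (u x : 'rV[R]_n) : dotp (- u) x = - dotp u x.
Proof. by rewrite dotpC dotpN dotpC. Qed.

Lemma dotpB n (u x y : 'rV[R]_n) : dotp u (x - y) = dotp u x - dotp u y.
Proof. by rewrite dotpD dotpN. Qed.

Lemma dotpBl n (u v x : 'rV[R]_n) : dotp (u - v) x = dotp u x - dotp v x.
Proof. by rewrite dotpC dotpB !(dotpC x). Qed.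

Lemma dotp_sumr n k (v : 'rV[R]_n) (c : 'I_k -> R) (p : 'I_k -> 'rV[R]_n) :
  dotp v (\sum_i c i *: p i) = \sum_i c i * dotp v (p i).
Proof.
rewrite /dotp; under [RHS]eq_bigr do rewrite mulr_sumr.
rewrite exchange_big/=; apply: eq_bigr => i _.
by rewrite summxE mulr_sumr; apply: eq_bigr => j _; rewrite !mxE mulrCA.
Qed.

Lemma rV_consZ n (t c : R) (x : 'rV[R]_n) :
  c *: rV_cons (t, x) = rV_cons (c * t, c *: x) :> 'rV[R]_n.+1.
Proof.
apply/rowP => i; have [j ->|->] := unliftP ord0 i.
  by rewrite mxE !rV_consS mxE.
by rewrite mxE !rV_cons0.
Qed.

Lemma rV_cons_eq0 n : rV_cons (0, 0) = 0 :> 'rV[R]_n.+1.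
Proof.
apply/rowP => i; have [j ->|->] := unliftP ord0 i.
  by rewrite rV_consS !mxE.
by rewrite rV_cons0 mxE.
Qed.

(* The one-dimensional extension step of the Hahn-Banach theorem, iterated
   over the coordinates. *)
Lemma concave_supergradient n (D : set 'rV[R]_n) (phi : 'rV[R]_n -> R) :
  internal0 D -> concave_on D phi ->
  exists u, forall x, D x -> phi x <= phi 0 + dotp u x.
Proof.
elim: n D phi => [|n IH] D phi [e e0 eD] cphi.
  by exists 0 => x _; rewrite (thinmx0 x) /dotp big_ord0 addr0.
have [|x y t Dx Dy t01|v vP] := IH [set x | D (rV_cons (0, x))]
    (fun x => phi (rV_cons (0, x))).
- exists e => // x xe; apply: eD => i; have [j ->|->] := unliftP ord0 i.
    by rewrite rV_consS.
  by rewrite rV_cons0 normr0.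
- have := cphi _ _ t Dx Dy t01.
  by rewrite !rV_consZ rV_consD !mulr0 addr0.
(* With the supergradient [v] of the restriction to the coordinate hyperplane removed, only the
   coefficient of [t] is missing: it must lie above all slopes [psi t x / t] with [t > 0] and below
   those with [t < 0]. *)
pose psi t x := phi (rV_cons (t, x)) - dotp v x - phi 0.
have psi0 x : D (rV_cons (0, x)) -> psi 0 x <= 0.
  by move=> /vP; rewrite rV_cons_eq0 /psi; lra.
have key t x s y : 0 < t -> 0 < s -> D (rV_cons (t, x)) ->
    D (rV_cons (- s, y)) -> psi t x / t <= - psi (- s) y / s.
  (* The weight [l] balances [t] against [- s], so that the convex combination has first coordinate
     0. *)
  move=> t0 s0 Dx Dy; pose l := s / (t + s).
  have ts0 : 0 < t + s by rewrite addr_gt0.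
  have l01 : 0 < l < 1 by rewrite /l divr_gt0//= ltr_pdivrMr// mul1r ltrDr.
  have [] := cphi _ _ l Dx Dy l01; rewrite !rV_consZ rV_consD.
  have -> : l * t + (1 - l) * - s = 0 by rewrite /l; field; rewrite gt_eqF.
  move=> /psi0; rewrite /psi dotpD !dotpZ => h1 h2.
  have : l * psi t x + (1 - l) * psi (- s) y <= 0 by rewrite /psi; lra.
  have -> : 1 - l = t / (t + s) by rewrite /l; field; rewrite gt_eqF.
  rewrite /l mulrAC [X in _ + X]mulrAC -mulrDl pmulr_lle0 ?invr_gt0// => h3.
  rewrite ler_pdivrMr// mulrAC ler_pdivlMr//; move: h3; rewrite /psi; lra.
pose S := [set r | exists t x, [/\ 0 < t, D (rV_cons (t, x)) & r = psi t x / t]].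
have De t : `|t| < e -> D (rV_cons (t, 0)).
  move=> te; apply: eD => i; have [j ->|->] := unliftP ord0 i.
    by rewrite rV_consS mxE normr0.
  by rewrite rV_cons0.
have S0 : S !=set0.
  exists (psi (e / 2) 0 / (e / 2)), (e / 2), 0; split => //; first lra.
  by apply: De; rewrite ger0_norm; lra.
have Sub s y : 0 < s -> D (rV_cons (- s, y)) -> ubound S (- psi (- s) y / s).
  by move=> s0 Dy r [t [x [t0 Dx ->]]]; exact: key.
have hS : has_ubound S.
  exists (- psi (- (e / 2)) 0 / (e / 2)); apply: Sub; first lra.
  by apply: De; rewrite normrN ger0_norm; lra.
exists (rV_cons (sup S, v)) => x; rewrite -(rV_unconsK x).
case: (rV_uncons x) => t y Dx; rewrite dotp_rV_cons.
suff : psi t y <= sup S * t by rewrite /psi; lra.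
case: (ltgtP t 0) => [t0|t0|t0].
- have := ge_sup S0 (Sub (- t) y _ _); rewrite opprK.
  move=> /(_ _ Dx); rewrite oppr_gt0 => /(_ t0).
  by rewrite invrN mulrNN ler_ndivlMr.
- by rewrite -ler_pdivrMr//; apply: ub_le_sup => //; exists t, y.
- by rewrite t0 mulr0; apply: psi0; rewrite -t0.
Qed.

End supergradient.

(** * The one-dimensional Prekopa-Leindler inequality *)

Section prekopa_one_dim.
Context {R : realType}.
Notation lebR := (@lebesgue_measure R).

Lemma weighted_amgm (x y t : R) : 0 <= x -> 0 <= y -> 0 < t < 1 ->
  x `^ t * y `^ (1 - t) <= t * x + (1 - t) * y.
Proof.
move=> x0 y0 /andP[t0 t1].
have t1' : 0 < 1 - t by rewrite subr_gt0.
have := @conjugate_powR R (x `^ t) (y `^ (1 - t)) t^-1 (1 - t)^-1.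
rewrite !powR_ge0 !invr_gt0 !invrK -!powRrM !mulfV ?gt_eqF// !powRr1//.
by rewrite subrKC [x * t]mulrC [y * _]mulrC; apply.
Qed.

Definition convex1 (A : set R) := forall a b s : R, A a -> A b -> 0 < s < 1 ->
  A (s * a + (1 - s) * b).

(** In dimension one a bounded set has measure at most [sup - inf], while [C] contains the open
    interval between the corresponding combinations [lo] and [hi]. *)
Lemma brunn_minkowski1 (A B C : set (measurableTypeR R)) (t : R) :
  0 < t < 1 -> A !=set0 -> B !=set0 -> has_ubound A -> has_lbound A ->
  has_ubound B -> has_lbound B -> convex1 A -> convex1 B ->
  measurable A -> measurable B -> measurable C ->
  (forall a b, A a -> B b -> C (t * a + (1 - t) * b)) ->
  (t%:E * lebR A + (1 - t)%:E * lebR B <= lebR C)%E.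
Proof.
move=> /andP[t0 t1] A0 B0 uA lA uB lB cA cB mA mB mC ABC.
have t1' : 0 < 1 - t by rewrite subr_gt0.
have diam (S : set (measurableTypeR R)) : S !=set0 -> has_ubound S ->
    has_lbound S -> measurable S -> (lebR S <= (sup S - inf S)%:E)%E.
  move=> S0 uS lS mS; have [s Ss] := S0.
  have sS := ub_le_sup uS; have iS := ge_inf lS.
  apply: (@le_trans _ _ (lebR `[inf S, sup S]%classic)).
    by apply: le_measure; rewrite ?inE// => x Sx/=; rewrite in_itv/= sS// iS.
  rewrite lebesgue_measure_itv/= lte_fin; case: ifPn => // _.
  by rewrite lee_fin subr_ge0 (le_trans (iS s Ss))// sS.
pose lo := t * inf A + (1 - t) * inf B.
pose hi := t * sup A + (1 - t) * sup B.
apply: (@le_trans _ _ (hi - lo)%:E).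
  rewrite (_ : hi - lo = t * (sup A - inf A) + (1 - t) * (sup B - inf B)).
    by rewrite [X in (_ <= X)%E]EFinD !EFinM; apply: leeD;
      (apply: lee_wpmul2l; [rewrite lee_fin ltW//|exact: diam]).
  by rewrite /hi /lo; ring.
apply: (@le_trans _ _ (lebR `]lo, hi[%classic)).
  rewrite lebesgue_measure_itv/= lte_fin; case: ifPn => // /negP h.
  by rewrite lee_fin subr_le0 leNgt; exact/negP.
apply: le_measure; rewrite ?inE// => c /=; rewrite in_itv/= => /andP[loc chi].
(* Near-extremal points of [A] and [B] bracket [c]; going from the lower to the upper ones with the
   same ratio [s] in both sets reaches [c]. *)
have [a Aa ha] := inf_adherent (E := A) (eps := c - lo) ltac:(by rewrite subr_gt0) (conj A0 lA).
have [b Bb hb] := inf_adherent (E := B) (eps := c - lo) ltac:(by rewrite subr_gt0) (conj B0 lB).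
have [a' Aa' ha'] := sup_adherent (E := A) (eps := hi - c) ltac:(by rewrite subr_gt0) (conj A0 uA).
have [b' Bb' hb'] := sup_adherent (E := B) (eps := hi - c) ltac:(by rewrite subr_gt0) (conj B0 uB).
have h1 : t * a + (1 - t) * b < c.
  have : t * a < t * (inf A + (c - lo)) by rewrite ltr_pM2l.
  have : (1 - t) * b < (1 - t) * (inf B + (c - lo)) by rewrite ltr_pM2l.
  have -> : (1 - t) * (inf B + (c - lo)) = (1 - t) * inf B + (1 - t) * (c - lo) by ring.
  have -> : t * (inf A + (c - lo)) = t * inf A + t * (c - lo) by ring.
  by rewrite /lo; lra.
have h2 : c < t * a' + (1 - t) * b'.
  have : t * (sup A - (hi - c)) < t * a' by rewrite ltr_pM2l.
  have : (1 - t) * (sup B - (hi - c)) < (1 - t) * b' by rewrite ltr_pM2l.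
  have -> : (1 - t) * (sup B - (hi - c)) = (1 - t) * sup B - (1 - t) * (hi - c) by ring.
  have -> : t * (sup A - (hi - c)) = t * sup A - t * (hi - c) by ring.
  by rewrite /hi; lra.
set p := _ + _ in h1; set q := _ + _ in h2.
have qp : 0 < q - p by rewrite subr_gt0 (lt_trans h1).
pose s := (q - c) / (q - p).
have s01 : 0 < s < 1.
  apply/andP; split; first by rewrite divr_gt0// subr_gt0.
  by rewrite ltr_pdivrMr// mul1r ltrD2l ltrN2.
suff -> : c = t * (s * a + (1 - s) * a') + (1 - t) * (s * b + (1 - s) * b').
  by apply: ABC; [exact: cA|exact: cB].
have -> : t * (s * a + (1 - s) * a') + (1 - t) * (s * b + (1 - s) * b') =
  s * p + (1 - s) * q by rewrite /p /q; ring.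
by rewrite /s; field; rewrite gt_eqF.
Qed.

(** Tonelli for the region under the graph of the minimum of [f] and 1. Levels between 0 and 1
    suffice because the functions are normalized before use. *)
Lemma layer_cake01 (f : measurableTypeR R -> R) :
  measurable_fun setT f -> (forall x, 0 <= f x) ->
  (\int[lebR]_(s in `]0%R, 1%R[) lebR [set x | ((s : R) < f x)%R] =
   \int[lebR]_x (Num.min (f x) 1)%:E)%E.
Proof.
move=> mf f0.
pose D := [set z : measurableTypeR R * measurableTypeR R |
  (0 < (z.2 : R)) && ((z.2 : R) < 1) && ((z.2 : R) < f z.1)].
have mD : measurable D.
  have m2 : measurable_fun setT
    (fun z : measurableTypeR R * measurableTypeR R => z.2 : R).
    exact: measurable_snd.
  have mf1 : measurable_fun setT
    (fun z : measurableTypeR R * measurableTypeR R => f z.1).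
    by apply: measurableT_comp => //; exact: measurable_fst.
  have mp : measurable_fun setT
    (fun z : measurableTypeR R * measurableTypeR R =>
      (0 < (z.2 : R)) && ((z.2 : R) < 1) && ((z.2 : R) < f z.1)).
    apply: measurable_and; first apply: measurable_and.
    - exact: measurable_fun_ltr.
    - exact: measurable_fun_ltr.
    - exact: measurable_fun_ltr.
  by have := mp measurableT [set true] I; rewrite setTI.
have m1D : measurable_fun setT (fun z => (\1_D z : R)%:E).
  exact/measurable_EFinP/measurable_indic.
have := @fubini_tonelli _ _ _ _ R lebR lebR (fun z => (\1_D z)%:E) m1D.
have D0 z : (0 <= (\1_D z)%:E :> \bar R)%E by rewrite lee_fin.
move=> /(_ D0) H; rewrite integral_mkcond; apply/esym.
transitivity (\int[lebR]_x \int[lebR]_y (\1_D (x, y))%:E)%E.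
  apply: eq_integral => x _; rewrite -[RHS](_ : lebR `]0%R, (Num.min (f x) 1)[%classic = _).
    rewrite lebesgue_measure_itv/= lte_fin; case: ifPn; first by rewrite oppr0 adde0.
    rewrite -leNgt => le0; congr EFin; apply/eqP; rewrite eq_le le0.
    by rewrite le_min f0 ler01.
  rewrite -[in LHS](setIT `]_, _[%classic) -integral_indic//.
  apply: eq_integral => y _; congr EFin; rewrite !indicE; congr ((nat_of_bool _)%:R).
  apply/idP/idP; rewrite !inE /D/= in_itv/= lt_min.
    by move=> /and3P[a b c]; rewrite a b c.
  by move=> /andP[/andP[a b] c]; rewrite a b c.
rewrite H; apply: eq_integral => s _; rewrite patchE; case: ifPn.
  rewrite inE/= in_itv/= => s01.
  have mS : measurable [set x : measurableTypeR R | s < f x].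
    have mp : measurable_fun setT (fun x : measurableTypeR R => s < f x).
      exact: measurable_fun_ltr.
    by have := mp measurableT [set true] I; rewrite setTI.
  rewrite -[in RHS](setIT [set x | _]) -integral_indic//.
  apply: eq_integral => y _; congr EFin; rewrite !indicE; congr ((nat_of_bool _)%:R).
  by apply/idP/idP; rewrite !inE /D/= s01.
rewrite notin_setE/= in_itv/= => /negP s01.
apply: integral0_eq => x _; congr EFin; rewrite indicE memNset//.
by rewrite /D/= (negbTE s01).
Qed.

(* Both functions are normalized to have supremum 1, so that all their
   superlevel sets of height in ]0, 1[ are nonempty. *)
Let prekopa_leindler_normalized (f g h : measurableTypeR R -> R) (t r : R) :
  0 < t < 1 ->
  measurable_fun setT f -> measurable_fun setT g -> measurable_fun setT h ->
  (forall x, 0 <= f x <= 1) -> (forall x, 0 <= g x <= 1) ->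
  (forall x, 0 <= h x) ->
  (forall x, f x != 0 -> `|x| <= r) -> (forall x, g x != 0 -> `|x| <= r) ->
  (forall s, s < 1 -> exists x, s < f x) ->
  (forall s, s < 1 -> exists x, s < g x) ->
  (forall s, convex1 [set x | s < f x]) ->
  (forall s, convex1 [set x | s < g x]) ->
  (forall x y, f x `^ t * g y `^ (1 - t) <= h (t * x + (1 - t) * y)) ->
  (t%:E * \int[lebR]_x (f x)%:E + (1 - t)%:E * \int[lebR]_x (g x)%:E <=
   \int[lebR]_x (h x)%:E)%E.
Proof.
move=> t01 mf mg mh f01 g01 h0 fr gr f1 g1 cf cg fgh.
have /andP[t0 t1] := t01; have t1' : 0 < 1 - t by rewrite subr_gt0.
have f0 x : 0 <= f x by have /andP[] := f01 x.
have g0 x : 0 <= g x by have /andP[] := g01 x.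
have minE (k : measurableTypeR R -> R) : (forall x, 0 <= k x <= 1) ->
  (\int[lebR]_x (k x)%:E = \int[lebR]_x (Num.min (k x) 1)%:E)%E.
  move=> k01; apply: eq_integral => x _; rewrite min_l//.
  by have /andP[] := k01 x.
rewrite (minE f)// (minE g)// -!layer_cake01//.
apply: (@le_trans _ _ (\int[lebR]_x (Num.min (h x) 1)%:E)%E); last first.
  apply: ge0_le_integral => //.
  - by move=> x _; rewrite lee_fin le_min h0/=.
  - by apply/measurable_EFinP; exact: measurable_minr.
  - exact/measurable_EFinP.
  - by move=> x _; rewrite lee_fin ge_min lexx.
rewrite -layer_cake01//.
have mS (k : measurableTypeR R -> R) s : measurable_fun setT k ->
    measurable [set x : measurableTypeR R | s < k x].
  move=> mk; have mp : measurable_fun setT (fun x : measurableTypeR R => s < k x).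
    exact: measurable_fun_ltr.
  by have := mp measurableT [set true] I; rewrite setTI.
have mL (k : measurableTypeR R -> R) : measurable_fun setT k ->
    measurable_fun (`]0%R, 1%R[%classic : set (measurableTypeR R))
      (fun s => lebR [set x | (s : R) < k x]).
  move=> mk.
  have mE : measurable [set z : measurableTypeR R * measurableTypeR R | (z.1 : R) < k z.2].
    have mp : measurable_fun setT (fun z : measurableTypeR R * measurableTypeR R =>
        (z.1 : R) < k z.2).
      apply: measurable_fun_ltr; first exact: measurable_fst.
      by apply: measurableT_comp => //; exact: measurable_snd.
    by have := mp measurableT [set true] I; rewrite setTI.
  have /measurable_funTS := measurable_fun_xsection lebR mE.
  move=> /(_ (`]0%R, 1%R[%classic : set (measurableTypeR R))); congr measurable_fun.
  apply/funext => s /=; congr (lebR _).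
  by apply/seteqP; split => x; rewrite /xsection/= inE.
rewrite -!ge0_integralZl//; try exact: mL; try by rewrite lee_fin ltW.
rewrite -ge0_integralD//; first last.
- by apply: measurable_funeM; exact: mL.
- by move=> s _; rewrite mule_ge0// lee_fin ltW.
- by apply: measurable_funeM; exact: mL.
- by move=> s _; rewrite mule_ge0// lee_fin ltW.
apply: ge0_le_integral => //.
- by move=> s _; rewrite adde_ge0// mule_ge0// lee_fin ltW.
- by apply: emeasurable_funD; apply: measurable_funeM; exact: mL.
- exact: mL.
move=> s; rewrite /= in_itv/= => /andP[s0 s1].
have bnd (k : measurableTypeR R -> R) : (forall x, k x != 0 -> `|x| <= r) ->
  has_ubound [set x : R | s < k x] /\ has_lbound [set x : R | s < k x].
  move=> kr; have {}kr x : s < k x -> - r <= x <= r.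
    by move=> skx; rewrite -ler_norml kr// gt_eqF// (lt_trans s0).
  by split; [exists r|exists (- r)] => x /= /kr /andP[].
have [uf lf] := bnd f fr; have [ug lg] := bnd g gr.
apply: brunn_minkowski1 => //; try exact: mS.
- by have [x fx] := f1 s s1; exists x.
- by have [x gx] := g1 s s1; exists x.
(* The level [s] is the product of its powers with exponents [t] and [1 - t], so [h] exceeds it at
   the combination of [a] and [b]. *)
move=> a b /= fa gb; apply: lt_le_trans (fgh a b).
rewrite -[ltLHS](_ : s `^ t * s `^ (1 - t) = _); last first.
  by rewrite -powRD ?subrKC ?powRr1 ?(ltW s0)// gt_eqF// implybT.
apply: ltr_pM; rewrite ?powR_ge0//; apply: gt0_ltr_powR => //.
- by rewrite nnegrE ltW.
- by rewrite nnegrE.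
- by rewrite nnegrE ltW.
- by rewrite nnegrE.
Qed.

(** After division by the suprema, the normalized version bounds an arithmetic mean of the
    integrals; the weighted AM-GM inequality replaces it by the geometric mean, and the suprema
    cancel. *)
Lemma prekopa_leindler1 (f g h : measurableTypeR R -> R) (t r C : R) :
  0 < t < 1 ->
  measurable_fun setT f -> measurable_fun setT g -> measurable_fun setT h ->
  (forall x, 0 <= f x <= C) -> (forall x, 0 <= g x <= C) ->
  (forall x, 0 <= h x) ->
  (forall x, f x != 0 -> `|x| <= r) -> (forall x, g x != 0 -> `|x| <= r) ->
  (forall s, convex1 [set x | s < f x]) ->
  (forall s, convex1 [set x | s < g x]) ->
  (forall x y, f x `^ t * g y `^ (1 - t) <= h (t * x + (1 - t) * y)) ->
  forall If Ig Ih : R,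
  (\int[lebR]_x (f x)%:E = If%:E)%E -> (\int[lebR]_x (g x)%:E = Ig%:E)%E ->
  (\int[lebR]_x (h x)%:E = Ih%:E)%E ->
  If `^ t * Ig `^ (1 - t) <= Ih.
Proof.
move=> t01 mf mg mh fC gC h0 fr gr cf cg fgh If Ig Ih fI gI hI.
have /andP[t0 t1] := t01; have t1' : 0 < 1 - t by rewrite subr_gt0.
have f0 x : 0 <= f x by have /andP[] := fC x.
have g0 x : 0 <= g x by have /andP[] := gC x.
have Ih0 : 0 <= Ih.
  by rewrite -lee_fin -hI; apply: integral_ge0 => x _; rewrite lee_fin.
(* If [f] or [g] vanishes identically there is no positive supremum to divide by, but then the
   left-hand side is 0. *)
have [[x0 fx0]|/forallNP fz] := pselect (exists x, 0 < f x); last first.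
  suff -> : If = 0 by rewrite powR0 ?gt_eqF// mul0r.
  apply: EFin_inj; rewrite -fI integral0_eq// => x _; congr EFin.
  by apply/eqP; rewrite eq_le f0 andbT leNgt; exact/negP.
have [[y0 gy0]|/forallNP gz] := pselect (exists x, 0 < g x); last first.
  suff -> : Ig = 0 by rewrite [X in _ * X]powR0 ?gt_eqF// mulr0.
  apply: EFin_inj; rewrite -gI integral0_eq// => x _; congr EFin.
  by apply/eqP; rewrite eq_le g0 andbT leNgt; exact/negP.
have sup_props (k : measurableTypeR R -> R) x1 : 0 < k x1 -> (forall x, 0 <= k x <= C) ->
    [/\ 0 < sup (range k), forall x, k x <= sup (range k) &
      forall s, s < 1 -> exists x, s < (sup (range k))^-1 * k x].
  move=> kx1 kC.
  have kub : has_ubound (range k).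
    by exists C => _ [x _ <-]; have /andP[] := kC x.
  have ks x : k x <= sup (range k) by apply: ub_le_sup => //; exists x.
  have s0 : 0 < sup (range k) by apply: lt_le_trans (ks x1).
  split => // s s1.
  have e0 : 0 < (1 - s) * sup (range k) by rewrite mulr_gt0 ?subr_gt0.
  have hsk : has_sup (range k) by split => //; exists (k x1), x1.
  have [_ [x _ <-] hx] := sup_adherent e0 hsk.
  exists x; rewrite mulrC ltr_pdivlMr//.
  by move: hx; rewrite mulrBl mul1r subKr.
have [M0 fM fs] := sup_props f x0 fx0 fC.
have [N0 gN gs] := sup_props g y0 gy0 gC.
move: M0 fM fs N0 gN gs; set M := sup (range f); set N := sup (range g).
(* Dividing [h] by [K] preserves the pointwise hypothesis when [f] is divided by [M] and [g] by
   [N]. *)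
move=> M0 fM fs N0 gN gs; pose K := M `^ t * N `^ (1 - t).
have K0 : 0 < K by rewrite mulr_gt0 ?powR_gt0.
have Zc (k : measurableTypeR R -> R) c s : 0 < c ->
  (forall s, convex1 [set x | s < k x]) -> convex1 [set x | s < c * k x].
  move=> c0 ck a b u /= ka kb u01.
  have := ck (s / c) a b u; rewrite /= !ltr_pdivrMr// ![_ * c]mulrC.
  exact.
have H := @prekopa_leindler_normalized (fun x => M^-1 * f x)
  (fun x => N^-1 * g x) (fun x => K^-1 * h x) t r t01.
have {}H : (t%:E * \int[lebR]_x (M^-1 * f x)%:E +
    (1 - t)%:E * \int[lebR]_x (N^-1 * g x)%:E <=
   \int[lebR]_x (K^-1 * h x)%:E)%E.
  apply: H => //.
  - exact: measurable_funM.
  - exact: measurable_funM.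
  - exact: measurable_funM.
  - move=> x; rewrite mulr_ge0 ?invr_ge0 ?(ltW M0)//=.
    by rewrite mulrC ler_pdivrMr// mul1r.
  - move=> x; rewrite mulr_ge0 ?invr_ge0 ?(ltW N0)//=.
    by rewrite mulrC ler_pdivrMr// mul1r.
  - by move=> x; rewrite mulr_ge0 ?invr_ge0 ?(ltW K0).
  - by move=> x; rewrite mulf_eq0 negb_or => /andP[_]; exact: fr.
  - by move=> x; rewrite mulf_eq0 negb_or => /andP[_]; exact: gr.
  - by move=> s; apply: Zc; rewrite ?invr_gt0.
  - by move=> s; apply: Zc; rewrite ?invr_gt0.
  move=> x y; rewrite !powRM ?invr_ge0 ?(ltW M0) ?(ltW N0)// mulrACA.
  suff -> : M^-1 `^ t * N^-1 `^ (1 - t) = K^-1.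
    by rewrite ler_pM2l ?invr_gt0.
  apply: (mulIf (lt0r_neq0 K0)); rewrite mulVf ?gt_eqF// /K mulrACA.
  rewrite -!powRM ?invr_ge0 ?(ltW M0) ?(ltW N0)//.
  by rewrite !mulVf ?gt_eqF// !powR1 mulr1.
have IZ (k : measurableTypeR R -> R) (c I : R) : 0 < c -> measurable_fun setT k ->
    (forall x, 0 <= k x) -> (\int[lebR]_x (k x)%:E = I%:E)%E ->
    (\int[lebR]_x (c * k x)%:E = (c * I)%:E)%E.
  move=> c0 mk k0 kI; under eq_integral do rewrite EFinM.
  rewrite ge0_integralZl//; first by rewrite kI.
  - exact/measurable_EFinP.
  - by move=> x _; rewrite lee_fin.
  - by rewrite lee_fin ltW.
move: H; rewrite (IZ f _ If)// ?invr_gt0// (IZ g _ Ig)// ?invr_gt0//.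
rewrite (IZ h _ Ih)// ?invr_gt0// -!EFinM -EFinD lee_fin => H.
have If0 : 0 <= If.
  by rewrite -lee_fin -fI; apply: integral_ge0 => x _; rewrite lee_fin.
have Ig0 : 0 <= Ig.
  by rewrite -lee_fin -gI; apply: integral_ge0 => x _; rewrite lee_fin.
have MIf0 : 0 <= M^-1 * If by rewrite mulr_ge0 ?invr_ge0 ?(ltW M0).
have NIg0 : 0 <= N^-1 * Ig by rewrite mulr_ge0 ?invr_ge0 ?(ltW N0).
have := le_trans (weighted_amgm MIf0 NIg0 t01) H.
rewrite [leRHS]mulrC ler_pdivlMr//; apply: le_trans; rewrite /K.
rewrite mulrACA -!powRM ?(ltW M0) ?(ltW N0)//.
by rewrite (mulrAC M^-1) (mulrAC N^-1) !mulVf ?gt_eqF// !mul1r.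
Qed.

End prekopa_one_dim.

(** * Log-concave functions and their marginals *)

Section log_concave.
Context {R : realType}.
Notation lebR := (@lebesgue_measure R).

(** The explicit bound [C] and support radius [r] make all integrals finite and are passed on to
    marginals. The product form with [0 < t < 1] allows zeros of [F], whose powers are 0. *)
Record log_concave n (F : 'rV[R]_n -> R) (C r : R) : Prop := LogConcave {
  lc_r_ge0 : 0 <= r;
  lc_measurable : measurable_fun setT F;
  lc_bound : forall x, 0 <= F x <= C;
  lc_support : forall x, F x != 0 -> forall i, `|x ord0 i| <= r;
  lc_concave : forall x y t, 0 < t < 1 ->
    F x `^ t * F y `^ (1 - t) <= F (t *: x + (1 - t) *: y) }.

Lemma lc_ge0 n (F : 'rV[R]_n -> R) C r x : log_concave F C r -> 0 <= F x.
Proof. by move=> [_ _ /(_ x)/andP[]]. Qed.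

Lemma lc_le n (F : 'rV[R]_n -> R) C r x : log_concave F C r -> F x <= C.
Proof. by move=> [_ _ /(_ x)/andP[]]. Qed.

Lemma lc_superlevel n (F : 'rV[R]_n -> R) C r s x y t : log_concave F C r ->
  0 < t < 1 -> s < F x -> s < F y -> s < F (t *: x + (1 - t) *: y).
Proof.
move=> lF t01 sx sy; have /andP[t0 t1] := t01.
have t1' : 0 < 1 - t by rewrite subr_gt0.
have [s0|s0] := ltP s 0; first exact: lt_le_trans (lc_ge0 _ lF).
apply: lt_le_trans (lc_concave lF _ _ t01).
rewrite -[ltLHS](_ : s `^ t * s `^ (1 - t) = _); last first.
  by rewrite -powRD ?subrKC ?powRr1// oner_eq0.
apply: ltr_pM; rewrite ?powR_ge0//; apply: gt0_ltr_powR => //;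
  by rewrite nnegrE// (le_trans s0)// ltW.
Qed.

Definition marginal n (F : 'rV[R]_n.+1 -> R) (x : 'rV[R]_n) : R :=
  fine (\int[lebR]_t (F (rV_cons (t, x)))%:E)%E.

Section marginal_log_concave.
Variables (n : nat) (F : 'rV[R]_n.+1 -> R) (C r : R).
Hypothesis lF : log_concave F C r.

Let r0 := lc_r_ge0 lF.

Let supp1 x t : F (rV_cons (t, x)) != 0 -> `|t| <= r.
Proof. by move=> /(lc_support lF)/(_ ord0); rewrite rV_cons0. Qed.

Let meas1 x : measurable_fun setT
  (fun t : measurableTypeR R => F (rV_cons (t, x))).
Proof.
apply: measurableT_comp; first exact: lc_measurable lF.
exact: measurable_rV_cons1.
Qed.

Let C_ge0 : 0 <= C.
Proof. exact: le_trans (lc_ge0 0 lF) (lc_le 0 lF). Qed.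

Let slice_le x :
  (\int[lebR]_t (F (rV_cons (t, x)))%:E <= (C * (2 * r))%:E)%E.
Proof.
have mI : measurable (`[- r, r]%classic : set (measurableTypeR R)).
  exact: measurable_itv.
apply: (@le_trans _ _ (\int[lebR]_t (C%:E * (\1_(`[- r, r]%classic) t)%:E))%E).
  apply: ge0_le_integral => //.
  - by move=> t _; rewrite lee_fin (lc_ge0 _ lF).
  - by apply/measurable_EFinP; exact: meas1.
  - by apply: measurable_funeM; exact/measurable_EFinP/measurable_indic.
  move=> t _; rewrite -EFinM lee_fin indicE; case: (boolP (t \in _)).
    by move=> _; rewrite mulr1 (lc_le _ lF).
  rewrite notin_setE/= in_itv/= => /negP tr; rewrite mulr0.
  suff /eqP -> : F (rV_cons (t, x)) == 0 by [].
  by apply: contraNT tr => /supp1; rewrite ler_norml.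
rewrite ge0_integralZl ?lee_fin//; last exact/measurable_EFinP/measurable_indic.
rewrite integral_indic// setIT/= lebesgue_measure_itv/= lte_fin.
case: ifPn => _; last by rewrite mule0 lee_fin mulr_ge0// mulr_ge0.
by rewrite -EFinB -EFinM lee_fin ler_wpM2l//; lra.
Qed.

Let slice_ge0 x : (0 <= \int[lebR]_t (F (rV_cons (t, x)))%:E)%E.
Proof. by apply: integral_ge0 => t _; rewrite lee_fin (lc_ge0 _ lF). Qed.

Lemma marginalE x :
  (\int[lebR]_t (F (rV_cons (t, x)))%:E = (marginal F x)%:E)%E.
Proof.
rewrite /marginal fineK// ge0_fin_numE; first exact: le_lt_trans (slice_le x) (ltry _).
exact: slice_ge0.
Qed.

(** Prekopa's theorem for one coordinate: log-concavity of [F] is the pointwise hypothesis of the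
    one-dimensional inequality for the slices over [x], [y] and their combination. *)
Lemma log_concave_marginal : log_concave (marginal F) (C * (2 * r)) r.
Proof.
split => //.
- apply/measurable_EFinP.
  rewrite (_ : _ \o _ = fun x => \int[lebR]_t (F (rV_cons (t, x)))%:E)%E.
    apply: (@measurable_integral_rV_consl _ _ (EFin \o F)).
      by apply/measurable_EFinP; exact: lc_measurable lF.
    by move=> x; rewrite lee_fin (lc_ge0 _ lF).
  by apply/funext => x /=; rewrite marginalE.
- by move=> x; rewrite -!lee_fin -marginalE slice_ge0 slice_le.
- move=> x + i; apply: contra_neqP => ri.
  apply: EFin_inj; rewrite -marginalE integral0_eq// => t _; congr EFin.
  apply/eqP; apply: contra_notT ri => /(lc_support lF)/(_ (lift ord0 i)).
  by rewrite rV_consS.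
move=> x y t t01.
apply: (@prekopa_leindler1 R (fun s => F (rV_cons (s, x)))
  (fun s => F (rV_cons (s, y))) (fun s => F (rV_cons (s, t *: x + (1 - t) *: y)))
  t r C t01); rewrite ?marginalE//; try exact: meas1.
- by move=> s; exact: lc_bound lF _.
- by move=> s; exact: lc_bound lF _.
- by move=> s; exact: lc_ge0 lF.
- by move=> s; exact: supp1.
- by move=> s; exact: supp1.
- move=> s a b u /= sa sb u01; have := lc_superlevel lF u01 sa sb.
  by rewrite !rV_consZ rV_consD -scalerDl subrKC scale1r.
- move=> s a b u /= sa sb u01; have := lc_superlevel lF u01 sa sb.
  by rewrite !rV_consZ rV_consD -scalerDl subrKC scale1r.
move=> a b; have := lc_concave lF (rV_cons (a, x)) (rV_cons (b, y)) t01.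
by rewrite !rV_consZ rV_consD.
Qed.

End marginal_log_concave.

Lemma integrable_bounded_support n (g : 'rV[R]_n -> R) (C r : R) :
  measurable_fun setT g -> (forall x, `|g x| <= C) ->
  (forall x, g x != 0 -> forall i, `|x ord0 i| <= r) ->
  (lebesgue_rV n).-integrable setT (EFin \o g).
Proof.
move=> mg gC gr.
pose B := [set x : 'rV[R]_n | forall i, `[- r, r]%classic (x ord0 i)].
have mB : measurable B.
  by apply: (measurable_rV_box (A := fun=> `[- r, r]%classic)) => i; exact: measurable_itv.
have -> : EFin \o g = (EFin \o g) \_ B.
  apply/funext => x; rewrite patchE; case: ifPn => //; rewrite notin_setE => Bx.
  congr EFin; apply/eqP; apply: contra_notT Bx => /gr gx i.
  by rewrite /= in_itv/= -ler_norml.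
apply/(integrable_mkcond _ mB); apply: measurable_bounded_integrable => //.
- apply: (@lebesgue_rV_bounded _ _ r) => // x Bx i; have := Bx i.
  by rewrite /= in_itv/= -ler_norml.
- exact: measurable_funTS.
- exists C; split; first by rewrite num_real.
  by move=> M CM x _; apply: le_trans (gC x) _; exact: ltW.
Qed.

(* For a log-concave function, the supergradient [u] of [ln f] at the centroid
   [0] gives [f (l y) >= f y * (1 - (1 - l) (u . y))], and the linear term
   integrates to [0]. *)
Lemma log_concave_scaling_base d (f : 'rV[R]_d -> R) (C r l : R)
    (B : set 'rV[R]_d) :
  log_concave f C r -> measurable B -> internal0 [set x | 0 < f x] ->
  (forall x, 0 < f x -> B x) ->
  (forall j, (\int[lebesgue_rV d]_x (f x * (x ord0 j + r))%:E =
     r%:E * \int[lebesgue_rV d]_x (f x)%:E)%E) ->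
  0 < l < 1 ->
  (\int[lebesgue_rV d]_x (f x)%:E <=
   \int[lebesgue_rV d]_x (f (l *: x) * \1_B x)%:E)%E.
Proof.
move=> lf mB if0 fB fc l01; have /andP[l0 l1] := l01.
have l1' : 0 < 1 - l by rewrite subr_gt0.
have r0 := lc_r_ge0 lf.
have mf := lc_measurable lf.
have C0 : 0 <= C by exact: le_trans (lc_ge0 0 lf) (lc_le 0 lf).
have [] := @concave_supergradient R d [set x | 0 < f x] (fun x => ln (f x)) if0.
  move=> x y t /= fx fy t01.
  have fxy : 0 < f (t *: x + (1 - t) *: y) by exact: lc_superlevel lf _ _ _.
  split => //; rewrite -!ln_powR -lnM ?posrE ?powR_gt0//.
  by rewrite ler_ln ?posrE ?mulr_gt0 ?powR_gt0//; exact: lc_concave lf _ _ _ t01.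
move=> u uf.
have f0 : 0 < f 0 by case: if0 => e e0 /(_ 0); apply => i; rewrite mxE normr0.
have key x : f x * (1 - (1 - l) * dotp u x) <= f (l *: x) * \1_B x.
  have := lc_ge0 x lf; rewrite le_eqVlt => /predU1P[<-|fx].
    by rewrite mul0r mulr_ge0 ?(lc_ge0 _ lf)// indicE.
  rewrite indicE mem_set ?mulr1; last exact: fB.
  have := lc_concave lf x 0 l01; rewrite scaler0 addr0; apply: le_trans.
  (* After division by [f x] the lower bound is an exponential; [exp s >= 1 + s] and the
     supergradient bound on [ln (f x) - ln (f 0)] give the linear factor. *)
  rewrite -ler_pdivlMl//.
  have -> : (f x)^-1 * (f x `^ l * f 0 `^ (1 - l)) =
      expR ((1 - l) * (ln (f 0) - ln (f x))).
    rewrite -{1}(lnK fx) -expRN -[f x `^ l]lnK ?posrE ?powR_gt0//.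
    rewrite -[f 0 `^ _]lnK ?posrE ?powR_gt0// !ln_powR -!expRD.
    by congr expR; ring.
  apply: le_trans (expR_ge1Dx _); have := uf x fx; nra.
have Cr0 : 0 <= C * r by rewrite mulr_ge0.
have i1 : (lebesgue_rV d).-integrable setT (EFin \o f).
  apply: (@integrable_bounded_support _ _ C r) => // [x|].
    by rewrite ger0_norm ?(lc_le _ lf) ?(lc_ge0 _ lf).
  exact: lc_support lf.
have i2 j : (lebesgue_rV d).-integrable setT (fun x => (f x * x ord0 j)%:E).
  apply: (@integrable_bounded_support _ (fun x => f x * x ord0 j) (C * r) r).
  - by apply: measurable_funM => //; exact: (@measurable_rV_coord R d j).
  - move=> x; rewrite normrM; have [->|fx] := eqVneq (f x) 0.
      by rewrite normr0 mul0r.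
    apply: ler_pM => //; last exact: (lc_support lf fx).
    by rewrite ger0_norm ?(lc_le _ lf) ?(lc_ge0 _ lf).
  by move=> x; rewrite mulf_eq0 negb_or => /andP[fx _]; exact: lc_support lf _ fx.
(* The hypothesis uses [x ord0 j + r], nonnegative on the support, so that it passes through
   nonnegative integrals; removing [r] times the mass leaves a vanishing first moment. *)
have c0 j : (\int[lebesgue_rV d]_x (f x * x ord0 j)%:E = 0)%E.
  have E x : (f x * (x ord0 j + r))%:E =
      ((f x * x ord0 j)%:E + r%:E * (f x)%:E)%E.
    by rewrite -EFinM -EFinD mulrDr [f x * r]mulrC.
  have := fc j; under eq_integral do rewrite E.
  rewrite integralD//; last exact: (integrableZl measurableT r i1).
  rewrite integralZl//.
  have fa := integrable_fin_num measurableT (i2 j).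
  have fb := integrable_fin_num measurableT i1.
  rewrite -(fineK fa) -(fineK fb) -EFinM -EFinD => -[] H; congr EFin; lra.
pose h x := (\sum_j ((1 - l) * u ord0 j)%:E * (f x * x ord0 j)%:E)%E.
have ih : (lebesgue_rV d).-integrable setT h.
  by apply: integrable_sum => // j _; exact: (integrableZl measurableT _ (i2 j)).
have h0 : (\int[lebesgue_rV d]_x h x = 0)%E.
  rewrite integral_sum//; last by move=> j; exact: (integrableZl measurableT _ (i2 j)).
  by apply: big1 => j _; rewrite integralZl// c0 mule0.
have -> : (\int[lebesgue_rV d]_x (f x)%:E =
    \int[lebesgue_rV d]_x ((f x)%:E - h x))%E.
  by rewrite [RHS]integralB// [X in (_ = _ - X)%E]h0 sube0.
apply: le_integral => //; first exact: integrableB.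
- apply: (@integrable_bounded_support _ (fun x => f (l *: x) * \1_B x) C (r / l)).
  + apply: measurable_funM; last exact: measurable_indic.
    apply: measurableT_comp => //.
    have := @measurable_mulmx R d d l%:M.
    by under eq_fun do rewrite mul_mx_scalar.
  + move=> x; rewrite normrM -[leRHS]mulr1; apply: ler_pM => //.
      by rewrite ger0_norm ?(lc_le _ lf) ?(lc_ge0 _ lf).
    by rewrite indicE ger0_norm// lern1 leq_b1.
  + move=> x; rewrite mulf_eq0 negb_or => /andP[fx _] i.
    have := lc_support lf fx i; rewrite mxE normrM gtr0_norm//.
    by rewrite ler_pdivlMr// mulrC.
- move=> x _; have := key x; rewrite -lee_fin; apply: le_trans.
  rewrite /h; under eq_bigr do rewrite -EFinM.
  rewrite sumEFin -EFinB lee_fin mulrBr mulr1 lerD2l lerN2.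
  rewrite /dotp !mulr_sumr le_eqVlt; apply/orP; left; apply/eqP/eq_bigr => j _.
  ring.
Qed.

End log_concave.

(** * Scaling the last coordinates of a log-concave function *)

Section scaling.
Context {R : realType}.
Notation lebR := (@lebesgue_measure R).

Definition scale_last k (l : R) n (x : 'rV[R]_n) : 'rV[R]_n :=
  x *m diag_mx (\row_(i < n) if (i < k)%N then 1 else l).

Lemma scale_lastE k (l : R) n (x : 'rV[R]_n) i :
  scale_last k l x ord0 i = x ord0 i * (if (i < k)%N then 1 else l).
Proof. by rewrite /scale_last mul_mx_diag !mxE. Qed.

Lemma scale_last_cons k (l : R) n t (x : 'rV[R]_n) :
  scale_last k.+1 l (rV_cons (t, x)) = rV_cons (t, scale_last k l x).
Proof.
apply/rowP => i; rewrite scale_lastE; have [j ->|->] := unliftP ord0 i.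
  by rewrite !rV_consS scale_lastE.
by rewrite !rV_cons0 mulr1.
Qed.

Lemma det_scale_last k d (l : R) :
  \det (diag_mx (\row_(i < k + d) if (i < k)%N then 1 else l)) = l ^+ d.
Proof.
rewrite det_diag big_split_ord/= big1 ?mul1r; last first.
  by move=> i _; rewrite mxE/= ltn_ord.
rewrite (eq_bigr (fun=> l)) ?prodr_const ?card_ord// => i _.
by rewrite mxE /= ltnNge leq_addr.
Qed.

Lemma rsubmx_rV_cons k d (t : R) (x : 'rV[R]_(k + d)) :
  rsubmx (rV_cons (t, x) : 'rV[R]_(k.+1 + d)) = rsubmx x.
Proof.
apply/rowP => j; rewrite [LHS]mxE [RHS]mxE.
have -> : rshift k.+1 j = lift ord0 (rshift k j) :> 'I_(k + d).+1 by exact/val_inj.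
exact: rV_consS.
Qed.

Lemma rsubmx_scale_last k d l (x : 'rV[R]_(k + d)) :
  rsubmx (scale_last k l x) = l *: rsubmx x.
Proof.
by apply/rowP => j; rewrite mxE scale_lastE !mxE/= ltnNge leq_addr mulrC.
Qed.

Lemma measurable_rsubmx k d : measurable_fun setT
  (fun x : 'rV[R]_(k + d) => rsubmx x).
Proof.
apply/measurable_fun_rVP => i.
rewrite (_ : _ \o _ = rV_coord (rshift k i)); first exact: measurable_rV_coord.
by apply/funext => x; rewrite /rV_coord/= mxE.
Qed.

Lemma measurable_scale_last k n l :
  measurable_fun setT (fun x : 'rV[R]_n => scale_last k l x).
Proof. exact: measurable_mulmx. Qed.

(** The [k] coordinates that are not scaled are integrated out one by one, which leaves a
    log-concave function of [d] variables. The uniform lower bound near 0 passes to marginals with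
    an explicit constant. *)
Lemma log_concave_scaling k d (F : 'rV[R]_(k + d) -> R) (C r l : R)
    (B : set 'rV[R]_d) :
  log_concave F C r -> measurable B ->
  (exists e c : R, [/\ 0 < e, 0 < c & forall x : 'rV[R]_(k + d),
     (forall i, `|x ord0 i| < e) -> c <= F x]) ->
  (forall x, F x != 0 -> B (rsubmx x)) ->
  (forall j, (\int[lebesgue_rV (k + d)]_x (F x * (rsubmx x ord0 j + r))%:E =
     r%:E * \int[lebesgue_rV (k + d)]_x (F x)%:E)%E) ->
  0 < l < 1 ->
  (\int[lebesgue_rV (k + d)]_x (F x)%:E <=
   \int[lebesgue_rV (k + d)]_x (F (scale_last k l x) * \1_B (rsubmx x))%:E)%E.
Proof.
move=> + mB + + + l01; elim: k F C => [|k IH] F C lF [e [c [e0 c0 eF]]] FB Fc.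
  have rsub0 (x : 'rV[R]_(0 + d)) : rsubmx x = x.
    by apply/rowP => j; rewrite mxE; congr (x _ _); exact/val_inj.
  have sc0 (x : 'rV[R]_d) : scale_last 0 l x = l *: x.
    by apply/rowP => j; rewrite scale_lastE mxE mulrC.
  under [leRHS]eq_integral do rewrite rsub0 sc0.
  apply: (log_concave_scaling_base lF mB) => //.
  - by exists e => // x xe; apply: lt_le_trans c0 (eF x xe).
  - by move=> x fx; have := FB x; rewrite rsub0; apply; rewrite gt_eqF.
  - by move=> j; have := Fc j; under eq_integral do rewrite rsub0.
have r0 := lc_r_ge0 lF.
have mF := lc_measurable lF.
have lM := log_concave_marginal lF.
have F0 x : 0 <= F x by exact: lc_ge0 lF.
have intM : (\int[lebesgue_rV (k + d)]_x (marginal F x)%:E =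
    \int[lebesgue_rV (k.+1 + d)]_x (F x)%:E)%E.
  rewrite [RHS](@ge0_integral_rV_consC _ (k + d))//; last exact/measurable_EFinP.
  by apply: eq_integral => x _; rewrite (marginalE lF).
have mcons x : measurable_fun setT (fun t : measurableTypeR R => F (rV_cons (t, x))).
  by apply: measurableT_comp => //; exact: measurable_rV_cons1.
have := IH (marginal F) _ lM; rewrite intM => {}IH.
apply: le_trans (IH _ _ _) _.
(* Over a point within [e] of 0 the slice is at least [c] on [[0, e / 2]]. *)
- exists e, (c * (e / 2)); split => //; first by rewrite mulr_gt0// divr_gt0.
  move=> x xe; rewrite -lee_fin -(marginalE lF).
  have -> : ((c * (e / 2))%:E =
      \int[lebR]_t (c%:E * (\1_(`[0%R, (e / 2)%R]%classic) t)%:E))%E.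
    rewrite ge0_integralZl ?lee_fin ?(ltW c0)//; last exact/measurable_EFinP/measurable_indic.
    rewrite integral_indic// setIT/= lebesgue_measure_itv/= lte_fin divr_gt0//.
    by rewrite oppr0 adde0.
  apply: ge0_le_integral => //.
  + by move=> t _; rewrite -EFinM lee_fin mulr_ge0 ?(ltW c0)// indicE.
  + by apply: measurable_funeM; exact/measurable_EFinP/measurable_indic.
  + by apply/measurable_EFinP; exact: mcons.
  move=> t _; rewrite -EFinM lee_fin indicE; case: (boolP (t \in _)).
    rewrite inE/= in_itv/= => /andP[t0 te]; rewrite mulr1; apply: eF => i.
    have [j ->|->] := unliftP ord0 i; first by rewrite rV_consS.
    by rewrite rV_cons0/= ger0_norm//; apply: le_lt_trans te _; lra.
  by rewrite mulr0.
- move=> x; apply: contra_neqP => Bx.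
  apply: EFin_inj; rewrite -(marginalE lF) integral0_eq// => t _; congr EFin.
  by apply: contra_notP Bx => /eqP/FB; rewrite rsubmx_rV_cons.
- move=> j; rewrite -(Fc j) [RHS](@ge0_integral_rV_consC _ (k + d)).
  + apply: eq_integral => x _; under eq_integral do rewrite rsubmx_rV_cons.
    (* A negative value puts [x] outside the support box, so the slice vanishes and with it the
       marginal. *)
    have [rx|rx] := leP 0 (rsubmx x ord0 j + r).
      under eq_integral do rewrite mulrC EFinM.
      rewrite ge0_integralZl//; last 2 first.
      - by apply/measurable_EFinP; exact: mcons.
      - by move=> t _; rewrite lee_fin.
      by rewrite (marginalE lF) -EFinM mulrC.
    have Fx0 t : F (rV_cons (t, x)) = 0.
      apply: contra_ltP rx => /eqP/(lc_support lF)/(_ (lift ord0 (rshift k j))).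
      by rewrite rV_consS mxE ler_norml => /andP[? _]; lra.
    under eq_integral do rewrite Fx0 mul0r; rewrite integral0.
    by rewrite (_ : marginal F x = 0) ?mul0r// /marginal;
      under eq_integral do rewrite Fx0; rewrite integral0.
  + apply/measurable_EFinP; apply: measurable_funM => //.
    apply: measurable_funD => //.
    exact: (measurableT_comp (measurable_rV_coord j) (@measurable_rsubmx k.+1 d)).
  + move=> x; rewrite lee_fin; have [->|/(lc_support lF)/(_ (rshift k.+1 j))] := eqVneq (F x) 0.
      by rewrite mul0r.
    by rewrite ler_norml => /andP[? _]; rewrite mulr_ge0// mxE; lra.
rewrite [leRHS](@ge0_integral_rV_consC _ (k + d)); last 2 first.
- apply/measurable_EFinP; apply: measurable_funM.
    by apply: measurableT_comp => //; exact: measurable_scale_last.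
  exact: (measurableT_comp (measurable_indic mB) (@measurable_rsubmx k.+1 d)).
- by move=> x; rewrite lee_fin mulr_ge0// indicE.
rewrite le_eqVlt; apply/orP; left; apply/eqP/eq_integral => x _.
under [RHS]eq_integral do rewrite rsubmx_rV_cons scale_last_cons mulrC EFinM.
rewrite ge0_integralZl//; last 2 first.
- by apply/measurable_EFinP; exact: mcons.
- by move=> t _; rewrite lee_fin.
by rewrite (marginalE lF) -EFinM mulrC.
Qed.

End scaling.

(** * Scaling a centered convex set along a subspace *)

Section convex_scaling.
Context {R : realType}.

Definition convexV n (P : set 'rV[R]_n) := forall x y (t : R), P x -> P y ->
  0 < t < 1 -> P (t *: x + (1 - t) *: y).

Definition centered n (P : set 'rV[R]_n) :=
  forall j, (\int[lebesgue_rV n]_(x in P) (x ord0 j)%:E = 0)%E.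

Lemma log_concave_indic n (P : set 'rV[R]_n) r : 0 <= r -> measurable P ->
  bounded_by r P -> convexV P -> log_concave (\1_P : 'rV[R]_n -> R) 1 r.
Proof.
move=> r0 mP Pr cP; split => //.
- by move=> x; rewrite indicE lern1 leq_b1 ler0n.
- move=> x; rewrite indicE pnatr_eq0 eqb0 negbK inE; exact: Pr.
move=> x y t t01; have /andP[t0 t1] := t01.
rewrite !indicE; case: (boolP (x \in P)) => xP; last first.
  by rewrite powR0 ?gt_eqF// mul0r.
case: (boolP (y \in P)) => yP; last first.
  by rewrite [X in _ * X]powR0 ?mulr0// gt_eqF// subr_gt0.
by rewrite !powR1 mul1r mem_set//; apply: cP => //; exact: set_mem.
Qed.

Lemma integral_indic_mul n (P : set 'rV[R]_n) (g : 'rV[R]_n -> R) :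
  measurable P -> (\int[lebesgue_rV n]_x (\1_P x * g x)%:E =
  \int[lebesgue_rV n]_(x in P) (g x)%:E)%E.
Proof.
move=> mP; rewrite [RHS]integral_mkcond; apply: eq_integral => x _.
by rewrite patchE indicE; case: ifPn; rewrite ?mul1r ?mul0r.
Qed.

Lemma integrable_coord n (P : set 'rV[R]_n) r (j : 'I_n) : measurable P ->
  bounded_by r P -> (lebesgue_rV n).-integrable P (fun x => (x ord0 j)%:E).
Proof.
move=> mP Pr.
apply: (measurable_bounded_integrable (f := fun x : 'rV[R]_n => x ord0 j)) => //.
- exact: lebesgue_rV_bounded Pr.
- by apply: measurable_funTS; exact: measurable_rV_coord.
- exists r; split; first by rewrite num_real.
  by move=> M CM x Px; apply: le_trans (Pr x Px j) _; exact: ltW.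
Qed.

Lemma centered_comb n (P : set 'rV[R]_n) r (q : 'I_n -> R) (s : R) :
  measurable P -> bounded_by r P -> centered P ->
  (\int[lebesgue_rV n]_(x in P) (\sum_i x ord0 i * q i + s)%:E =
   s%:E * lebesgue_rV n P)%E.
Proof.
move=> mP Pr cP.
have iP i := integrable_coord i mP Pr.
have E (x : 'rV[R]_n) : (\sum_i x ord0 i * q i + s)%:E =
    (\sum_i (q i)%:E * (x ord0 i)%:E + (cst s%:E) x)%E.
  by rewrite EFinD -sumEFin; congr (_ + _)%E; apply: eq_bigr => i _; rewrite -EFinM mulrC.
under eq_integral do rewrite E.
rewrite integralD//; last first.
- apply: (measurable_bounded_integrable (f := fun x : 'rV[R]_n => s)) => //.
    exact: lebesgue_rV_bounded Pr.
  exists `|s|; split; first by rewrite num_real.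
  by move=> M CM x Px; exact: ltW.
- by apply: integrable_sum => // i _; exact: (integrableZl mP _ (iP i)).
rewrite integral_cst// integral_sum//; last first.
  by move=> i; exact: (integrableZl mP _ (iP i)).
by rewrite big1 ?add0e// => i _; rewrite integralZl// cP mule0.
Qed.

(** Substituting [scale_last k l] in the volume on the right produces the factor [l ^+ d] and turns
    the bounds [l * h i] into the bounds [h i] defining [B], which hold on all of [P]. *)
Lemma convex_scaling_coord k d (T : finType) (P : set 'rV[R]_(k + d))
    (b : T -> 'rV[R]_d) (h : T -> R) (r l : R) :
  0 <= r -> measurable P -> bounded_by r P -> convexV P -> internal0 P ->
  centered P -> (forall x i, P x -> dotp (b i) (rsubmx x) <= h i) ->
  0 < l < 1 ->
  ((l ^+ d)%:E * lebesgue_rV (k + d) P <= lebesgue_rV (k + d)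
    [set x | P x /\ forall i, (dotp (b i) (rsubmx x) <= l * h i)%R])%E.
Proof.
move=> r0 mP Pr cP iP P0 Ph l01; have /andP[l0 l1] := l01.
pose B := [set z | forall i, dotp (b i) z <= h i].
have mBh (c : T -> R) : measurable [set z | forall i, dotp (b i) z <= c i].
  rewrite (_ : [set _ | _] = \bigcap_i [set z | dotp (b i) z <= c i]).
    by apply: fin_bigcap_measurable => // i _; exact: measurable_halfspace.
  by apply/seteqP; split => z /= zc i; [move=> _|]; exact: zc.
have mS : measurable [set x | P x /\ forall i, dotp (b i) (rsubmx x) <= l * h i].
  rewrite (_ : [set _ | _] = P `&`
      ((fun x : 'rV[R]_(k + d) => rsubmx x) @^-1` [set z | forall i, dotp (b i) z <= l * h i]))//.
  apply: measurableI => //; rewrite -[X in measurable X]setTI.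
  by apply: measurable_rsubmx => //; exact: mBh.
set S := [set x | _] in mS *.
have := @log_concave_scaling R k d \1_P 1 r l B (log_concave_indic r0 mP Pr cP) (mBh h).
move=> /(_ _ _ _ l01)/=.
rewrite integral_indic// setIT => H.
have {H} : (lebesgue_rV (k + d) P <=
    \int[lebesgue_rV (k + d)]_x (\1_P (scale_last k l x) * \1_B (rsubmx x))%:E)%E.
  apply: H.
  - have [e e0 eP] := iP; exists e, 1; split => // x xe.
    by rewrite indicE mem_set//; exact: eP.
  - by move=> x; rewrite indicE pnatr_eq0 eqb0 negbK inE => Px i; exact: Ph.
  - move=> j; rewrite integral_indic_mul//.
    pose q (i : 'I_(k + d)) : R := (i == rshift k j)%:R.
    have E (x : 'rV[R]_(k + d)) : rsubmx x ord0 j = \sum_i x ord0 i * q i.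
      rewrite (bigD1 (rshift k j))//= /q eqxx mulr1 big1 ?addr0 ?mxE//.
      by move=> i /negbTE ->; rewrite mulr0.
    by under eq_integral do rewrite E; rewrite (centered_comb _ _ _ Pr).
move=> H.
have uM : diag_mx (\row_(i < k + d) if (i < k)%N then 1 else l) \in unitmx.
  by rewrite unitmxE det_scale_last unitfE expf_eq0 gt_eqF// andbF.
rewrite (lebesgue_rV_mulmx uM mS) det_scale_last ger0_norm ?exprn_ge0 ?(ltW l0)//.
apply: lee_wpmul2l; first by rewrite lee_fin exprn_ge0 ?(ltW l0).
apply: le_trans H _.
have mSl : measurable [set x | S (scale_last k l x)].
  rewrite -[X in measurable X]setTI.
  by apply: (@measurable_scale_last R k (k + d) l).
rewrite -/(scale_last _ _ _) -[X in lebesgue_rV _ X](setIT [set x | _]).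
rewrite -[leRHS]integral_indic//.
rewrite le_eqVlt; apply/orP; left; apply/eqP/eq_integral => x _; congr EFin.
rewrite !indicE -natrM mulnb; congr ((nat_of_bool _)%:R).
apply/andP/idP; rewrite !inE /S/= rsubmx_scale_last.
  move=> [Px Bx]; split => // i; rewrite dotpZ ler_pM2l//; exact: Bx.
by move=> [Px Bx]; split => // i; have := Bx i; rewrite dotpZ ler_pM2l.
Qed.

Lemma row_base_rank m n (A : 'M[R]_(m, n)) r : \rank A = r ->
  exists E : 'M[R]_(r, n), (E :=: A)%MS.
Proof. by move=> <-; exists (row_base A); exact: eq_row_base. Qed.

Lemma dotpE n (u x : 'rV[R]_n) : dotp u x = (u *m x^T) ord0 ord0.
Proof. by rewrite mxE; apply: eq_bigr => i _; rewrite mxE. Qed.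

Lemma dotp_mulmx m n (u : 'rV[R]_m) (Q : 'M[R]_(m, n)) (x : 'rV[R]_n) :
  dotp (u *m Q) x = dotp u (x *m Q^T).
Proof. by rewrite !dotpE trmx_mul trmxK mulmxA. Qed.

Lemma dotp_row_mx k d (b : 'rV[R]_d) (x : 'rV[R]_(k + d)) :
  dotp (row_mx 0 b) x = dotp b (rsubmx x).
Proof.
rewrite /dotp big_split_ord/= big1 ?add0r; last first.
  by move=> i _; rewrite row_mxEl mxE mul0r.
by apply: eq_bigr => i _; rewrite row_mxEr mxE.
Qed.

Lemma convexV_mulmx n (P : set 'rV[R]_n) (M : 'M[R]_n) :
  convexV P -> convexV [set x | P (x *m M)].
Proof.
by move=> cP x y t Px Py t01; rewrite /= mulmxDl -!scalemxAl; exact: cP.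
Qed.

Lemma mulmx_coord_le m n (M : 'M[R]_(m, n)) :
  exists2 C : R, 0 < C & forall (e : R) (x : 'rV[R]_m), 0 <= e ->
    (forall i, `|x ord0 i| <= e) -> forall j, `|(x *m M) ord0 j| <= C * e.
Proof.
exists (1 + \sum_i \sum_j `|M i j|).
  rewrite ltr_pwDl// sumr_ge0// => i _; exact: sumr_ge0.
move=> e x e0 xe j; rewrite mxE (le_trans (ler_norm_sum _ _ _))//.
rewrite mulrDl mul1r ler_wpDl// mulr_suml; apply: ler_sum => i _.
rewrite normrM mulrC; apply: ler_pM => //.
rewrite (bigD1 j)//= lerDl; exact: sumr_ge0.
Qed.

(* A linear change of variables turns the row space of [U] into the span of the
   last [\rank U] coordinates. *)
Lemma convex_scaling n (T : finType) (P : set 'rV[R]_n) (U : 'M[R]_n)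
    (a : T -> 'rV[R]_n) (h : T -> R) (r l : R) :
  0 <= r -> measurable P -> bounded_by r P -> convexV P -> internal0 P ->
  centered P -> (forall i, (a i <= U)%MS) ->
  (forall x i, P x -> dotp (a i) x <= h i) -> 0 < l < 1 ->
  ((l ^+ \rank U)%:E * lebesgue_rV n P <= lebesgue_rV n
    [set x | P x /\ forall i, (dotp (a i) x <= l * h i)%R])%E.
Proof.
move=> r0 mP Pr cP iP P0 aU Ph l01.
have dn := rank_leq_row U.
have [d dU] : exists d : nat, \rank U = d by exists (\rank U).
have [k kd] : exists k, n = (k + d)%N by exists (n - d)%N; rewrite subnK// -dU.
rewrite dU; subst n.
(* [C] is a basis of [U] and [E] one of a complement; with [C] placed last, every [a i] involves
   only the last [d] coordinates. *)
have [C UC] := row_base_rank dU.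
have [E UE] : exists E : 'M[R]_(k, k + d), (E :=: U^C)%MS.
  by apply: row_base_rank; rewrite mxrank_compl dU addnK.
have uQ : col_mx E C \in unitmx.
  rewrite -row_full_unit /row_full -addsmxE (adds_eqmx UE UC) addsmxC.
  exact: addsmx_compl_full.
set Q := col_mx E C in uQ.
have [b bE] : exists b : T -> 'rV[R]_d, forall i, a i = row_mx 0 (b i) *m Q.
  have /choice[b bE] i : exists z : 'rV[R]_d, a i = z *m C.
    by apply/submxP; rewrite UC.
  by exists b => i; rewrite mul_row_col mul0mx add0r.
have ab i x : dotp (a i) x = dotp (b i) (rsubmx (x *m Q^T)).
  by rewrite bE dotp_mulmx dotp_row_mx.
pose M := invmx Q^T.
have uM : M \in unitmx by rewrite unitmx_inv unitmx_tr.
have MQ (x : 'rV[R]_(k + d)) : x *m M *m Q^T = x by rewrite mulmxKV ?unitmx_tr.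
have QM (x : 'rV[R]_(k + d)) : x *m Q^T *m M = x by rewrite mulmxK ?unitmx_tr.
pose P' := [set x | P (x *m M)].
have mpre A : measurable A -> measurable [set x : 'rV[R]_(k + d) | A (x *m M)].
  by move=> mA; rewrite -[X in measurable X]setTI; exact: measurable_mulmx.
have [K K0 KQ] := mulmx_coord_le Q^T.
have [K' K'0 KM] := mulmx_coord_le M.
have P'r : bounded_by (K * r) P'.
  by move=> x P'x i; rewrite -(MQ x); apply: KQ => // j; exact: Pr.
have cP' : convexV P' by exact: convexV_mulmx.
have iP' : internal0 P'.
  have [e e0 eP] := iP; exists (e / (2 * K')); first by rewrite divr_gt0 ?mulr_gt0.
  move=> x xe; apply: eP => i.
  have : `|(x *m M) ord0 i| <= K' * (e / (2 * K')).
    by apply: KM => [|j]; [rewrite divr_ge0 ?mulr_ge0 ?ltW|exact: ltW].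
  have -> : K' * (e / (2 * K')) = e / 2 by field; rewrite gt_eqF.
  by move=> /le_lt_trans; apply; lra.
have mP' := mpre _ mP.
have P'0 : centered P'.
  move=> j.
  have i1 := integrable_coord j mP' P'r.
  (* Shifting the coordinate by [s] makes [f] nonnegative, so that the change of variables
     transports the centroid condition. *)
  pose s := K * r.
  have s0 : 0 <= s by rewrite mulr_ge0// ltW.
  pose f (x : 'rV[R]_(k + d)) := (\1_P x * ((x *m Q^T) ord0 j + s))%:E.
  have f0 x : (0 <= f x)%E.
    rewrite lee_fin indicE; case: (boolP (x \in P)); rewrite ?mul0r// inE => Px.
    have := P'r (x *m Q^T); rewrite /P'/= QM => /(_ Px j).
    by rewrite ler_norml mul1r => /andP[? _]; rewrite /s; lra.
  have mf : measurable_fun setT f.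
    apply/measurable_EFinP; apply: measurable_funM => //; apply: measurable_funD => //.
    exact: (measurableT_comp (measurable_rV_coord j) (measurable_mulmx Q^T)).
  have := ge0_integral_mulmx uM mf f0.
  rewrite integral_indic_mul//.
  under eq_integral do rewrite mxE.
  rewrite (centered_comb _ _ mP Pr P0).
  have -> : (\int[lebesgue_rV (k + d)]_x f (x *m M) =
      \int[lebesgue_rV (k + d)]_(x in P') (x ord0 j + s)%:E)%E.
    rewrite -[RHS]integral_indic_mul//; apply: eq_integral => x _.
    by rewrite /f MQ !indicE.
  under [in RHS]eq_integral do rewrite EFinD.
  have Pfin' := lebesgue_rV_bounded mP' P'r.
  rewrite integralD//; last first.
    apply: (measurable_bounded_integrable (f := fun x : 'rV[R]_(k + d) => s)) => //.
    exists `|s|; split; first by rewrite num_real.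
    by move=> N CN x Px; exact: ltW.
  have -> : (\int[lebesgue_rV (k + d)]_(x in P') s%:E =
      s%:E * lebesgue_rV (k + d) P')%E by exact: integral_cst.
  rewrite (lebesgue_rV_mulmx uM mP).
  have fa := integrable_fin_num mP' i1.
  have fb : lebesgue_rV (k + d) P' \is a fin_num by rewrite ge0_fin_numE.
  rewrite -/P' -(fineK fa) -(fineK fb) -!EFinM => -[] H.
  have D0 : `|\det M| != 0 by rewrite normr_eq0 -unitfE -unitmxE.
  by congr EFin; apply: (mulfI D0); rewrite mulr0; move: H; lra.
have := @convex_scaling_coord k d T P' b h (K * r) l.
rewrite mulr_ge0 ?(ltW K0)// => /(_ isT mP' P'r cP' iP' P'0 _ l01) H.
have mS : measurable [set x | P x /\ forall i, dotp (a i) x <= l * h i].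
  rewrite (_ : [set _ | _] = P `&` \bigcap_i [set z | dotp (a i) z <= l * h i]).
    apply: measurableI => //.
    by apply: fin_bigcap_measurable => // i _; exact: measurable_halfspace.
  by apply/seteqP; split => z /= [Pz zc]; split => // i; [move=> _|]; exact: zc.
rewrite (lebesgue_rV_mulmx uM mP) (lebesgue_rV_mulmx uM mS) muleCA.
apply: lee_wpmul2l => //; apply: le_trans (H _) _.
  by move=> x i P'x; rewrite -(MQ x) -ab; exact: Ph.
rewrite le_eqVlt; apply/orP; left; apply/eqP; congr (lebesgue_rV _ _).
by apply/seteqP; split => x /= [P'x xb]; split => // i; have := xb i; rewrite ab MQ.
Qed.

End convex_scaling.

(** * Convex hulls and polytopes *)

Section convex_hulls.
Context {R : realType}.

Lemma conv_hull_convexV n (S : set 'rV[R]_n) : convexV (conv_hull S).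
Proof.
move=> x y t Sx Sy /andP[t0 t1].
have := @conv_hull_convex R n S x y (Itv01 (ltW t0) (ltW t1)).
by rewrite !inE; apply.
Qed.

Lemma conv_hull_min n (S K : set 'rV[R]_n) :
  convexV K -> S `<=` K -> conv_hull S `<=` K.
Proof.
move=> cK SK; apply: smallest_sub => //=.
apply/convex_setW => x y /set_mem Kx /set_mem Ky t t0 t1; apply/mem_set.
by apply: cK => //; rewrite t0.
Qed.

Lemma sub_conv_hull n (S : set 'rV[R]_n) : S `<=` conv_hull S.
Proof. by move=> x Sx; exact: sub_smallest Sx. Qed.

Lemma conv_hullS n (S S' : set 'rV[R]_n) :
  S `<=` S' -> conv_hull S `<=` conv_hull S'.
Proof.
move=> SS'; apply: conv_hull_min; first exact: conv_hull_convexV.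
by move=> x /SS'; exact: sub_conv_hull.
Qed.

Lemma convexV_dotp n (u : 'rV[R]_n) c : convexV [set x | dotp u x = c].
Proof. by move=> x y t /= ux uy _; rewrite dotpD !dotpZ ux uy; ring. Qed.

Lemma convexVI n (K K' : set 'rV[R]_n) :
  convexV K -> convexV K' -> convexV (K `&` K').
Proof. by move=> cK cK' x y t [Kx K'x] [Ky K'y] t01; split; [exact: cK|exact: cK']. Qed.

Lemma dotp_continuous n (u : 'rV[R]_n) : continuous (dotp u).
Proof.
move=> x A /= /nbhs_ballP[e /= e0 eA].
have [C C0 Cu] := mulmx_coord_le (u^T : 'M[R]_(n, 1)).
apply/nbhs_rVP; exists (e / (2 * C)); first by rewrite divr_gt0 ?mulr_gt0.
move=> y xy; apply: eA; rewrite /ball/= /dotp -sumrB.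
have := Cu (e / (2 * C)) (x - y) _ _ ord0.
have -> : ((x - y) *m u^T) ord0 ord0 = \sum_i (u ord0 i * x ord0 i - u ord0 i * y ord0 i).
  by rewrite mxE; apply: eq_bigr => i _; rewrite !mxE; ring.
have -> : C * (e / (2 * C)) = e / 2 by field; rewrite gt_eqF.
have ce : 0 <= e / (2 * C) by rewrite divr_ge0 ?mulr_ge0 ?ltW.
move=> /(_ ce) H; apply: le_lt_trans (H _) _; last lra.
by move=> i; rewrite !mxE ltW.
Qed.

Lemma closed_dotp n (u : 'rV[R]_n) c : closed [set x | dotp u x <= c].
Proof.
apply: (@closed_comp _ _ (dotp u) [set t | t <= c]); last exact: closed_le.
by move=> x _; exact: dotp_continuous.
Qed.

Lemma mulmx_continuous m n (M : 'M[R]_(m, n)) :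
  continuous (fun x : 'rV[R]_m => x *m M).
Proof.
move=> x A /= /nbhs_rVP[e e0 eA].
have [C C0 CM] := mulmx_coord_le M.
apply/nbhs_rVP; exists (e / (2 * C)); first by rewrite divr_gt0 ?mulr_gt0.
move=> y xy; apply: eA => i.
have ce : 0 <= e / (2 * C) by rewrite divr_ge0 ?mulr_ge0 ?ltW.
have := CM (e / (2 * C)) (x - y) ce _ i; rewrite mulmxBl !mxE.
have -> : C * (e / (2 * C)) = e / 2 by field; rewrite gt_eqF.
move=> H; apply: le_lt_trans (H _) _; last lra.
by move=> j; rewrite !mxE ltW.
Qed.

Definition simplex m : set 'rV[R]_m :=
  [set w | (forall i, 0 <= w ord0 i) /\ \sum_i w ord0 i = 1].
Arguments simplex : clear implicits.

Lemma dotp_delta n (i : 'I_n) (x : 'rV[R]_n) : dotp (delta_mx ord0 i) x = x ord0 i.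
Proof.
rewrite /dotp (bigD1 i)//= mxE !eqxx mul1r big1 ?addr0// => j /negbTE ji.
by rewrite mxE eqxx ji mul0r.
Qed.

Lemma compact_simplex m : compact (simplex m).
Proof.
apply: bounded_closed_compact.
  exists 1; split; first by rewrite num_real.
  move=> M M1 w [w0 w1]; rewrite /= [leLHS]/Num.norm/= mx_normrE.
  apply/bigmax_leP; split; first by rewrite ltW// (lt_trans _ M1).
  move=> [i j] _ /=; rewrite ord1 ger0_norm//; apply: le_trans (ltW M1).
  by rewrite -w1 (bigD1 j)//= lerDl sumr_ge0.
rewrite (_ : simplex m = \bigcap_i [set w | dotp (- delta_mx ord0 i) w <= 0] `&`
    [set w | dotp (const_mx 1) w <= 1] `&` [set w | dotp (- const_mx 1) w <= -1]).
  by apply: closedI; [apply: closedI; [apply: closed_bigI => i _|]|]; exact: closed_dotp.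
have sE (w : 'rV[R]_m) : dotp (const_mx 1) w = \sum_i w ord0 i.
  by apply: eq_bigr => i _; rewrite mxE mul1r.
apply/seteqP; split => w; rewrite /simplex/= !dotpNl sE.
  move=> [w0 w1]; rewrite w1 !lexx; split => //; split => // i _ /=.
  by rewrite dotpNl dotp_delta oppr_le0.
move=> [[w0 w1] w1']; split; last by lra.
by move=> i; have := w0 i I; rewrite /= dotpNl dotp_delta oppr_le0.
Qed.

(** Presents a polytope as the linear image of a compact simplex, from which compactness and
    boundedness follow. *)
Lemma conv_hull_range n m (a : 'M[R]_(m, n)) :
  conv_hull [set x | exists i, x = row i a] = [set w *m a | w in simplex m].
Proof.
apply/seteqP; split.
  apply: conv_hull_min => [x y t [w [w0 w1] <-] [w' [w'0 w'1] <-] /andP[t0 t1]|_ [i ->]].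
    have t1' : 0 < 1 - t by rewrite subr_gt0.
    exists (t *: w + (1 - t) *: w'); last by rewrite mulmxDl -!scalemxAl.
    split => [i|]; first by rewrite !mxE addr_ge0// mulr_ge0// ltW.
    under eq_bigr do rewrite !mxE; rewrite big_split/= -!mulr_sumr w1 w'1; ring.
  exists (delta_mx ord0 i); last by rewrite -rowE.
  split => [j|]; first by rewrite mxE.
  by rewrite (bigD1 i)//= mxE !eqxx big1 ?addr0// => j /negbTE ji; rewrite mxE eqxx ji.
move=> _ [w + <-]; rewrite mulmx_sum_row.
pose c (i : 'I_m) := row i a.
have : forall i, conv_hull [set x | exists i, x = row i a] (c i).
  by move=> i; apply: sub_conv_hull; exists i.
rewrite /c; move: (conv_hull _) (@conv_hull_convexV n [set x | exists i, x = row i a]).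
move=> K cK {c}; elim: m w a => [w a _ [_ ]|m IH w a Ka [w0]].
  by rewrite big_ord0 => /esym/eqP; rewrite oner_eq0.
rewrite !big_ord_recl => w1.
have s0 : 0 <= \sum_(i < m) w ord0 (lift ord0 i) by rewrite sumr_ge0.
move: s0; rewrite le_eqVlt => /predU1P[s0|s0].
  rewrite big1 ?addr0; last first.
    move=> i _; move/esym/eqP: s0; rewrite psumr_eq0// => /allP/(_ i).
    by rewrite mem_index_enum => /(_ isT)/eqP ->; rewrite scale0r.
  by move: w1; rewrite -s0 addr0 => ->; rewrite scale1r.
set s := \sum_(i < m) _ in s0 w1.
(* Convexity is stated for strict combinations, so a zero first weight is dropped; otherwise the
   tail is renormalized by its sum [s]. *)
have [w00|w00] := eqVneq (w ord0 ord0) 0.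
  rewrite w00 scale0r add0r.
  have := IH (\row_i w ord0 (lift ord0 i)) (\matrix_i row (lift ord0 i) a).
  under eq_bigr do rewrite mxE rowK; apply; first by move=> i; rewrite rowK.
  by split => [i|]; rewrite ?mxE//; under eq_bigr do rewrite mxE; rewrite -w1 w00 add0r.
have := IH (\row_i (w ord0 (lift ord0 i) / s)) (\matrix_i row (lift ord0 i) a).
under eq_bigr do rewrite mxE rowK.
move=> H.
have {}H : K (\sum_(i < m) (w ord0 (lift ord0 i) / s) *: row (lift ord0 i) a).
  apply: H; first by move=> i; rewrite rowK.
  split => [i|]; first by rewrite mxE divr_ge0// ltW.
  by under eq_bigr do rewrite mxE; rewrite -mulr_suml mulfV// gt_eqF.
have := cK _ _ (w ord0 ord0) (Ka ord0) H.
have -> : 1 - w ord0 ord0 = s by rewrite -w1 addrC addKr.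
rewrite lt0r w00 w0/= => /(_ _).
have -> : w ord0 ord0 < 1 by rewrite -w1 ltrDl.
move=> /(_ isT); congr K; congr (_ + _); rewrite scaler_sumr.
by apply: eq_bigr => i _; rewrite scalerA mulrC divfK// gt_eqF.
Qed.

Lemma polytope_rows n (P : set 'rV[R]_n) : polytope P ->
  exists m (a : 'M[R]_(m, n)), P = conv_hull [set x | exists i, x = row i a].
Proof.
move=> [A /finite_seqP[s ->] ->]; exists (size s), (\matrix_i nth 0 s i).
congr conv_hull; apply/seteqP; split => x /=.
  move=> xs; have xi : (index x s < size s)%N by rewrite index_mem.
  by exists (Ordinal xi); rewrite rowK/= nth_index.
by move=> [i ->]; rewrite rowK mem_nth.
Qed.

Lemma polytope_compact n (P : set 'rV[R]_n) : polytope P -> compact P.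
Proof.
move=> /polytope_rows[m [a ->]]; rewrite conv_hull_range.
apply: continuous_compact; last exact: compact_simplex.
by apply: continuous_subspaceT; exact: mulmx_continuous.
Qed.

Lemma rV_hausdorff n : hausdorff_space 'rV[R]_n.
Proof. exact: norm_hausdorff. Qed.

Lemma polytope_closed n (P : set 'rV[R]_n) : polytope P -> closed P.
Proof.
move=> pP; apply: compact_closed; [exact: rV_hausdorff|exact: polytope_compact].
Qed.

Lemma polytope_measurable n (P : set 'rV[R]_n) : polytope P -> measurable P.
Proof. by move=> /polytope_closed; exact: closed_rV_measurable. Qed.

Lemma polytope_bounded n (P : set 'rV[R]_n) : polytope P ->
  exists2 r : R, 0 <= r & bounded_by r P.
Proof.
move=> /polytope_rows[m [a ->]]; rewrite conv_hull_range.
have [C C0 Ca] := mulmx_coord_le a; exists (C * 1); first by rewrite mulr1 ltW.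
move=> _ [w [w0 w1] <-] j; apply: Ca => // i.
by rewrite ger0_norm// -w1 (bigD1 i)//= lerDl sumr_ge0.
Qed.

Lemma polytope_convexV n (P : set 'rV[R]_n) : polytope P -> convexV P.
Proof. by move=> [A _ ->]; exact: conv_hull_convexV. Qed.

Lemma interior_internal0 n (P : set 'rV[R]_n) : interior P 0 -> internal0 P.
Proof.
move=> /nbhs_rVP[e e0 eP]; exists e => // x xe; apply: eP => i.
by rewrite mxE sub0r normrN.
Qed.

End convex_hulls.

(** * Supporting functionals *)

Section gauge.
Context {R : realType}.
Variables (n : nat) (P : set 'rV[R]_n) (r : R).
Hypotheses (Pclosed : closed P) (Pconvex : convexV P) (Pbounded : bounded_by r P)
  (Pinternal : internal0 P).

Definition gauge_set (x : 'rV[R]_n) := [set s : R | 0 < s /\ P (s^-1 *: x)].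

(** The Minkowski functional of [P]. *)
Definition gauge x := inf (gauge_set x).

Lemma internal0_mem : P 0.
Proof. by case: Pinternal => e e0; apply => i; rewrite mxE normr0. Qed.

Lemma convexV_star x s : P x -> 0 <= s <= 1 -> P (s *: x).
Proof.
move=> Px /andP[]; rewrite le_eqVlt => /predU1P[<- _|s0].
  by rewrite scale0r; exact: internal0_mem.
rewrite le_eqVlt => /predU1P[->|s1]; first by rewrite scale1r.
have := Pconvex Px internal0_mem; move=> /(_ s); rewrite scaler0 addr0 s0 s1.
exact.
Qed.

Lemma coord_le_sum (x : 'rV[R]_n) i : `|x ord0 i| <= \sum_j `|x ord0 j|.
Proof. by rewrite (bigD1 i)//= lerDl sumr_ge0. Qed.

Lemma gauge_set_nonempty x : gauge_set x !=set0.
Proof.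
have [e e0 eP] := Pinternal; pose c := \sum_j `|x ord0 j|.
have c0 : 0 <= c by exact: sumr_ge0.
exists ((c + 1) / e); split; first by rewrite divr_gt0// ltr_wpDl.
apply: eP => i; rewrite mxE invf_div normrM gtr0_norm ?divr_gt0 ?ltr_wpDl//.
rewrite mulrAC ltr_pdivrMr ?ltr_wpDl// ltr_pM2l//.
by rewrite (le_lt_trans (coord_le_sum _ _))// ltrDl.
Qed.

Lemma gauge_set_up x s t : gauge_set x s -> s <= t -> gauge_set x t.
Proof.
move=> [s0 Ps] st; have t0 : 0 < t := lt_le_trans s0 st.
split => //; have -> : t^-1 *: x = (s / t) *: (s^-1 *: x).
  by rewrite scalerA mulrAC mulfV ?mul1r// gt_eqF.
by apply: convexV_star => //; rewrite divr_ge0 ?(ltW s0) ?(ltW t0)//= ler_pdivrMr// mul1r.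
Qed.

Lemma gauge_le x s : gauge_set x s -> gauge x <= s.
Proof. by apply: ge_inf; exists 0 => t [/ltW]. Qed.

Lemma gauge_ge x c : (forall s, gauge_set x s -> c <= s) -> c <= gauge x.
Proof. by move=> cs; apply: lb_le_inf => //; exact: gauge_set_nonempty. Qed.

Lemma gauge_lt x t : gauge x < t -> gauge_set x t.
Proof.
move=> xt; have [s xs st] := inf_lt (gauge_set_nonempty x) xt.
by apply: gauge_set_up xs (ltW st).
Qed.

Lemma gauge_ge0 x : 0 <= gauge x.
Proof. by apply: gauge_ge => s [/ltW]. Qed.

Lemma gauge_mem_le x : P x -> gauge x <= 1.
Proof. by move=> Px; apply: gauge_le; split => //; rewrite invr1 scale1r. Qed.

Lemma gauge0 : gauge 0 = 0.
Proof.
apply/eqP; rewrite eq_le gauge_ge0 andbT; apply/ler_addgt0Pr => e e0.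
by rewrite add0r; apply: gauge_le; split => //; rewrite scaler0; exact: internal0_mem.
Qed.

Lemma gauge_double x : gauge (x + x) <= 2 * gauge x.
Proof.
rewrite -ler_pdivrMl//; apply: gauge_ge => s [s0 Ps].
rewrite ler_pdivrMl//; apply: gauge_le; split; first by rewrite mulr_gt0.
suff -> : (2 * s)^-1 *: (x + x) = s^-1 *: x by [].
by rewrite scalerDr -scalerDl; congr (_ *: _); field; rewrite gt_eqF.
Qed.

Lemma gauge_convex x y t : 0 < t < 1 ->
  gauge (t *: x + (1 - t) *: y) <= t * gauge x + (1 - t) * gauge y.
Proof.
move=> /andP[t0 t1]; have t1' : 0 < 1 - t by rewrite subr_gt0.
have key a b : gauge_set x a -> gauge_set y b ->
    gauge (t *: x + (1 - t) *: y) <= t * a + (1 - t) * b.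
  move=> [a0 Pa] [b0 Pb]; apply: gauge_le.
  have s0 : 0 < t * a + (1 - t) * b by rewrite addr_gt0// mulr_gt0.
  split => //; set s := _ + _ in s0 *.
  have l01 : 0 < t * a / s < 1.
    rewrite divr_gt0 ?mulr_gt0//= ltr_pdivrMr// mul1r /s ltrDl.
    by rewrite mulr_gt0.
  have := Pconvex Pa Pb l01; congr P; rewrite scalerDr !scalerA.
  have -> : 1 - t * a / s = (1 - t) * b / s.
    by apply/eqP; rewrite subr_eq -mulrDl addrC -/s mulfV// gt_eqF.
  by congr (_ *: _ + _ *: _); field; rewrite ?gt_eqF.
rewrite -lerBlDr -ler_pdivrMl//; apply: gauge_ge => a xa.
rewrite ler_pdivrMl// lerBlDl -lerBlDr -ler_pdivrMl//; apply: gauge_ge => b yb.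
by rewrite ler_pdivrMl// lerBlDr [leRHS]addrC; exact: key.
Qed.

Lemma gauge_gt0 x : x != 0 -> 0 < gauge x.
Proof.
move=> x0.
have [i xi] : exists i, x ord0 i != 0.
  apply/not_existsP => xN; move/eqP: x0; apply; apply/rowP => i.
  by have /negP := xN i; rewrite negbK mxE => /eqP.
have r1 : 0 < `|r| + 1 by rewrite ltr_wpDl.
apply: (@lt_le_trans _ _ (`|x ord0 i| / (`|r| + 1))).
  by rewrite divr_gt0 ?normr_gt0.
apply: gauge_ge => s [s0 /Pbounded/(_ i)]; rewrite mxE normrM gtr0_norm ?invr_gt0//.
rewrite mulrC ler_pdivrMr// => H; rewrite ler_pdivrMr// (le_trans H)// mulrC.
by rewrite ler_wpM2l ?(ltW s0)// (le_trans (ler_norm r))// lerDl.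
Qed.

(** Closedness: a neighbourhood outside [P] of the radial boundary point would contain points
    slightly closer to 0 on the same ray, yet these lie in [P]. *)
Lemma gauge_mem x : x != 0 -> P ((gauge x)^-1 *: x).
Proof.
move=> x0; have g0 := gauge_gt0 x0; set g := gauge x in g0 *.
apply: contrapT => NP.
have /nbhs_rVP[e e0 eN] : nbhs (g^-1 *: x) (~` P).
  by apply: open_nbhs_nbhs; split => //; exact: closed_openC.
pose c := \sum_j `|(g^-1 *: x) ord0 j|.
have c0 : 0 <= c by exact: sumr_ge0.
have c1 : 0 < c + 1 by rewrite ltr_wpDl.
pose d := e / (c + 1); have d0 : 0 < d by rewrite divr_gt0.
have d1 : 0 < 1 + d by rewrite addr_gt0.
have [_] : gauge_set x (g * (1 + d)).
  by apply: gauge_lt; rewrite ltr_pMr// ltrDl.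
apply: eN => i; rewrite !mxE -mulrBl normrM.
have -> : g^-1 - (g * (1 + d))^-1 = g^-1 * (d / (1 + d)).
  by field; rewrite !gt_eqF.
rewrite normrM (@gtr0_norm _ (d / (1 + d))) ?divr_gt0// mulrAC.
have := coord_le_sum (g^-1 *: x) i; rewrite -/c mxE normrM => H.
apply: (@le_lt_trans _ _ (c * (d / (1 + d)))).
  by rewrite ler_wpM2r// divr_ge0 ?ltW.
rewrite mulrA ltr_pdivrMr// /d mulrA ltr_pdivrMr//.
have -> : e * (1 + e / (c + 1)) * (c + 1) = e * c + e + e * e by field; rewrite gt_eqF.
by rewrite mulrC -addrA ltrDl addr_gt0// mulr_gt0.
Qed.

(* The supporting functional at [x] is a supergradient of [- gauge]. *)
Lemma supporting_functional x : x != 0 -> exists u : 'rV[R]_n,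
  dotp u ((gauge x)^-1 *: x) = 1 /\ forall y, P y -> dotp u y <= 1.
Proof.
move=> x0; have g0 := gauge_gt0 x0.
have iT : internal0 [set: 'rV[R]_n] by exists 1.
have [|v vP] := concave_supergradient (phi := fun z => - gauge (x + z)) iT.
  move=> y z t _ _ t01; split => //.
  have -> : x + (t *: y + (1 - t) *: z) = t *: (x + y) + (1 - t) *: (x + z).
    rewrite !scalerDr addrACA -scalerDl; congr (_ + _).
    by rewrite subrKC scale1r.
  by have := gauge_convex (x + y) (x + z) t01; lra.
(* The displacements [x] and [- x] lead to [x + x] and to 0, where the gauge is at most
   [2 * gauge x] and equal to 0; together they fix the value of [v] at [x]. *)
have vx1 : dotp v x >= - gauge x.
  have := vP x I; rewrite addr0; have := gauge_double x; lra.
have vx2 : dotp v x <= - gauge x.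
  have := vP (- x) I; rewrite subrr gauge0 addr0 dotpN; lra.
have vx : dotp v x = - gauge x by apply/eqP; rewrite eq_le vx1 vx2.
exists (- v); split; first by rewrite dotpZ dotpNl vx opprK mulVf// gt_eqF.
move=> y Py; have := vP (y - x) I; rewrite addr0 subrKC dotpB vx.
by rewrite dotpNl; have := gauge_mem_le Py; lra.
Qed.

End gauge.

(** * Facets *)

Section facets.
Context {R : realType}.

(** Says that the linear span of [F] is the whole space. For a face on a hyperplane avoiding 0 this
    amounts to affine dimension [n - 1]. *)
Definition spans n (F : set 'rV[R]_n) :=
  forall v, (forall y, F y -> dotp v y = 0) -> v = 0.

Lemma dotp_eq0 n (u : 'rV[R]_n) : (dotp u u == 0) = (u == 0).
Proof.
apply/idP/eqP => [|->]; last by rewrite /dotp big1// => i _; rewrite mxE mul0r.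
rewrite psumr_eq0; last by move=> i _; rewrite -expr2 sqr_ge0.
move=> /allP u0; apply/rowP => i; rewrite mxE; apply/eqP.
by have := u0 i; rewrite mem_index_enum mulf_eq0 orbb; exact.
Qed.

Lemma dotp_gt0 n (u : 'rV[R]_n) : u != 0 -> 0 < dotp u u.
Proof.
move=> u0; rewrite lt0r dotp_eq0 u0; apply: sumr_ge0 => i _.
by rewrite -expr2 sqr_ge0.
Qed.

Lemma not_row_full_orth m n (M : 'M[R]_(m, n)) : ~~ row_full M ->
  exists2 v : 'rV[R]_n, v != 0 & forall i, dotp v (row i M) = 0.
Proof.
move=> fM; have K0 : cokermx M != 0.
  rewrite -mxrank_eq0 mxrank_coker subn_eq0 -ltnNge ltn_neqAle rank_leq_col andbT.
  exact: fM.
have [j vj] : exists j, (col j (cokermx M))^T != 0.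
  apply/not_existsP => vN; move/eqP: K0; apply; apply/matrixP => i j.
  have /negP := vN j; rewrite negbK => /eqP/rowP/(_ i).
  by rewrite !mxE.
exists (col j (cokermx M))^T => // i.
have /matrixP/(_ i j) := mulmx_coker M; rewrite dotpC !mxE => <-.
by apply: eq_bigr => t _; rewrite !mxE.
Qed.

(** A family of points of [F] of maximal rank has full rank: otherwise a nonzero [v] is orthogonal
    to it, some [y] in [F] has [dotp v y] nonzero, and appending [y] raises the rank. *)
Lemma spans_unitmx n (F : set 'rV[R]_n) : spans F ->
  exists2 M : 'M[R]_n, M \in unitmx & forall i, F (row i M).
Proof.
move=> sF.
pose Q (k : nat) := `[< exists m (M : 'M[R]_(m, n)),
  (forall i, F (row i M)) /\ \rank M = k >].
have exQ : exists k, Q k.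
  by exists 0%N; apply/asboolP; exists 0%N, 0; split => [[]//|]; rewrite mxrank0.
have ubQ k : Q k -> (k <= n)%N.
  by move=> /asboolP[m [M [_ <-]]]; exact: rank_leq_col.
have [k /asboolP[m [M [FM <-]]] maxQ] := ex_maxnP exQ ubQ.
have fM : row_full M.
  apply: contrapT => /negP/not_row_full_orth[v v0 vM].
  have [y [Fy vy]] : exists y, F y /\ dotp v y <> 0.
    apply/not_existsP => yN; move/eqP: v0; apply; apply: sF => y Fy.
    by apply: contrapT => vy; apply: (yN y).
  have : (\rank (col_mx y M) <= \rank M)%N.
    apply: maxQ; apply/asboolP; exists (1 + m)%N, (col_mx y M); split => // i.
    case: (split_ordP i) => j ->; last by rewrite rowKd.
    by rewrite rowKu ord1 row_id.
  have sM : (M <= col_mx y M)%MS by rewrite -addsmxE addsmxSr.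
  rewrite (geq_leqif (mxrank_leqif_sup sM)) -addsmxE addsmx_sub => /andP[/submxP[w yE] _].
  apply: vy; rewrite yE dotpC dotpE -mulmxA.
  suff -> : M *m v^T = 0 by rewrite mulmx0 mxE.
  apply/matrixP => i j; have := vM i; rewrite dotpC dotpE mxE => H.
  by rewrite ord1 !mxE -[RHS]H; apply: eq_bigr => t _; rewrite !mxE.
exists (rowsub (fullrankfun fM) M).
  by rewrite -row_full_unit; exact: fullrowsub_full.
by move=> i; rewrite row_rowsub.
Qed.

Definition orth n (v : 'rV[R]_n) : {vspace 'rV[R]_n} :=
  lker (linfun (mulmxr v^T : 'rV[R]_n -> 'rV[R]_1)).

Lemma mem_orth n (v x : 'rV[R]_n) : (x \in orth v) = (dotp v x == 0).
Proof.
rewrite memv_ker lfunE/= dotpC dotpE; apply/eqP/eqP => [->|H]; first by rewrite mxE.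
by apply/rowP => i; rewrite ord1 H mxE.
Qed.

Lemma dim_rV n : \dim (fullv : {vspace 'rV[R]_n}) = n.
Proof. by rewrite dimvf /dim/= mul1n. Qed.

Lemma dim_orth n (v : 'rV[R]_n) : v != 0 -> \dim (orth v) = n.-1.
Proof.
move=> v0; pose f := linfun (mulmxr v^T : 'rV[R]_n -> 'rV[R]_1).
have := limg_ker_dim f fullv; rewrite dim_rV capfv.
have -> : \dim (f @: fullv) = 1%N.
  apply/eqP; rewrite eqn_leq (leq_trans (dimvS (subvf _))) ?dim_rV//=.
  rewrite lt0n dimv_eq0; apply: contraNneq v0 => f0.
  have : f v \in (f @: fullv)%VS by rewrite memv_img// memvf.
  rewrite f0 memv0 lfunE/= => /eqP/rowP/(_ ord0); rewrite -dotpE mxE => vv.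
  by rewrite -dotp_eq0 vv.
by rewrite addn1 => /(congr1 predn).
Qed.

Lemma aff_hull_sub n (F : set 'rV[R]_n) v c : (forall x, F x -> dotp v x = c) ->
  forall x, aff_hull F x -> dotp v x = c.
Proof.
move=> Fc x [k [p [w [Fp w1 ->]]]].
by rewrite dotp_sumr; under eq_bigr do rewrite Fc//; rewrite -mulr_suml w1 mul1r.
Qed.

Lemma sub_aff_hull n (F : set 'rV[R]_n) : F `<=` aff_hull F.
Proof.
move=> x Fx; exists 1%N, (fun=> x), (fun=> 1).
by rewrite !big_ord1 scale1r.
Qed.

Section facets_of_polytope.
Variables (n : nat) (P : set 'rV[R]_n).
Hypotheses (n_gt0 : (0 < n)%N) (Pinternal : internal0 P).

Let P0 : P 0.
Proof. exact: internal0_mem. Qed.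

Lemma internal0_scale (x : 'rV[R]_n) : exists2 s : R, 0 < s & P (s *: x).
Proof.
have [e e0 eP] := Pinternal; pose c := \sum_j `|x ord0 j|.
have c0 : 0 <= c by exact: sumr_ge0.
have c1 : 0 < c + 1 by rewrite ltr_wpDl.
exists (e / (c + 1)); first by rewrite divr_gt0.
apply: eP => i; rewrite mxE normrM gtr0_norm ?divr_gt0//.
rewrite mulrAC ltr_pdivrMr// ltr_pM2l//.
by rewrite (le_lt_trans (coord_le_sum _ _))// ltrDl.
Qed.

(** A tight bound 0 would force [u = 0], because [P] contains a positive multiple of [u], and then
    [F = P] has too large a dimension; so the bound is positive and can be normalized to 1. *)
Lemma facet_exposed F : facet P F -> exists u, exposed_by P u 1 F /\ spans F.
Proof.
move=> [[u [c [uc FE]]] [x0 [L [aff dL]]]].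
have Fx0 : aff_hull F x0 by rewrite aff/= subrr mem0v.
have c0 : 0 <= c by have := uc 0 P0; rewrite dotp0.
have nLfull : ~ (fullv <= L)%VS.
  by move=> /dimvS; rewrite dim_rV dL leqNgt ltn_predL n_gt0.
have {}c0 : 0 < c.
  rewrite lt0r c0 andbT; apply/eqP => cE.
  have u0 : u = 0.
    apply/eqP; apply: contrapT => /negP /dotp_gt0 uu.
    have [s s0 /uc] := internal0_scale u; rewrite dotpZ cE.
    by rewrite pmulr_rle0// leNgt uu.
  have FP : F = P.
    rewrite FE; apply/seteqP; split => [x []//|x Px]; split => //=.
    by rewrite u0 cE dotpC dotp0.
  apply: nLfull; apply/subvP => x _.
  have PL y : P y -> y - x0 \in L.
    by move=> Py; have := @sub_aff_hull _ F y; rewrite aff/=; apply; rewrite FP.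
  have [s s0 Psx] := internal0_scale x.
  have := memvB (PL _ Psx) (PL _ P0); rewrite opprB addrA subrK subr0 => sx.
  by rewrite -(scalerK (lt0r_neq0 s0) x) memvZ.
exists (c^-1 *: u).
have uE := dotpZl c^-1 u.
split.
  split; first by move=> x /uc; rewrite uE mulrC ler_pdivrMr// mul1r.
  rewrite FE; apply/seteqP; split => x [Px /= ux]; split => //=.
    by rewrite uE ux mulVf// gt_eqF.
  by move: ux; rewrite uE => /(canRL (mulVKf (lt0r_neq0 c0))); rewrite mulr1.
move=> v vF; apply/eqP; apply: contrapT => /negP v0.
have Fu x : F x -> dotp u x = c by rewrite FE => -[].
have vx0 := aff_hull_sub vF Fx0; have ux0 := aff_hull_sub Fu Fx0.
have Lx l : l \in L -> aff_hull F (x0 + l) by move=> lL; rewrite aff/= addrC addKr.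
have vL l : l \in L -> dotp v l = 0.
  by move=> /Lx/(aff_hull_sub vF); rewrite dotpD vx0 add0r.
have uL l : l \in L -> dotp u l = 0.
  by move=> /Lx/(aff_hull_sub Fu); rewrite dotpD ux0 => H; apply: (addrI c); rewrite H addr0.
have x0L : x0 \notin L by apply/negP => /uL; rewrite ux0 => /eqP; rewrite gt_eqF.
(* [x0] lies outside [L], so the sum has dimension [n], one more than the orthogonal complement of a
   nonzero [v] allows. *)
have : (<[x0]> + L <= orth v)%VS.
  apply/subvP => _ /memv_addP[_ /vlineP[k ->] [l lL ->]].
  by rewrite mem_orth dotpD dotpZ vx0 vL// mulr0 addr0.
move=> /dimvS; rewrite dim_orth// dimv_disjoint_sum; last first.
  apply/eqP; rewrite -subv0; apply/subvP => y /memv_capP[/vlineP[k ->] kL].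
  rewrite memv0; apply: contraNT x0L => /eqP kx.
  have k0 : k != 0 by apply: contra_notN kx => /eqP ->; rewrite scale0r.
  by rewrite -(scalerK k0 x0) memvZ.
rewrite dim_vline dL (_ : (x0 != 0) = true) ?add1n ?ltnn//.
by apply/eqP => x00; move: x0L; rewrite x00 mem0v.
Qed.

(** Points of the hyperplane have coordinates of sum 1 in a basis taken from [F], so the affine hull
    of [F] is the whole hyperplane. *)
Lemma exposed_facet F u : exposed_by P u 1 F -> spans F -> facet P F.
Proof.
move=> [u1 FE] sF; split; first by exists u, 1.
have [M uM FM] := spans_unitmx sF.
have Fu x : F x -> dotp u x = 1 by rewrite FE => -[].
pose x0 := row (Ordinal n_gt0) M.
have Fx0 : F x0 by exact: FM.
have u0 : u != 0.
  apply/eqP => u0; have := Fu _ Fx0.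
  rewrite u0 dotpC dotp0 => /esym/eqP.
  by rewrite oner_eq0.
exists x0, (orth u); split; last exact: dim_orth.
apply/seteqP; split => x /=; rewrite mem_orth dotpB (Fu _ Fx0).
  by move=> /(aff_hull_sub Fu) ->; rewrite subrr.
rewrite subr_eq0 => /eqP ux.
pose w := x *m invmx M.
have xE : x = \sum_i w ord0 i *: row i M by rewrite -mulmx_sum_row mulmxKV.
exists n, (fun i => row i M), (fun i => w ord0 i); split => //.
rewrite -ux xE dotp_sumr.
by apply: eq_bigr => i _; rewrite Fu// mulr1.
Qed.

Lemma exposed_inj F u v : exposed_by P u 1 F -> exposed_by P v 1 F -> spans F ->
  u = v.
Proof.
move=> [_ Fu] [_ Fv] sF; apply/eqP; rewrite -subr_eq0; apply/eqP; apply: sF => y Fy.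
rewrite dotpBl.
have -> : dotp u y = 1 by move: Fy; rewrite Fu => -[].
have -> : dotp v y = 1 by move: Fy; rewrite Fv => -[].
exact: subrr.
Qed.

(* Outer unit normals are the positive multiples of the functional [u] with
   [F = P `&` [set x | dotp u x = 1]]. *)
Lemma outer_unit_normal_exposed F u a : exposed_by P u 1 F -> spans F ->
  outer_unit_normal P F a -> exists2 c : R, 0 < c & a = c *: u.
Proof.
move=> eu sF [aa [c [ac FE]]].
have aE : a = c *: u.
  apply/eqP; rewrite -subr_eq0; apply/eqP; apply: sF => y Fy.
  rewrite dotpBl dotpZl.
  have -> : dotp a y = c by move: Fy; rewrite FE => -[].
  have -> : dotp u y = 1 by case: eu => _ Fu; move: Fy; rewrite Fu => -[].
  by rewrite mulr1 subrr.
exists c => //; rewrite lt0r; apply/andP; split.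
  apply/eqP => c0; move: aa; rewrite aE c0 scale0r dotp0.
  by move=> /esym/eqP; rewrite oner_eq0.
by have := ac 0 P0; rewrite dotp0.
Qed.

Lemma exposed_outer_unit_normal F u : exposed_by P u 1 F -> u != 0 ->
  outer_unit_normal P F ((Num.sqrt (dotp u u))^-1 *: u).
Proof.
move=> [u1 FE] u0; have uu := dotp_gt0 u0.
set k := Num.sqrt _; have k0 : 0 < k by rewrite sqrtr_gt0.
have kE := dotpZl k^-1 u.
split.
  rewrite kE dotpZ mulrA -[dotp u u]sqr_sqrtr ?(ltW uu)// -/k.
  by field; rewrite gt_eqF.
exists k^-1; split => [x /u1|]; first by rewrite kE ger_pMr ?invr_gt0.
rewrite FE; apply/seteqP; split => x [Px /= ux]; split => //=.
  by rewrite kE ux mulr1.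
move: ux; rewrite kE => /(canRL (mulVKf (lt0r_neq0 k0))); rewrite mulfV//.
by rewrite gt_eqF.
Qed.

End facets_of_polytope.

End facets.

(** * Cones over facets *)

Section measure_finite_families.
Context {R : realType} (n : nat).
Notation mu := (@lebesgue_rV R n).

Lemma fsbig_finType (V : Type) (idx : V) (op : Monoid.com_law idx) (T : finType)
    (f : T -> V) :
  \big[op/idx]_(t \in [set: T]) f t = \big[op/idx]_t f t.
Proof.
rewrite (fsbigE (index_enum T)) ?index_enum_uniq//.
  by apply: eq_bigl => t; rewrite in_setT.
by move=> t _; rewrite mem_index_enum.
Qed.

Lemma measurable_bigcup_fin (T : finType) (D : T -> set 'rV[R]_n) :
  (forall t, measurable (D t)) -> measurable (\bigcup_t D t).
Proof. by move=> mD; apply: fin_bigcup_measurable => // t _; exact: mD. Qed.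

Lemma measure_le_sum (T : finType) (D : T -> set 'rV[R]_n) (E : set 'rV[R]_n) :
  (forall t, measurable (D t)) -> measurable E -> E `<=` \bigcup_t D t ->
  (mu E <= \sum_t mu (D t))%E.
Proof.
move=> mD mE ED.
rewrite -(@fsbig_finType _ _ _ _ (fun t => mu (D t))).
by apply: content_sub_fsum => //; exact: finite_finset.
Qed.

Lemma measure_bigcup_null (T : finType) (D : T -> set 'rV[R]_n) :
  (forall t, measurable (D t)) -> (forall t, mu (D t) = 0%E) ->
  mu (\bigcup_t D t) = 0%E.
Proof.
move=> mD D0; apply/eqP; rewrite eq_le measure_ge0 andbT.
apply: le_trans (measure_le_sum mD (measurable_bigcup_fin mD) _) _ => //.
by rewrite big1.
Qed.

Lemma measureD_null (A N : set 'rV[R]_n) : measurable A -> measurable N ->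
  mu N = 0%E -> mu (A `\` N) = mu A.
Proof.
move=> mA mN N0; have mAN : measurable (A `&` N) by exact: measurableI.
rewrite [RHS](measureDI _ mA mN) (_ : _ (A `&` N) = 0%E) ?adde0//.
apply/eqP; rewrite eq_le measure_ge0 andbT -N0.
by apply: le_measure; rewrite ?inE// => x [].
Qed.

Lemma sum_measure_le (T : finType) (D : T -> set 'rV[R]_n)
    (N E : set 'rV[R]_n) :
  (forall t, measurable (D t)) -> measurable N -> mu N = 0%E -> measurable E ->
  (forall t, D t `<=` E) ->
  (forall t t', t != t' -> D t `&` D t' `<=` N) ->
  (\sum_t mu (D t) <= mu E)%E.
Proof.
move=> mD mN N0 mE DE DN.
rewrite (eq_bigr (fun t => mu (D t `\` N))); last by move=> t _; rewrite measureD_null.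
rewrite -(@fsbig_finType _ _ _ _ (fun t => mu (D t `\` N))).
have mDN t : measurable (D t `\` N) by exact: measurableD.
have tDN : trivIset [set: T] (fun t => D t `\` N).
  apply/trivIsetP => t t' _ _ tt'; rewrite -subset0 => x [[Dx Nx] [D'x _]].
  by apply: Nx; apply: DN tt' _ _.
rewrite -(measure_fin_bigcup mu finite_finset tDN (fun t _ => mDN t)).
apply: le_measure; rewrite ?inE//; first exact: measurable_bigcup_fin.
by move=> x [t _ [/DE]].
Qed.

End measure_finite_families.

Section cones.
Context {R : realType} (n : nat) (P : set 'rV[R]_n).
Hypotheses (n_gt0 : (0 < n)%N) (Ppoly : polytope P) (Pint : internal0 P).
Notation mu := (@lebesgue_rV R n).

Let Pconvex : convexV P := polytope_convexV Ppoly.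
Let Pclosed : closed P := polytope_closed Ppoly.
Let P0 : P 0 := internal0_mem Pint.

Lemma convexV_exposed u c F : exposed_by P u c F -> convexV F.
Proof.
by move=> [_ ->]; apply: convexVI => //; exact: convexV_dotp.
Qed.

(** Radial description of the cone, with [dotp u x] as radial coordinate. It makes truncation at
    level [l] a scaling by [l]. *)
Lemma cone0P u F : exposed_by P u 1 F -> spans F ->
  cone0 F = [set x | x = 0 \/ (0 < dotp u x <= 1 /\ F ((dotp u x)^-1 *: x))].
Proof.
move=> eu sF; have cF := convexV_exposed eu; have [u1 FE] := eu.
apply/seteqP; split.
  apply: conv_hull_min; last first.
    move=> x [->|Fx]; first by left.
    right; have -> : dotp u x = 1 by move: Fx; rewrite FE => -[].
    by rewrite ltr01 lexx invr1 scale1r.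
  have half x t : 0 < t -> t <= 1 -> (0 < dotp u x <= 1 /\ F ((dotp u x)^-1 *: x)) ->
      (0 < dotp u (t *: x) <= 1 /\ F ((dotp u (t *: x))^-1 *: (t *: x))).
    move=> t0 t1 [/andP[a0 a1] Fa]; rewrite dotpZ mulr_gt0//= mulr_ile1 ?(ltW t0) ?(ltW a0)//.
    split => //; rewrite scalerA (_ : _ * t = (dotp u x)^-1)//.
    by field; rewrite !gt_eqF.
  move=> x y t xK yK /andP[t0 t1]; have t1' : 0 < 1 - t by rewrite subr_gt0.
  case: xK => [->|xK].
    rewrite scaler0 add0r; case: yK => [->|yK]; first by left; rewrite scaler0.
    by right; apply: half => //; lra.
  case: yK => [->|yK].
    by rewrite scaler0 addr0; right; apply: half => //; exact: ltW.
  right; case: xK => /andP[a0 a1] Fx; case: yK => /andP[b0 b1] Fy.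
  rewrite dotpD !dotpZ; set a := dotp u x in a0 a1 Fx *; set b := dotp u y in b0 b1 Fy *.
  have ta0 : 0 < t * a by rewrite mulr_gt0.
  have tb0 : 0 < (1 - t) * b by rewrite mulr_gt0.
  have s0 : 0 < t * a + (1 - t) * b by rewrite addr_gt0.
  split; first by rewrite s0/=; nra.
  have l01 : 0 < t * a / (t * a + (1 - t) * b) < 1.
    by rewrite divr_gt0//= ltr_pdivrMr// mul1r ltrDl.
  have := cF _ _ _ Fx Fy l01; congr F; rewrite !scalerA scalerDr !scalerA.
  by congr (_ *: _ + _ *: _); field; rewrite ?gt_eqF.
move=> x [->|[/andP[a0 a1] Fx]]; first by apply: sub_conv_hull; left.
have cc := @conv_hull_convexV R n (0 |` F).
have c0 : cone0 F 0 by apply: sub_conv_hull; left.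
have cx : cone0 F ((dotp u x)^-1 *: x) by apply: sub_conv_hull; right.
have -> : x = dotp u x *: ((dotp u x)^-1 *: x) by rewrite scalerA mulfV ?scale1r ?gt_eqF.
move: a1; rewrite le_eqVlt => /predU1P[a1|a1].
  by rewrite [X in X *: _]a1 scale1r.
have := cc _ _ (dotp u x) cx c0; rewrite scaler0 addr0 a0 a1; exact.
Qed.

Lemma cone0_sub u F : exposed_by P u 1 F -> cone0 F `<=` P.
Proof. by move=> [_ FE]; apply: conv_hull_min => // x [->//|]; rewrite FE => -[]. Qed.

Lemma polytope_cone0 u F : exposed_by P u 1 F -> polytope (cone0 F).
Proof.
move=> eu; have [A finA PE] := Ppoly.
have FE : F = conv_hull (A `&` F) by move: eu; rewrite {1}PE => /conv_hull_face.
exists (0 |` (A `&` F)).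
  by rewrite finite_setU; split => //; exact: finite_setIl.
apply/seteqP; split; last by apply: conv_hullS => x [?|[_ ?]]; [left|right].
apply: conv_hull_min; first exact: (@conv_hull_convexV R n _).
move=> x [->|]; first by apply: sub_conv_hull; left.
move=> Fx; have : conv_hull (A `&` F) x by rewrite -FE.
by apply: conv_hullS => y; right.
Qed.

Lemma cone0_scale u F l : exposed_by P u 1 F -> spans F -> 0 < l < 1 ->
  (lebesgue_rV n [set x | cone0 F x /\ (dotp u x <= l)%R] =
   (l ^+ n)%:E * lebesgue_rV n (cone0 F))%E.
Proof.
move=> eu sF /andP[l0 l1].
have mC := polytope_measurable (polytope_cone0 eu).
have mH := @measurable_halfspace R n u l.
have -> : [set x | cone0 F x /\ dotp u x <= l] = cone0 F `&` [set x | dotp u x <= l] by [].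
rewrite (lebesgue_rV_scale l0) ?measurableI//; last exact: measurableI.
congr (_ * lebesgue_rV n _)%E; rewrite (cone0P eu sF); apply/seteqP; split => x /=.
  move=> [[/eqP|]]; first by rewrite scaler_eq0 gt_eqF//= => /eqP ->; left.
  rewrite dotpZ => -[/andP[a0 _]]; rewrite scalerA invfM => Fx al; right.
  move: a0 al; rewrite pmulr_rgt0// -[leRHS]mulr1 ler_pM2l// => -> ->; split => //.
  by move: Fx; rewrite mulrAC mulVf ?gt_eqF// mul1r.
move=> [->|[/andP[a0 a1] Fx]]; first by rewrite scaler0 dotp0; split; [left|exact: ltW].
rewrite dotpZ; split; last by rewrite ger_pMr.
right; rewrite mulr_gt0//= mulr_ile1 ?(ltW a0) ?(ltW l0) ?(ltW l1)//; split => //.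
by rewrite scalerA invfM mulrAC mulVf ?gt_eqF// mul1r.
Qed.

Lemma cone0_gt0 u F : exposed_by P u 1 F -> spans F ->
  (0 < lebesgue_rV n (cone0 F))%E.
Proof.
move=> eu sF; have [M uM FM] := spans_unitmx sF; have [u1 FE] := eu.
have mC := polytope_measurable (polytope_cone0 eu).
rewrite (lebesgue_rV_mulmx uM mC) mule_gt0//.
  by rewrite lte_fin normr_gt0 -unitfE -unitmxE.
have nR : 0 < n%:R :> R by rewrite ltr0n.
(* In the coordinates of the basis [M], the cube with centre [(e, ..., e)] and half-width [e] has
   coordinates between 0 and [1 / n], hence of sum at most 1, and lies in the cone. *)
pose e : R := (2 * n%:R)^-1; have e0 : 0 < e by rewrite invr_gt0 mulr_gt0.
apply: (@lebesgue_rV_gt0 R n e _ (const_mx e)) => //.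
  by rewrite -[X in measurable X]setTI; exact: measurable_mulmx.
move=> w we; have {}we i : 0 < w ord0 i < n%:R^-1.
  have := we i; rewrite mxE distrC ltr_distl subrr => /andP[-> w2]/=.
  suff <- : e + e = n%:R^-1 by [].
  by rewrite /e; field; rewrite gt_eqF.
have s0 : 0 < \sum_i w ord0 i.
  rewrite (bigD1 (Ordinal n_gt0))//= ltr_pwDl//; first by have /andP[] := we (Ordinal n_gt0).
  by apply: sumr_ge0 => i _; have /andP[/ltW] := we i.
have s1 : \sum_i w ord0 i <= 1.
  apply: (@le_trans _ _ (\sum_(i < n) n%:R^-1)).
    by apply: ler_sum => i _; have /andP[_ /ltW] := we i.
  by rewrite sumr_const card_ord -[leLHS]mulr_natr mulVf// gt_eqF.
rewrite /= (cone0P eu sF); right.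
have us : dotp u (w *m M) = \sum_i w ord0 i.
  rewrite dotpC dotpE -mulmxA mxE; apply: eq_bigr => i _.
  have -> : (M *m u^T) i ord0 = dotp (row i M) u.
    by rewrite dotpE !mxE; apply: eq_bigr => j _; rewrite !mxE.
  rewrite dotpC (_ : dotp u (row i M) = 1) ?mulr1//.
  by have := FM i; rewrite {1}FE => -[].
rewrite us s0 s1; split => //.
rewrite scalemxAl.
have : conv_hull [set x | exists i, x = row i M] ((\sum_i w ord0 i)^-1 *: w *m M).
  rewrite conv_hull_range; exists ((\sum_i w ord0 i)^-1 *: w) => //; split.
    by move=> i; rewrite mxE mulr_ge0 ?invr_ge0 ?(ltW s0)//; have /andP[/ltW] := we i.
  by under eq_bigr do rewrite mxE; rewrite -mulr_sumr mulVf// gt_eqF.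
by apply: conv_hull_min; [exact: convexV_exposed eu|move=> _ [i ->]].
Qed.

(** The face exposed in the direction of [x] is the convex hull of some of the finitely many points
    generating [P]. If it does not span, these points lie in a hyperplane through 0 chosen for their
    index set [J], and so does [x]; the null set is the union of these hyperplanes. *)
Lemma cone_cover : exists N : set 'rV[R]_n,
  [/\ measurable N, lebesgue_rV n N = 0%E &
   forall x, ~ N x -> exists u F, [/\ exposed_by P u 1 F, spans F,
     0 < dotp u x & F ((dotp u x)^-1 *: x)]].
Proof.
have [m [a PE]] := polytope_rows Ppoly.
pose bad (J : {set 'I_m}) (v : 'rV[R]_n) :=
  v != 0 /\ forall j, j \in J -> dotp v (row j a) = 0.
have delta0 : delta_mx ord0 (Ordinal n_gt0) != 0 :> 'rV[R]_n.
  by apply/eqP => /rowP/(_ (Ordinal n_gt0)); rewrite !mxE !eqxx => /eqP; rewrite oner_eq0.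
(* [v J] is a common normal of the rows indexed by [J] if there is one, and an arbitrary nonzero
   vector otherwise. *)
have /choice[v vP] (J : {set 'I_m}) : exists v, v != 0 /\ ((exists v', bad J v') -> bad J v).
  have [[v' bv]|nb] := pselect (exists v', bad J v'); first by exists v'; split; case: bv.
  by exists (delta_mx ord0 (Ordinal n_gt0)).
have mH (J : {set 'I_m}) := measurable_hyperplane (v J) 0.
exists (\bigcup_J [set x | dotp (v J) x = 0]); split.
- exact: measurable_bigcup_fin.
- by apply: measure_bigcup_null => // J; apply: lebesgue_rV_hyperplane; case: (vP J).
move=> x Nx; have x0 : x != 0.
  by apply/eqP => x0; apply: Nx; exists finset.set0 => //=; rewrite x0 dotp0.
have [r r0 Pr] := polytope_bounded Ppoly.
have [u [ux u1]] := supporting_functional Pconvex Pr Pint x0.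
have g0 := gauge_gt0 Pr Pint x0.
have Pq := gauge_mem Pclosed Pconvex Pr Pint x0.
pose F := P `&` [set y | dotp u y = 1].
have eu : exposed_by P u 1 F by [].
have uxg : dotp u x = gauge P x.
  by move: ux; rewrite dotpZ => /(canRL (mulVKf (lt0r_neq0 g0))); rewrite mulr1.
have Fq : F ((dotp u x)^-1 *: x) by rewrite uxg; split.
exists u, F; split => //; last by rewrite uxg.
move=> w wF; apply/eqP; apply: contrapT => /negP w0.
pose J := [set j | `[< F (row j a) >]]%SET.
have bw : bad J w by split => // j; rewrite inE => /asboolP/wF.
have [vJ0 vJ] := (vP J).2 (ex_intro _ _ bw).
apply: Nx; exists J => //=.
have : conv_hull ([set x | exists i, x = row i a] `&` F) ((dotp u x)^-1 *: x).
  by move: eu Fq; rewrite PE => /conv_hull_face {1}->.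
have sub : [set x | exists i, x = row i a] `&` F `<=` [set y | dotp (v J) y = 0].
  by move=> _ [[i ->] Fi]; apply: vJ; rewrite inE; exact/asboolP.
move=> /(conv_hull_min (@convexV_dotp R n (v J) 0) sub)/=.
rewrite dotpZ => /eqP; rewrite mulf_eq0 invr_eq0 uxg gt_eqF//= => /eqP; exact.
Qed.

End cones.

(** * Subspace concentration *)

Section subspace_concentration.
Context {R : realType} (n : nat) (P : set 'rV[R]_n).
Hypotheses (n_gt0 : (0 < n)%N) (Ppoly : polytope P) (Pint : internal0 P).
Notation mu := (@lebesgue_rV R n).

Lemma volE (S : set 'rV[R]_n) r : measurable S -> bounded_by r S ->
  ((vol S)%:E = lebesgue_rV n S)%E.
Proof.
move=> mS Sr; rewrite fineK// ge0_fin_numE//.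
exact: lebesgue_rV_bounded Sr.
Qed.

Lemma vol_polytope (S : set 'rV[R]_n) : polytope S ->
  ((vol S)%:E = lebesgue_rV n S)%E.
Proof.
move=> pS; have [r _ Sr] := polytope_bounded pS.
exact: volE (polytope_measurable pS) Sr.
Qed.

Lemma vol_gt0 : 0 < vol P.
Proof.
have [e e0 eP] := Pint.
rewrite -lte_fin vol_polytope//; apply: (@lebesgue_rV_gt0 R n e _ 0) => //.
  exact: polytope_measurable.
by move=> x xe; apply: eP => i; have := xe i; rewrite mxE sub0r normrN.
Qed.

Lemma centroid_centered : centroid P = 0 -> centered P.
Proof.
move=> /rowP cP j; have [r _ Pr] := polytope_bounded Ppoly.
have mP := polytope_measurable Ppoly.
have := cP j; rewrite !mxE => /eqP; rewrite mulf_eq0 invr_eq0 gt_eqF ?vol_gt0//=.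
move=> /eqP H; rewrite -[LHS]fineK; first by congr EFin; exact: H.
by have := integrable_fin_num mP (integrable_coord j mP Pr).
Qed.

Lemma facet_family : exists (T : finType) (F : T -> set 'rV[R]_n) (u : T -> 'rV[R]_n),
  [/\ injective F, forall G, facet P G <-> exists t, G = F t,
      forall t, exposed_by P (u t) 1 (F t) & forall t, spans (F t)].
Proof.
have finF := finite_facets Ppoly; pose X := fset_set (facet P).
have FX (t : X) : facet P (fsval t).
  by have := fsvalP t; rewrite in_fset_set// inE.
have /choice[u uP] (t : X) := facet_exposed n_gt0 Pint (FX t).
exists X, (fun t => fsval t), u; split.
- exact: val_inj.
- move=> G; split => [fG|[t ->]//].
  have GX : G \in X by rewrite in_fset_set// inE.
  by exists [` GX]%fset.
- by move=> t; case: (uP t).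
- by move=> t; case: (uP t).
Qed.

Variables (T : finType) (F : T -> set 'rV[R]_n) (u : T -> 'rV[R]_n).
Hypotheses (F_inj : injective F) (facetsF : forall G, facet P G <-> exists t, G = F t)
  (Fu : forall t, exposed_by P (u t) 1 (F t)) (Fspans : forall t, spans (F t)).

Let w t := vol (cone0 (F t)).

Let wE t : ((w t)%:E = lebesgue_rV n (cone0 (F t)))%E.
Proof. exact: vol_polytope (polytope_cone0 Ppoly (Fu t)). Qed.

Lemma cone_vol_gt0 t : 0 < vol (cone0 (F t)).
Proof. by have := cone0_gt0 n_gt0 Ppoly (Fu t) (@Fspans t); rewrite -wE lte_fin. Qed.

Lemma facet_functional_inj : injective u.
Proof.
move=> t t' utt'; apply: F_inj.
by have [_ ->] := Fu t; have [_ ->] := Fu t'; rewrite utt'.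
Qed.

Lemma vol_le_sum_cone_vol : vol P <= \sum_t vol (cone0 (F t)).
Proof.
have [N [mN N0 NP]] := cone_cover n_gt0 Ppoly Pint.
have mP := polytope_measurable Ppoly.
have mC t := polytope_measurable (polytope_cone0 Ppoly (Fu t)).
rewrite -lee_fin vol_polytope// -(measureD_null mP mN N0) -sumEFin.
rewrite (eq_bigr (fun t => lebesgue_rV n (cone0 (F t)))); last by move=> t _; rewrite wE.
apply: measure_le_sum => //; first exact: measurableD.
move=> x [Px /NP[v [G [ev sG vx Gx]]]].
have [t Gt] : exists t, G = F t by apply/facetsF; exact: exposed_facet ev sG.
exists t => //; rewrite -Gt (cone0P Ppoly ev sG)//; right; rewrite vx; split => //.
by case: ev => v1 _; rewrite /= v1.
Qed.

Lemma subspace_concentration (U : 'M[R]_n) : centered P ->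
  \sum_(t | (u t <= U)%MS) vol (cone0 (F t)) <= (\rank U)%:R / n%:R * vol P.
Proof.
move=> Pcent; set W := \sum_(t | _) _; pose d := \rank U.
have [r r0 Pr] := polytope_bounded Ppoly.
have mP := polytope_measurable Ppoly.
have mC t := polytope_measurable (polytope_cone0 Ppoly (Fu t)).
have V0 := vol_gt0.
have W0 : 0 <= W by apply: sumr_ge0 => t _; exact: ltW (cone_vol_gt0 t).
have Cfin t : (lebesgue_rV n (cone0 (F t)) < +oo)%E by rewrite -wE ltry.
have Pfin : (lebesgue_rV n P < +oo)%E by rewrite -vol_polytope// ltry.
have key l : 0 < l < 1 -> (1 - l ^+ n) * W <= (1 - l ^+ d) * vol P.
  move=> l01; have /andP[l0 l1] := l01.
  (* Replacing the functionals outside [U] by 0 makes their constraint void, so that the family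
     stays indexed by [T]. *)
  pose a t := if (u t <= U)%MS then u t else 0.
  pose Pl := [set x | P x /\ forall t, dotp (a t) x <= l * 1].
  have mPl : measurable Pl.
    rewrite (_ : Pl = P `&` \bigcap_t [set x | dotp (a t) x <= l * 1]).
      apply: measurableI => //; apply: fin_bigcap_measurable => // t _.
      exact: measurable_halfspace.
    by apply/seteqP; split => x /= [Px H]; split => // t; [move=> _|]; exact: H.
  have PlP : Pl `<=` P by move=> x [].
  have Plr : bounded_by r Pl by move=> x /PlP/Pr.
  have H1 : l ^+ d * vol P <= vol Pl.
    rewrite -lee_fin EFinM vol_polytope// (volE mPl Plr).
    apply: (@convex_scaling R n T P U a (fun=> 1) r l) => //.
    - exact: polytope_convexV.
    - by move=> t; rewrite /a; case: ifPn => // _; exact: sub0mx.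
    - move=> x t Px; rewrite /a; case: ifPn => _; first by have [+ _] := Fu t; exact.
      by rewrite dotpC dotp0.
  pose D t := if (u t <= U)%MS then [set x | cone0 (F t) x /\ l < dotp (u t) x] else set0.
  have DE t : (u t <= U)%MS -> D t = cone0 (F t) `\` [set x | cone0 (F t) x /\ dotp (u t) x <= l].
    move=> tU; rewrite /D tU; apply/seteqP; split => x /= [Cx].
      by move=> lx; split => // -[_]; rewrite leNgt lx.
    by move=> H; split => //; rewrite ltNge; apply/negP => ux; apply: H.
  have mCl t : measurable [set x | cone0 (F t) x /\ dotp (u t) x <= l].
    have -> : [set x | cone0 (F t) x /\ dotp (u t) x <= l] =
      cone0 (F t) `&` [set x | dotp (u t) x <= l] by [].
    by apply: measurableI => //; exact: measurable_halfspace.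
  have mD t : measurable (D t).
    have [tU|tU] := boolP (u t <= U)%MS; last by rewrite /D (negbTE tU).
    by rewrite DE//; exact: measurableD.
  have vD t : (u t <= U)%MS -> (lebesgue_rV n (D t) = ((1 - l ^+ n) * w t)%:E)%E.
    move=> tU; rewrite DE// measureD//; last exact: Cfin.
    rewrite (_ : cone0 (F t) `&` _ = [set x | cone0 (F t) x /\ dotp (u t) x <= l]).
      rewrite [X in (_ - X)%E](cone0_scale Ppoly (Fu t) (@Fspans t) l01).
      by rewrite -[X in (X - _)%E]wE -wE -EFinM -EFinB mulrBl mul1r.
    by apply/seteqP; split => x [] // ? [].
  (* Cones over different facets overlap only where their functionals agree, which is a hyperplane
     because the functionals are distinct. *)
  pose N := \bigcup_(p : T * T) if p.1 == p.2 then set0 else [set x | dotp (u p.1 - u p.2) x = 0].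
  have mN0 (p : T * T) :
      measurable (if p.1 == p.2 then set0 else [set x | dotp (u p.1 - u p.2) x = 0]).
    by case: ifPn => // _; exact: measurable_hyperplane.
  have mN : measurable N by exact: measurable_bigcup_fin.
  have N0 : lebesgue_rV n N = 0%E.
    apply: measure_bigcup_null => // p; case: ifPn => [_|p12]; first exact: measure0.
    apply: lebesgue_rV_hyperplane; rewrite subr_eq0; apply: contra p12 => /eqP.
    by move=> /facet_functional_inj ->.
  have DE' t : D t `<=` P `\` Pl.
    rewrite /D; case: ifPn => // tU x [Cx lx]; split.
      by apply: (cone0_sub Ppoly Pint (Fu t)); exact: Cx.
    by move=> [_ /(_ t)]; rewrite /a tU mulr1 leNgt lx.
  have DN t t' : t != t' -> D t `&` D t' `<=` N.
    move=> tt' x []; rewrite /D; case: ifPn => // tU [Cx lx]; case: ifPn => // t'U [C'x l'x].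
    exists (t, t') => //=; rewrite (negbTE tt') /=.
    (* Away from 0, dividing a point of the cone over [F s] by [dotp (u s) x] gives a point of [P],
       where every functional is at most 1. *)
    have half s s' : cone0 (F s) x -> cone0 (F s') x -> l < dotp (u s) x ->
        dotp (u s') x <= dotp (u s) x.
      rewrite (cone0P Ppoly (Fu s) (@Fspans s)) => -[-> _|]; first by rewrite !dotp0.
      move=> [/andP[a0 a1] Fx] _ _.
      have [+ _] := Fu s'; move=> /(_ ((dotp (u s) x)^-1 *: x)).
      rewrite dotpZ mulrC ler_pdivrMr// mul1r; apply.
      by have [_ FE] := Fu s; move: Fx; rewrite {1}FE => -[].
    have E : dotp (u t) x = dotp (u t') x by apply/eqP; rewrite eq_le !half.
    by rewrite dotpBl E subrr.
  have := sum_measure_le mD mN N0 (measurableD mP mPl) DE' DN.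
  have -> : lebesgue_rV n (P `\` Pl) = (vol P - vol Pl)%:E.
    rewrite [LHS](measureD mP mPl Pfin) EFinB vol_polytope// (volE mPl Plr).
    by congr (_ - lebesgue_rV n _)%E; apply/seteqP; split => x [].
  rewrite (bigID (fun t => (u t <= U)%MS))/= [X in (_ + X)%E]big1 ?adde0; last first.
    by move=> t tU; rewrite /D (negbTE tU) measure0.
  rewrite (eq_bigr (fun t => ((1 - l ^+ n) * w t)%:E)); last by move=> t; exact: vD.
  rewrite sumEFin lee_fin -mulr_sumr -/W => H2.
  by apply: le_trans H2 _; rewrite mulrBl mul1r lerB.
have nR : 0 < n%:R :> R by rewrite ltr0n.
suff H : n%:R * W <= d%:R * vol P by rewrite mulrAC ler_pdivlMr// mulrC.
apply/ler_addgt0Pr => e e0.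
(* The limit is made quantitative with [l = 1 - h]: the loss in the geometric sum costs at most
   [n^2 * W * h], which [h <= e / C] bounds by [e]. The summand [e] keeps [C] positive, and the
   bound [1 / 2] on [h] keeps [l] positive. *)
pose C := n%:R ^+ 2 * W + e; have C0 : 0 < C by rewrite ltr_wpDl// mulr_ge0// sqr_ge0.
pose h := Num.min (e / C) 2^-1.
have h0 : 0 < h by rewrite lt_min divr_gt0//= invr_gt0.
have h1 : h < 1 by rewrite gt_min invf_lt1// ltr1n orbT.
pose l := 1 - h; have l0 : 0 < l by rewrite subr_gt0.
have l1 : l < 1 by rewrite gtrBl.
have l01 : 0 < l < 1 by rewrite l0.
(* The common factor [1 - l] is cancelled, which leaves geometric sums with [n] and [d] terms. *)
have := key _ l01; rewrite -!(opprB (l ^+ _)) !subrX1 -!mulNr opprB.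
rewrite -!mulrA ler_pM2l ?subr_gt0// => H.
have Sd : \sum_(i < d) l ^+ i <= d%:R.
  rewrite -[leRHS]mulr1 -[X in X%:R * _](card_ord d) mulr_natl -sumr_const.
  by apply: ler_sum => i _; rewrite exprn_ile1 ?(ltW l0) ?(ltW l1).
have bern k : 1 - k%:R * h <= l ^+ k.
  elim: k => [|k IH]; first by rewrite expr0 mul0r subr0.
  rewrite exprS; apply: (@le_trans _ _ (l * (1 - k%:R * h))); last by rewrite ler_pM2l.
  rewrite /l -natr1; have : 0 <= k%:R * (h * h) by rewrite !mulr_ge0 ?(ltW h0).
  lra.
have Sn : n%:R * (1 - n%:R * h) <= \sum_(i < n) l ^+ i.
  rewrite -[X in X%:R * (_ - _)](card_ord n) mulr_natl -sumr_const.
  apply: ler_sum => i _; apply: le_trans (bern n) _.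
  by apply: ler_wiXn2l; rewrite ?(ltW l0) ?(ltW l1)// ltnW.
have H3 : n%:R * (1 - n%:R * h) * W <= d%:R * vol P.
  apply: (@le_trans _ _ ((\sum_(i < n) l ^+ i) * W)); first exact: ler_wpM2r.
  by apply: le_trans H _; rewrite ler_pM2r.
have H4 : n%:R ^+ 2 * W * h <= e.
  apply: (@le_trans _ _ (C * h)); first by rewrite ler_pM2r// lerDl ltW.
  by rewrite mulrC -ler_pdivlMr// ge_min lexx.
have -> : n%:R * W = n%:R * (1 - n%:R * h) * W + n%:R ^+ 2 * W * h by ring.
exact: lerD.
Qed.

End subspace_concentration.

(** * Linearly independent tuples *)

Section independent_tuples.
Context {R : realFieldType} (T : finType) (n : nat) (u : T -> 'rV[R]_n) (w : T -> R)
  (V : R).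
Hypotheses (n_gt0 : (0 < n)%N) (V_gt0 : 0 < V) (w_gt0 : forall t, 0 < w t)
  (V_le_sum : V <= \sum_t w t)
  (concentration : forall U : 'M[R]_n,
     \sum_(t | (u t <= U)%MS) w t <= (\rank U)%:R / n%:R * V).

Definition rows_of k (f : {ffun 'I_k -> T}) : 'M[R]_(k, n) := \matrix_i u (f i).

(** For [k = n] this is the sum under the root in [Ufun]; all lengths are needed because tuples are
    built one functional at a time. *)
Definition indep_sum k : R :=
  \sum_(f : {ffun 'I_k -> T} | row_free (rows_of f)) \prod_i w (f i).

Lemma row_free_col_mx k (v : 'rV[R]_n) (M : 'M[R]_(k, n)) :
  row_free (col_mx v M) = row_free M && ~~ (v <= M)%MS.
Proof.
have := mxrank_sum_cap v M; rewrite /row_free -addsmxE => e.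
have [vM|vM] /= := boolP (v <= M)%MS.
  rewrite andbF; apply/negbTE; rewrite neq_ltn.
  by rewrite (addsmx_idPr vM) ltnS rank_leq_row.
have v0 : v != 0 by apply: contraNneq vM => ->; exact: sub0mx.
have c0 : \rank (v :&: M)%MS = 0%N.
  apply/eqP; apply: contraNT vM; rewrite -lt0n => c0.
  have := mxrank_leqif_sup (capmxSl v M); rewrite rank_rV v0 /=.
  move=> [_]; have -> : \rank (v :&: M)%MS == true.
    by rewrite eqn_leq c0 andbT (leq_trans (mxrankS (capmxSl v M)))// rank_rV v0.
  by move=> /esym; rewrite sub_capmx submx_refl.
by move: e; rewrite c0 rank_rV v0 addn0 andbT => ->; rewrite add1n eqSS.
Qed.

Lemma indep_sumS k : indep_sum k.+1 =
  \sum_(f : {ffun 'I_k -> T} | row_free (rows_of f))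
    (\prod_i w (f i)) * \sum_(t | ~~ (u t <= rows_of f)%MS) w t.
Proof.
pose h (p : {ffun 'I_k -> T} * T) : {ffun 'I_k.+1 -> T} :=
  [ffun i => if unlift ord0 i is Some j then p.1 j else p.2].
pose h' (f : {ffun 'I_k.+1 -> T}) : {ffun 'I_k -> T} * T :=
  ([ffun j => f (lift ord0 j)], f ord0).
have hK : cancel h h'.
  move=> [f t]; rewrite /h' /h !ffunE unlift_none; congr pair.
  by apply/ffunP => j; rewrite !ffunE liftK.
have h'K : cancel h' h.
  move=> f; apply/ffunP => i; rewrite ffunE.
  by case: unliftP => [j ->|->]; rewrite /= ?ffunE.
rewrite /indep_sum (reindex h); last by exists h' => f _; [exact: hK|exact: h'K].
under [RHS]eq_bigr do rewrite mulr_sumr.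
rewrite pair_big_dep/=; apply: eq_big => [[f t]|[f t] _] /=.
  rewrite -row_free_col_mx; congr row_free; apply/row_matrixP => i.
  rewrite rowK /h ffunE; case: unliftP => [j ->|->] /=.
    have -> : lift ord0 j = rshift 1 j by exact/val_inj.
    by rewrite (@rowKd _ 1) rowK.
  have -> : (ord0 : 'I_k.+1) = lshift k (ord0 : 'I_1) by exact/val_inj.
  by rewrite (@rowKu _ 1) row_id.
rewrite big_ord_recl /h ffunE unlift_none mulrC; congr (_ * _).
by apply: eq_bigr => i _; rewrite ffunE liftK.
Qed.

Lemma indep_sum0 : indep_sum 0 = 1.
Proof.
rewrite /indep_sum (big_pred1 (ffun0 (card_ord 0))); first by rewrite big_ord0.
move=> f /=; rewrite (_ : f = ffun0 (card_ord 0)).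
  by rewrite eqxx /row_free -leqn0 rank_leq_row.
by apply/ffunP => -[].
Qed.

Lemma span_weight k (f : {ffun 'I_k -> T}) : row_free (rows_of f) ->
  \sum_(t | (u t <= rows_of f)%MS) w t <= k%:R / n%:R * V.
Proof.
move=> /eqP rf; have := concentration <<rows_of f>>%MS; rewrite genmxE rf.
by apply: le_trans; rewrite le_eqVlt; apply/orP; left; apply/eqP/eq_bigl => t; rewrite genmxE.
Qed.

Lemma off_span_weight k (f : {ffun 'I_k -> T}) :
  \sum_(t | ~~ (u t <= rows_of f)%MS) w t =
  \sum_t w t - \sum_(t | (u t <= rows_of f)%MS) w t.
Proof. by rewrite [\sum_t w t](bigID (fun t => (u t <= rows_of f)%MS))/= addrAC subrr add0r. Qed.

(** Lower bound for the weight outside the span of [k] independent functionals: the total is at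
    least [V], and the span carries at most [k / n * V]. *)
Let c k := (1 - k%:R / n%:R) * V.

Let nR : 0 < n%:R :> R. Proof. by rewrite ltr0n. Qed.

Let c_gt0 k : (k < n)%N -> 0 < c k.
Proof.
by move=> kn; rewrite mulr_gt0// subr_gt0 ltr_pdivrMr// mul1r ltr_nat.
Qed.

Let prod_c : \prod_(k < n) c k = n`!%:R / n%:R ^+ n * V ^+ n.
Proof.
rewrite big_split/= prodr_const card_ord; congr (_ * _).
have -> : \prod_(k < n) (1 - k%:R / n%:R) = \prod_(k < n) (((n - k)%N)%:R / n%:R) :> R.
  apply: eq_bigr => k _; rewrite natrB; last exact: ltnW.
  by rewrite mulrBl mulfV// gt_eqF.
rewrite big_split/= prodr_const card_ord exprVn; congr (_ * _).
rewrite -natr_prod; congr (_%:R); rewrite fact_prod.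
rewrite (reindex_inj rev_ord_inj)/= big_add1/= big_mkord.
by apply: eq_bigr => k _; rewrite subKn.
Qed.

Lemma indep_sum_ge0 k : 0 <= indep_sum k.
Proof. by apply: sumr_ge0 => f _; apply: prodr_ge0 => i _; exact: ltW. Qed.

Lemma indep_sum_step k : c k * indep_sum k <= indep_sum k.+1.
Proof.
rewrite indep_sumS mulr_sumr; apply: ler_sum => f rf; rewrite mulrC.
apply: ler_wpM2l; first by apply: prodr_ge0 => i _; exact: ltW.
by rewrite off_span_weight /c mulrBl mul1r lerB// span_weight.
Qed.

(** Nondecreasing up to [n] with value 1 at 0, which gives the inequality; the value 1 at [n] then
    forces 1 throughout, which gives the equality case. *)
Let ratio k := indep_sum k / \prod_(i < k) c i.

Let prod_gt0 k : (k <= n)%N -> 0 < \prod_(i < k) c i.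
Proof. by move=> kn; apply: prodr_gt0 => i _; apply: c_gt0; exact: leq_trans kn. Qed.

Let ratioS k : (k < n)%N -> ratio k <= ratio k.+1.
Proof.
move=> kn; rewrite /ratio big_ord_recr/= invfM mulrA ler_pdivlMr ?c_gt0//.
by rewrite mulrAC ler_wpM2r ?invr_ge0 ?(ltW (prod_gt0 (ltnW kn)))// mulrC indep_sum_step.
Qed.

Let ratio_le j k : (j <= k <= n)%N -> ratio j <= ratio k.
Proof.
move=> /andP[]; elim: k => [|k IH]; first by rewrite leqn0 => /eqP ->.
rewrite leq_eqVlt => /predU1P[->//|jk] kn.
by rewrite (le_trans (IH _ _)) ?ratioS// ltnW.
Qed.

Let ratio0 : ratio 0 = 1.
Proof. by rewrite /ratio indep_sum0 big_ord0 divr1. Qed.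

Lemma indep_sum_ge : n`!%:R / n%:R ^+ n * V ^+ n <= indep_sum n.
Proof.
have := @ratio_le 0 n; rewrite leq0n leqnn ratio0 => /(_ isT).
by rewrite /ratio ler_pdivlMr ?prod_gt0// mul1r prod_c.
Qed.

Let u_neq0 t : u t != 0.
Proof.
apply/eqP => ut0; have := concentration 0; rewrite mxrank0 !mul0r (bigD1 t)/=.
  by rewrite leNgt ltr_pwDl// sumr_ge0// => s _; exact: ltW.
by rewrite ut0 sub0mx.
Qed.

(** No index is counted twice: a nonzero [u s] on two of the lines would be a linear relation
    between independent rows. *)
Lemma sum_lines k (f : {ffun 'I_k -> T}) : row_free (rows_of f) ->
  \sum_(i < k) \sum_(s | (u s <= u (f i))%MS) w s =
  \sum_(s | [exists i, (u s <= u (f i))%MS]) w s.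
Proof.
move=> rf; under [LHS]eq_bigr do rewrite big_mkcond/=.
rewrite exchange_big/= [RHS]big_mkcond/=; apply: eq_bigr => s _.
have row_f i : u (f i) = row i (rows_of f) by rewrite rowK.
case: ifPn => [/existsP[i si]|/existsPn nex]; last first.
  by rewrite big1 => // i _; rewrite (negbTE (nex i)).
rewrite (bigD1 i)//= si big1 ?addr0// => j ji; case: ifPn => // sj.
move: si sj; rewrite !row_f => /sub_rVP[a sa] /sub_rVP[b sb].
have : (a *: delta_mx 0 i : 'rV[R]_k) *m rows_of f = (b *: delta_mx 0 j) *m rows_of f.
  by rewrite -!scalemxAl -!rowE -sa -sb.
move=> /(row_free_inj rf)/rowP/(_ i).
rewrite !mxE !eqxx (eq_sym i) (negbTE ji) mulr1 mulr0 => a0.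
by have := u_neq0 s; rewrite sa a0 scale0r eqxx.
Qed.

(** The [n] lines of the tuple share no index and exhaust the total weight [V], so an index off them
    would have weight 0. *)
Lemma lines_cover (f : {ffun 'I_n -> T}) : row_free (rows_of f) ->
  \sum_t w t = V -> (forall t, \sum_(s | (u s <= u t)%MS) w s = V / n%:R) ->
  forall t, exists i, (u t <= u (f i))%MS.
Proof.
move=> rf SV Lt t; apply/existsP; apply: contraT => nt.
have := sum_lines rf; under eq_bigr do rewrite Lt.
rewrite sumr_const card_ord -[V / n%:R *+ n]mulr_natr divfK ?gt_eqF// -SV => /eqP.
rewrite (bigID (fun s => [exists i, (u s <= u (f i))%MS]))/=.
rewrite -subr_eq0 addrAC subrr add0r.
by rewrite (bigD1 t)//= gt_eqF// ltr_pwDl// sumr_ge0// => s _; exact: ltW.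
Qed.

(** The difference of the two sides is a sum of nonnegative terms, one for each independent tuple,
    so every term vanishes; the positive product of weights is then divided out. *)
Let step_eq_off k : indep_sum k.+1 = c k * indep_sum k ->
  forall f : {ffun 'I_k -> T}, row_free (rows_of f) ->
  \sum_(t | ~~ (u t <= rows_of f)%MS) w t = c k.
Proof.
move=> /eqP; rewrite -subr_eq0 indep_sumS mulr_sumr -sumrB.
rewrite psumr_eq0 => [/allP H f rf|f rf]; last first.
  rewrite mulrC -mulrBl mulr_ge0//; last by apply: prodr_ge0 => i _; exact: ltW.
  by rewrite subr_ge0 off_span_weight /c mulrBl mul1r lerB// span_weight.
have := H f (mem_index_enum _); rewrite rf /= mulrC -mulrBl mulf_eq0 subr_eq0.
have -> : \prod_i w (f i) == 0 = false by rewrite gt_eqF// prodr_gt0.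
by rewrite orbF => /eqP.
Qed.

(** The extension step at [k = 0] yields the total weight, the one at [k = 1] the weight of each
    line. Conversely, the lines of a [k]-tuple already carry the maximal weight [k / n * V] of their
    span, so every step is an equality. *)
Lemma indep_sum_eqP : indep_sum n = n`!%:R / n%:R ^+ n * V ^+ n <->
  \sum_t w t = V /\ forall t, \sum_(s | (u s <= u t)%MS) w s = V / n%:R.
Proof.
rewrite -prod_c; split => [En|[SV Lt]].
  have r1 k : (k <= n)%N -> ratio k = 1.
    move=> kn; apply/eqP; rewrite eq_le -{2}ratio0 ratio_le ?leq0n// andbT.
    have -> : 1 = ratio n by rewrite /ratio En mulfV// gt_eqF// prod_gt0.
    by rewrite ratio_le// kn leqnn.
  have step k : (k < n)%N -> indep_sum k.+1 = c k * indep_sum k.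
    move=> kn; have := r1 _ kn; have := r1 _ (ltnW kn); rewrite /ratio.
    have pk := prod_gt0 (ltnW kn); have pk1 := prod_gt0 kn.
    move=> /(canRL (divfK (lt0r_neq0 pk))) -> /(canRL (divfK (lt0r_neq0 pk1))) ->.
    by rewrite !mul1r big_ord_recr mulrC.
  have SV : \sum_t w t = V.
    have f0 : row_free (rows_of (ffun0 (card_ord 0))) by rewrite /row_free -leqn0 rank_leq_row.
    have := step_eq_off (step 0%N n_gt0) f0.
    rewrite /c mul0r subr0 mul1r => <-; apply: eq_bigl => t.
    by rewrite (flatmx0 (rows_of _)) eqmx0 submx0 u_neq0.
  (* In dimension 1 the step at [k = 1] is out of range, but the only line is the whole space. *)
  split => // t; have [n1|n1] := leqP n 1.
    have n1E : n = 1%N by apply/eqP; rewrite eqn_leq n1.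
    have -> : V / n%:R = V by rewrite [in n%:R]n1E divr1.
    rewrite -SV; apply: eq_bigl => s; apply: submx_full.
    by rewrite /row_full rank_rV u_neq0 [X in _ == X]n1E.
  pose f : {ffun 'I_1 -> T} := [ffun=> t].
  have fE : rows_of f = u t by apply/rowP => i; rewrite mxE ffunE.
  have rf : row_free (rows_of f) by rewrite /row_free fE rank_rV u_neq0.
  have := step_eq_off (step 1%N n1) rf.
  rewrite off_span_weight fE SV /c mulrBl mul1r mulrC mulr1n.
  by rewrite div1r [V / _]mulrC => /addrI/oppr_inj.
have step k : indep_sum k.+1 = c k * indep_sum k.
  rewrite indep_sumS mulr_sumr; apply: eq_bigr => f rf; rewrite mulrC; congr (_ * _).
  rewrite off_span_weight SV /c mulrBl mul1r; congr (_ - _).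
  apply/eqP; rewrite eq_le span_weight//=.
  have -> : k%:R / n%:R * V = \sum_(i < k) \sum_(s | (u s <= u (f i))%MS) w s.
    by under eq_bigr do rewrite Lt; rewrite sumr_const card_ord -mulr_natr; ring.
  rewrite sum_lines// [leRHS]big_mkcond [leLHS]big_mkcond/=.
  apply: ler_sum => s _; case: ifPn => [/existsP[i si]|_]; last first.
    by case: ifP => // _; exact: ltW.
  by rewrite (submx_trans si)//; have := row_sub i (rows_of f); rewrite rowK.
have : forall k, indep_sum k = \prod_(i < k) c i.
  by elim=> [|k IH]; [rewrite indep_sum0 big_ord0|rewrite step IH big_ord_recr mulrC].
exact.
Qed.

End independent_tuples.

(** * Equality case *)

Section equality_case.
Context {R : realType} (n : nat) (P : set 'rV[R]_n).
Hypotheses (n_gt0 : (0 < n)%N) (Ppoly : polytope P) (Pint : internal0 P).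
Variables (T : finType) (F : T -> set 'rV[R]_n) (u : T -> 'rV[R]_n).
Hypotheses (F_inj : injective F) (facetsF : forall G, facet P G <-> exists t, G = F t)
  (Fu : forall t, exposed_by P (u t) 1 (F t)) (Fspans : forall t, spans (F t)).

Lemma facet_nonempty t : exists q, F t q.
Proof.
have [M _ FM] := spans_unitmx (@Fspans t).
by exists (row (Ordinal n_gt0) M).
Qed.

Lemma facet_functional_neq0 t : u t != 0.
Proof.
have [q Fq] := facet_nonempty t; apply/eqP => u0.
have [_ FE] := Fu t; move: Fq; rewrite FE => -[_ /=]; rewrite u0 dotpC dotp0.
by move=> /esym/eqP; rewrite oner_eq0.
Qed.

(** Unit normals are positive multiples of the functionals [u], and rescaling rows is multiplication
    by an invertible diagonal matrix, so both families are independent together. *)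
Lemma indep_facetsE : indep_facets P =
  [set (fun k => F (f k)) | f in [set f : {ffun 'I_n -> T} | row_free (rows_of u f)]].
Proof.
have scale_free (f : {ffun 'I_n -> T}) (c : 'I_n -> R) (A : 'M[R]_n) :
    (forall k, 0 < c k) -> (forall k, row k A = c k *: u (f k)) ->
    row_free A = row_free (rows_of u f).
  move=> c0 AE; pose D := diag_mx (\row_k c k).
  have uD : D \in unitmx.
    rewrite unitmxE det_diag unitfE; apply/prodf_neq0 => k _.
    by rewrite mxE gt_eqF.
  have -> : A = D *m rows_of u f.
    apply/matrixP => k j; rewrite mul_diag_mx !mxE.
    by have /rowP/(_ j) := AE k; rewrite !mxE.
  by rewrite /row_free eqmxMfull// row_full_unit.
apply/seteqP; split => [G [facG [A [An Af]]]|_ [f rf <-]].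
  have /choice[f fE] k : exists t, G k = F t by apply/facetsF.
  have /choice[c cE] k : exists c : R, 0 < c /\ row k A = c *: u (f k).
    have [|c c0 cE] := outer_unit_normal_exposed Pint (Fu (f k)) (@Fspans (f k)) (a := row k A).
      by rewrite -fE.
    by exists c.
  exists [ffun k => f k]; last by apply/funext => k; rewrite ffunE fE.
  rewrite /= -(@scale_free _ c A)// => k; first by case: (cE k).
  by rewrite ffunE; case: (cE k).
split => [k|]; first by apply/facetsF; exists (f k).
exists (\matrix_k ((Num.sqrt (dotp (u (f k)) (u (f k))))^-1 *: u (f k))); split.
  move=> k; rewrite rowK.
  exact: exposed_outer_unit_normal (Fu (f k)) (facet_functional_neq0 (f k)).
rewrite (@scale_free f (fun k => (Num.sqrt (dotp (u (f k)) (u (f k))))^-1))//.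
  by move=> k; rewrite invr_gt0 sqrtr_gt0 dotp_gt0// facet_functional_neq0.
by move=> k; rewrite rowK.
Qed.

Lemma UfunE : Ufun P = indep_sum u (fun t => vol (cone0 (F t))) n `^ n%:R^-1.
Proof.
rewrite /Ufun indep_facetsE fsbig_image; last first.
  move=> f g _ _ fg; apply/ffunP => k.
  by have := congr1 (fun h => h k) fg; exact: F_inj.
congr (_ `^ _); rewrite fsbig_mkcond fsbig_finType /indep_sum [RHS]big_mkcond.
apply: eq_bigr => f _; rewrite patchE; congr (if _ then _ else _).
by apply/idP/idP => [/set_mem|rf]; [|exact/mem_set].
Qed.

(* A point of the intersection of the facet half-spaces is a limit of points of
   [P], since almost every point lies in the cone over a facet. *)
Lemma polytope_halfspaces x : (forall t, dotp (u t) x <= 1) -> P x.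
Proof.
move=> xQ; have [N [mN N0 NP]] := cone_cover n_gt0 Ppoly Pint.
have Pconvex := polytope_convexV Ppoly.
have QP y : ~ N y -> (forall t, dotp (u t) y <= 1) -> P y.
  move=> /NP[v [G [ev sG vy Gy]]] yQ.
  have [t Gt] : exists t, G = F t by apply/facetsF; exact: exposed_facet ev sG.
  have vE : v = u t by apply: exposed_inj ev _ sG; rewrite Gt.
  have PGy : P ((dotp v y)^-1 *: y) by case: ev => _ GE; move: Gy; rewrite {1}GE => -[].
  have -> : y = dotp v y *: ((dotp v y)^-1 *: y) by rewrite scalerA mulfV ?scale1r ?gt_eqF.
  by apply: convexV_star => //; rewrite (ltW vy)/= vE.
have [e e0 eP] := Pint.
apply: (polytope_closed Ppoly) => B /nbhs_rVP[r r0 rB].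
pose c := \sum_j `|x ord0 j|; have c0 : 0 <= c by exact: sumr_ge0.
have ce : 0 < c + e + 1 by rewrite addr_gt0// ltr_wpDl.
(* Contracting [x] by [1 - d] leaves room for [d] times the cube of half-width [e] inside [P]; the
   first bound keeps the resulting box within [r] of [x], the second keeps [d < 1]. *)
pose d := Num.min (r / (c + e + 1)) 2^-1.
have d0 : 0 < d by rewrite lt_min divr_gt0//= invr_gt0.
have d1 : d < 1 by rewrite gt_min invf_lt1// ltr1n orbT.
have dr : d * (c + e + 1) <= r by rewrite -ler_pdivlMr// ge_min lexx.
pose x0 := (1 - d) *: x.
pose I i := `](x0 ord0 i - d * e), (x0 ord0 i + d * e)[%classic.
pose A := [set z : 'rV[R]_n | forall i, I i (z ord0 i)].
have mA : measurable A.
  by apply: (measurable_rV_box (A := I)) => i; exact: measurable_itv.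
have de0 : 0 < d * e by rewrite mulr_gt0.
have A0 : (0 < lebesgue_rV n A)%E.
  apply: (@lebesgue_rV_gt0 R n (d * e) A x0) => // z zx i.
  by rewrite /I/= in_itv/= -ltr_distl distrC.
have [z [Az Nz]] : exists z, A z /\ ~ N z.
  apply/not_existsP => AN; move: A0; rewrite ltNge => /negP; apply.
  rewrite -N0; apply: le_measure; rewrite ?inE// => z Az.
  by apply: contrapT => Nz; apply: (AN z).
have zx i : `|z ord0 i - x0 ord0 i| < d * e by have := Az i; rewrite /I/= in_itv/= -ltr_distl.
exists z; split.
  apply: QP => // t.
  have -> : z = (1 - d) *: x + d *: (d^-1 *: (z - x0)).
    by rewrite scalerA mulfV ?gt_eqF// scale1r addrC subrK.
  rewrite dotpD !dotpZ -/x0.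
  have Pz : P (d^-1 *: (z - x0)).
    apply: eP => i; rewrite mxE normrM gtr0_norm ?invr_gt0// mulrC ltr_pdivrMr//.
    by rewrite mulrC; have := zx i; rewrite !mxE.
  have := xQ t; have [u1 _] := Fu t; have := u1 _ Pz; rewrite dotpZ => h1 h2.
  have : (1 - d) * dotp (u t) x <= (1 - d) * 1 by rewrite ler_pM2l ?subr_gt0.
  have : d * (d^-1 * dotp (u t) (z - x0)) <= d * 1 by rewrite ler_pM2l.
  lra.
apply: rB => i.
have -> : x ord0 i - z ord0 i = d * x ord0 i - (z ord0 i - x0 ord0 i) by rewrite !mxE; ring.
apply: le_lt_trans (ler_normB _ _) _; rewrite normrM (gtr0_norm d0).
apply: lt_le_trans dr.
have h : d * `|x ord0 i| <= d * c by rewrite ler_pM2l// coord_le_sum.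
have := zx i; have -> : d * (c + e + 1) = d * c + d * e + d by ring.
lra.
Qed.

(* For each functional [rows_of u f i] the family contains a positive and a
   negative multiple of it, otherwise [P] would contain a ray; so [P] is cut
   out by [n] independent pairs of parallel hyperplanes. *)
Lemma parallelotope_of_lines (f : {ffun 'I_n -> T}) : row_free (rows_of u f) ->
  (forall t, exists i, (u t <= u (f i))%MS) -> parallelotope P.
Proof.
set M := rows_of u f => rf cov; have uM : M \in unitmx by rewrite -row_free_unit.
have uMT : M^T \in unitmx by rewrite unitmx_tr.
pose y (x : 'rV[R]_n) := x *m M^T.
have yE x i : dotp (u (f i)) x = y x ord0 i.
  by rewrite dotpC dotpE /y !mxE; apply: eq_bigr => j _; rewrite !mxE.
have /choice[ic icP] t : exists ic : 'I_n * R, u t = ic.2 *: u (f ic.1).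
  by have [i /sub_rVP[c ->]] := cov t; exists (i, c).
pose i_ t := (ic t).1; pose c_ t := (ic t).2.
have uE t x : dotp (u t) x = c_ t * y x ord0 (i_ t) by rewrite icP dotpZl yE.
have [r r0 Pr] := polytope_bounded Ppoly.
have c_neq0 t : c_ t != 0.
  by apply: contra_neq (facet_functional_neq0 t) => c0; rewrite icP -/(c_ t) c0 scale0r.
have ray i (s : R) : (s != 0) -> exists t, i_ t = i /\ 0 < s * c_ t.
  move=> s0; apply/not_existsP => nt.
  (* Only the functionals on the [i]-th line are nonzero on [v]. If none of them has the sign of
     [s], no functional is positive on [v], and a whole ray lies in the bounded set [P]. *)
  pose v : 'rV[R]_n := s *: delta_mx ord0 i *m invmx M^T.
  have yv : y v = s *: delta_mx ord0 i by rewrite /y mulmxKV.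
  have [j vj] : exists j, v ord0 j != 0.
    apply/not_existsP => vN; have v0 : v = 0.
      by apply/rowP => j; have /negP := vN j; rewrite negbK [RHS]mxE => /eqP.
    move: yv; rewrite v0 /y mul0mx => /rowP/(_ i); rewrite !mxE !eqxx mulr1 => /esym/eqP.
    by rewrite (negbTE s0).
  have Pv (k : R) : 0 <= k -> P (k *: v).
    move=> k0; apply: polytope_halfspaces => t; rewrite dotpZ uE yv !mxE eqxx/=.
    have [ti|ti] := eqVneq (i_ t) i; last by rewrite !mulr0.
    rewrite mulr1 (le_trans _ ler01)// mulr_ge0_le0// leNgt; apply/negP => sc.
    by apply: (nt t); rewrite mulrC.
  have := Pr _ (Pv ((r + 1) / `|v ord0 j|) _) j.
  rewrite divr_ge0 ?addr_ge0// => /(_ isT); rewrite mxE normrM normf_div normr_id.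
  rewrite divfK ?normr_eq0// ger0_norm ?addr_ge0// => ?; lra.
have /choice[p pP] i : exists t, i_ t = i /\ 0 < c_ t.
  by have [|t [ti tc]] := ray i 1; [exact: oner_neq0|exists t; rewrite mul1r in tc].
have /choice[q qP] i : exists t, i_ t = i /\ c_ t < 0.
  have [|t [ti tc]] := ray i (-1); first by rewrite oppr_eq0 oner_neq0.
  by exists t; rewrite mulN1r oppr_gt0 in tc.
pose a i := (c_ (p i))^-1; pose b i := (c_ (q i))^-1.
have a0 i : 0 < a i by rewrite invr_gt0; case: (pP i).
have b0 i : b i < 0 by rewrite invr_lt0; case: (qP i).
(* On the facet of [t] the common coordinate is [1 / c_ t], and the functional of [t'] is at most 1
   there. *)
have cross t t' : i_ t = i_ t' -> c_ t' * (c_ t)^-1 <= 1.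
  move=> tt'; have [x Fx] := facet_nonempty t.
  have [_ FE] := Fu t; move: Fx; rewrite FE => -[Px /=]; rewrite uE => ux.
  have [+ _] := Fu t'; move=> /(_ x Px); rewrite uE -tt'; apply: le_trans.
  rewrite le_eqVlt; apply/orP; left; apply/eqP; congr (_ * _).
  by rewrite -[LHS]mul1r -ux mulrAC mulfV ?mul1r.
have PE x : P x <-> forall i, b i <= y x ord0 i <= a i.
  split => [Px i|xab].
    have [pi pc] := pP i; have [qi qc] := qP i.
    have [/(_ x Px) + _] := Fu (p i); rewrite uE pi => h1.
    have [/(_ x Px) + _] := Fu (q i); rewrite uE qi => h2.
    rewrite /a /b -[(c_ (p i))^-1]mul1r -[(c_ (q i))^-1]mul1r.
    by rewrite ler_ndivrMr// ler_pdivlMr// ![y x ord0 i * _]mulrC h1 h2.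
  apply: polytope_halfspaces => t; rewrite uE.
  have /andP[bi ai] := xab (i_ t).
  have [pi pc] := pP (i_ t); have [qi qc] := qP (i_ t).
  have := c_neq0 t; rewrite neq_lt => /orP[ct|ct].
    by apply: le_trans (cross _ _ qi); rewrite ler_nM2l.
  by apply: le_trans (cross _ _ pi); rewrite ler_pM2l.
(* In the coordinates [y] the set [P] is the box with sides [[b i, a i]], the image of the unit cube
   under [D] and a translation. *)
pose D := diag_mx (\row_i (a i - b i)).
have uD : D \in unitmx.
  rewrite unitmxE det_diag unitfE; apply/prodf_neq0 => k _.
  by rewrite mxE gt_eqF// subr_gt0 (lt_trans (b0 k)).
exists (D *m invmx M^T), ((\row_i b i) *m invmx M^T); split.
  by rewrite unitmx_mul uD unitmx_inv.
have ab i : 0 < a i - b i by rewrite subr_gt0 (lt_trans (b0 i)).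
apply/seteqP; split => [x /PE xab|_ [z z01 <-]].
  exists (\row_i ((y x ord0 i - b i) / (a i - b i))).
    move=> i; rewrite [X in _ <= X <= _]mxE; have /andP[bi ai] := xab i.
    apply/andP; split; first by rewrite divr_ge0 ?(ltW (ab i))// subr_ge0.
    by rewrite ler_pdivrMr// mul1r lerD2r.
  rewrite mulmxA -mulmxDl -[RHS](mulmxK uMT) -/(y x); congr (_ *m _).
  move: (y x) => yx; apply/rowP => i.
  by rewrite mxE mul_mx_diag !mxE divfK ?gt_eqF// subrK.
apply/PE => i; rewrite /y mulmxDl mulmxA !mulmxKV// mxE mul_mx_diag !mxE.
have /andP[z0 z1] := z01 i; rewrite lerDr mulr_ge0 ?(ltW (ab i))//=.
by rewrite -lerBrDr ler_piMl// ltW.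
Qed.

(* If the functional of a facet had two nonzero coordinates with respect to the
   edges, two independent linear functionals would be constant on the facet. *)
Lemma parallelotope_lines (L : 'M[R]_n) (b : 'rV[R]_n) : L \in unitmx ->
  P = [set x *m L + b | x in unit_cube] ->
  forall t, exists i, (u t <= row i (invmx L^T))%MS.
Proof.
move=> uL PE t; have uLT : L^T \in unitmx by rewrite unitmx_tr.
have [u1 FE] := Fu t.
have [v uv] : exists v, u t = v *m invmx L^T.
  by exists (u t *m L^T); rewrite mulmxK.
have uzE z : dotp (u t) (z *m L + b) = dotp v z + dotp (u t) b.
  by rewrite dotpD uv !dotp_mulmx trmx_inv trmxK mulmxK.
pose h i := if 0 < v ord0 i then 1 else 0 : R.
(* The facet maximizes the functional over the cube, so a coordinate with nonzero coefficient sits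
   at the end [h i] favoured by its sign: moving it there, to [z'], would otherwise increase the
   functional. *)
have face_coord i z : v ord0 i != 0 -> unit_cube z -> F t (z *m L + b) -> z ord0 i = h i.
  move=> vi z01 Fz.
  pose z' := z + (h i - z ord0 i) *: delta_mx ord0 i.
  have z'01 : unit_cube z'.
    move=> j; rewrite !mxE eqxx/=.
    have [->|_] := eqVneq j i; last by rewrite mulr0 addr0; exact: z01.
    by rewrite mulr1 subrKC /h; case: ifP; rewrite ?lexx ?ler01.
  have Pz' : P (z' *m L + b) by rewrite PE; exists z'.
  have uz : dotp (u t) (z *m L + b) = 1 by move: Fz; rewrite FE => -[].
  have := u1 _ Pz'; rewrite -uz !uzE lerD2r dotpD dotpZ (dotpC v (delta_mx _ _)) dotp_delta.
  rewrite -subr_le0 addrAC subrr add0r => H.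
  have /andP[zi0 zi1] := z01 i; apply/eqP; rewrite eq_sym -subr_eq0.
  move: H; rewrite /h; move: vi; rewrite neq_lt => /orP[vi|vi].
    rewrite ltNge (ltW vi)/= nmulr_lle0// => H; rewrite sub0r in H *.
    by rewrite eq_le H oppr_le0 zi0 andbT.
  by rewrite vi pmulr_lle0// => H; rewrite eq_le H subr_ge0.
pose g i := row i (invmx L^T).
have gE i z : dotp (g i) (z *m L + b) = z ord0 i + dotp (g i) b.
  rewrite dotpD; congr (_ + _); rewrite /g rowE dotp_mulmx dotp_delta.
  by rewrite trmx_inv trmxK mulmxK.
have g_const i x : v ord0 i != 0 -> F t x -> dotp (g i) x = h i + dotp (g i) b.
  move=> vi Fx; have [Px _] : P x /\ dotp (u t) x = 1 by move: Fx; rewrite FE => -[].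
  move: Px Fx; rewrite PE => -[z z01 <-] Fz.
  by rewrite gE (face_coord i z).
have g_neq0 i : g i != 0.
  apply/eqP => gi0; have := gE i (delta_mx ord0 i); rewrite gi0 !(dotpC 0) !dotp0 addr0.
  by rewrite mxE !eqxx => /eqP; rewrite eq_sym oner_eq0.
have v0 : v != 0.
  by apply: contraNneq (facet_functional_neq0 t) => v0; rewrite uv v0 mul0mx.
have [i vi] : exists i, v ord0 i != 0.
  apply/not_existsP => vN; move/eqP: v0; apply; apply/rowP => i.
  by have /negP := vN i; rewrite negbK [RHS]mxE => /eqP.
exists i; suff vE : v = v ord0 i *: delta_mx ord0 i.
  by rewrite uv vE -scalemxAl -rowE scalemx_sub.
apply/rowP => j; rewrite !mxE eqxx/=; have [->|ji] := eqVneq j i; first by rewrite mulr1.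
rewrite mulr0; apply/eqP; apply: contraT => vj; exfalso.
pose ai := h i + dotp (g i) b; pose aj := h j + dotp (g j) b.
(* Two affine constraints on the facet combine to a linear one, which [spans] makes zero.
   Independence gives [aj = 0], so [g j] itself vanishes on the facet and is zero, which is
   absurd. *)
have comb : aj *: g i - ai *: g j = 0.
  apply: (@Fspans t) => x Fx.
  rewrite dotpBl !dotpZl (g_const i x)// (g_const j x)//.
  by rewrite /ai /aj; ring.
have := congr1 (fun w => w *m L^T) comb; rewrite mulmxBl -!scalemxAl /g !rowE !mulmxKV// mul0mx.
move=> /rowP/(_ i); rewrite !mxE !eqxx (eq_sym i) (negbTE ji) mulr1 mulr0 subr0 => aj0.
have := g_neq0 j; rewrite -[_ != _]negbK => /negP; apply; rewrite negbK; apply/eqP.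
by apply: (@Fspans t) => x Fx; rewrite (g_const j x).
Qed.

End equality_case.

(** * Taking roots, and the final inequality with its equality case *)

Lemma powR_exprn_inv {R : realType} (n : nat) (x : R) : (0 < n)%N -> 0 <= x ->
  (x ^+ n) `^ n%:R^-1 = x.
Proof.
move=> n0 x0; rewrite -powR_mulrn// -powRrM mulfV ?powRr1//.
by rewrite pnatr_eq0 -lt0n.
Qed.

Lemma powR_inv_exprn {R : realType} (n : nat) (x : R) : (0 < n)%N -> 0 <= x ->
  (x `^ n%:R^-1) ^+ n = x.
Proof.
move=> n0 x0; rewrite -powR_mulrn ?powR_ge0// -powRrM mulVf ?powRr1//.
by rewrite pnatr_eq0 -lt0n.
Qed.

Unset Implicit Arguments.

Theorem theorem1p2 (R : realType) (n : nat) (n_gt0 : (0 < n)%N)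
    (P : set 'rV[R]_n) (P_polytope : polytope P)
    (P_int0 : interior P 0) (P_centroid : centroid P = 0) :
  Ufun P >= (n`!%:R `^ n%:R^-1) / n%:R * vol P /\
  (Ufun P = (n`!%:R `^ n%:R^-1) / n%:R * vol P <-> parallelotope P).
Proof.
have Pint := interior_internal0 P_int0.
have Pcent := centroid_centered P_polytope Pint P_centroid.
have V0 := vol_gt0 P_polytope Pint.
have [T [F [u [Finj facetsF Fu Fspans]]]] := facet_family n_gt0 P_polytope Pint.
pose w t := vol (cone0 (F t)).
have w0 t : 0 < w t by exact: (cone_vol_gt0 n_gt0 P_polytope Fu Fspans t).
have SV : vol P <= \sum_t w t by exact: (vol_le_sum_cone_vol n_gt0 P_polytope Pint facetsF Fu).
have conc (U : 'M[R]_n) : \sum_(t | (u t <= U)%MS) w t <= (\rank U)%:R / n%:R * vol P.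
  exact: (subspace_concentration n_gt0 P_polytope Pint Finj Fu Fspans U Pcent).
have nR : 0 < n%:R :> R by rewrite ltr0n.
pose B : R := n`!%:R / n%:R ^+ n * vol P ^+ n.
have B0 : 0 <= B by rewrite mulr_ge0 ?divr_ge0 ?exprn_ge0 ?ltW.
have BE : (n`!%:R `^ n%:R^-1) / n%:R * vol P = B `^ n%:R^-1.
  have -> : B = n`!%:R * (vol P / n%:R) ^+ n by rewrite expr_div_n /B; ring.
  rewrite powRM ?exprn_ge0 ?divr_ge0 ?ltW// powR_exprn_inv ?divr_ge0 ?ltW//.
  by rewrite mulrAC mulrA.
rewrite BE (UfunE n_gt0 Pint Finj facetsF Fu Fspans) -/w.
have E0 := indep_sum_ge0 u w0 n.
have BEn := indep_sum_ge n_gt0 V0 w0 SV conc; rewrite -/B in BEn.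
split.
  by apply: ge0_ler_powR => //; rewrite ?nnegrE// invr_ge0 ltW.
have -> : (indep_sum u w n `^ n%:R^-1 = B `^ n%:R^-1) <-> (indep_sum u w n = B).
  split=> [H|->//]; have := congr1 (fun x => x ^+ n) H.
  by rewrite !powR_inv_exprn.
rewrite (indep_sum_eqP n_gt0 V0 w0 SV conc); split => [[SVE Lt]|[L [b [uL PE]]]].
  (* An independent tuple exists because the total weight of such tuples is at least [B], which is
     positive. *)
  have [f rf] : exists f : {ffun 'I_n -> T}, row_free (rows_of u f).
    apply/not_existsP => nf; have : 0 < indep_sum u w n.
      by rewrite (lt_le_trans _ BEn)// !mulr_gt0 ?invr_gt0 ?exprn_gt0 ?ltr0n ?fact_gt0.
    by rewrite /indep_sum big1 ?ltxx// => f rf; case: (nf f).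
  apply: (parallelotope_of_lines n_gt0 P_polytope Pint facetsF Fu Fspans rf).
  exact: (lines_cover n_gt0 w0 conc rf SVE Lt).
have lines := parallelotope_lines n_gt0 Fu Fspans uL PE.
(* By concentration each of the [n] lines carries at most [vol P / n], yet together they contain all
   functionals, of weight at least [vol P]; so each carries exactly [vol P / n]. *)
pose ell i := \sum_(t | (u t <= row i (invmx L^T))%MS) w t.
have ell_le i : ell i <= vol P / n%:R.
  have -> : ell i = \sum_(t | (u t <= <<row i (invmx L^T)>>)%MS) w t.
    by apply: eq_bigl => t; rewrite genmxE.
  apply: le_trans (conc _) _; rewrite genmxE mulrC ler_pM2l// ler_pdivrMr//.
  by rewrite mulVf ?gt_eqF// lern1 rank_leq_row.
have sum_ell : \sum_t w t <= \sum_i ell i.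
  under [leRHS]eq_bigr do rewrite /ell big_mkcond/=.
  rewrite exchange_big/=; apply: ler_sum => t _; have [i ti] := lines t.
  rewrite (bigD1 i)//= ti lerDl; apply: sumr_ge0 => j _.
  by case: ifP => // _; exact: ltW.
have sum_ell_le : \sum_i ell i <= vol P.
  apply: (@le_trans _ _ (\sum_(i < n) vol P / n%:R)); first exact: ler_sum.
  by rewrite sumr_const card_ord -[leLHS]mulr_natr divfK ?gt_eqF.
have ellE i : ell i = vol P / n%:R.
  have : \sum_(i < n) (vol P / n%:R - ell i) == 0.
    rewrite sumrB sumr_const card_ord -[X in X - _]mulr_natr.
    rewrite (divfK (lt0r_neq0 nR)).
    by rewrite subr_eq0 eq_le sum_ell_le (le_trans SV)// sum_ell.
  rewrite psumr_eq0; last by move=> j _; rewrite subr_ge0.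
  by move=> /allP/(_ i); rewrite mem_index_enum subr_eq0 => /(_ isT)/eqP.
split; first by apply/eqP; rewrite eq_le SV (le_trans sum_ell).
move=> t; have [i ti] := lines t; rewrite -(ellE i); apply: eq_bigl => s.
have ut0 := facet_functional_neq0 n_gt0 Fu Fspans t.
have /sub_rVP[c utE] := ti.
have c0 : c != 0 by apply: contraNneq ut0 => c0; rewrite utE c0 scale0r.
by rewrite utE (eqmx_scale _ c0).
Qed.
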